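(* Let $h_1,h_2,h_3\in\mathbb R$ with $h_1^2\geq h_2^2\geq h_3^2$ and $P>0$. The sum-capacity $C_N$ of the (non-restricted) Gaussian Y-channel with gains $h_1,h_2,h_3$ and power $P$ satisfies $C_N\geq\underline{C}_3$, where $\underline{C}_3$ is the maximum, over $\alpha_{12},\alpha_{23},\alpha_{31}\in[0,1]$ with $\alpha_{12}+\alpha_{23}+\alpha_{31}=1$, of $$2\alpha_{12}\min\Big\{C^+\big(h_2^2P_{21}^*-\tfrac12\big),C(h_2^2P)\Big\}+2\alpha_{23}\min\Big\{C^+\big(h_3^2P_{31}^*-\tfrac12\big),C(h_3^2P)\Big\}+2\alpha_{31}\min\Big\{C^+\big(h_3^2P_{32}^*-\tfrac12\big),C(h_3^2P)\Big\},$$ where $$h_2^2P_{21}^*=\min\Big\{\tfrac{h_1^2P}{\alpha_{12}+\alpha_{31}},\tfrac{h_2^2P}{\alpha_{12}+\alpha_{23}}\Big\},\quad h_3^2P_{31}^*=\min\Big\{\tfrac{h_1^2P}{\alpha_{12}+\alpha_{31}},\tfrac{h_3^2P}{\alpha_{23}+\alpha_{31}}\Big\},\quad h_3^2P_{32}^*=\min\Big\{\tfrac{h_2^2P}{\alpha_{12}+\alpha_{23}},\tfrac{h_3^2P}{\alpha_{23}+\alpha_{31}}\Big\}.$$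
   Context: $C(x)=\frac12\log_2(1+x)$ and $C^+(x)=\max\{0,C(x)\}$. A fraction with zero denominator and positive numerator is interpreted as $+\infty$ (so the minimum picks the other argument). The (non-restricted, reciprocal) Gaussian Y-channel with real gains $h_1,h_2,h_3$ and power $P>0$: users $1,2,3$ and a relay $r$. For each ordered pair $(j,k)$ of distinct indices in $\{1,2,3\}$, user $j$ holds a message $m_{jk}$, uniform on $\{1,\dots,2^{nR_{jk}}\}$, intended for user $k$; the six messages are mutually independent. Over channel uses $i=1,\dots,n$, the relay receives $Y_{ri}=h_1X_{1i}+h_2X_{2i}+h_3X_{3i}+Z_{ri}$ and user $j$ receives $Y_{ji}=h_jX_{ri}+Z_{ji}$, all noise samples i.i.d. $\mathcal N(0,1)$ independent of the messages. Encoders $X_{ji}=f_{ji}(m_{jk},m_{jl},Y_j^{i-1})$ ($\{k,l\}=\{1,2,3\}\setminus\{j\}$), relay $X_{ri}=f_{ri}(Y_r^{i-1})$, power constraints $\frac1n\sum_i\mathbb E[X_{ai}^2]\le P$ for $a\in\{1,2,3,r\}$; user $j$ estimates $(m_{kj},m_{lj})$ from $(Y_j^n,m_{jk},m_{jl})$. A rate tuple is achievable if codes exist whose error probability tends to $0$ as $n\to\infty$; $C_N$ is the supremum of $\sum_{j\ne k}R_{jk}$ over achievable tuples. *)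

(* Defs.v *)
From HB Require Import structures.
From mathcomp Require Import all_boot all_order all_algebra.
From mathcomp Require Import all_classical all_reals all_analysis.
From mathcomp Require Import normal_distribution.
Set Implicit Arguments. Unset Strict Implicit. Unset Printing Implicit Defensive.
Import Order.TTheory GRing.Theory Num.Theory.
Import numFieldNormedType.Exports.
Local Open Scope classical_set_scope.
Local Open Scope ring_scope.

Definition Cap {R : realType} (x : R) : R := ln (1 + x) / (2 * ln 2).
Definition Capp {R : realType} (x : R) : R := Num.max 0 (Cap x).

(* min{a/b, c/d} with the convention that a fraction with zero
   denominator is +oo (so the minimum picks the other argument). *)
Definition minfrac {R : realType} (a b c d : R) : R :=
  if b == 0 then c / d else if d == 0 then a / b else Num.min (a / b) (c / d).

Definition C3_objective {R : realType} (h1 h2 h3 P a12 a23 a31 : R) : R :=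
  let P21 := minfrac (h1 ^+ 2 * P) (a12 + a31) (h2 ^+ 2 * P) (a12 + a23) in
  let P31 := minfrac (h1 ^+ 2 * P) (a12 + a31) (h3 ^+ 2 * P) (a23 + a31) in
  let P32 := minfrac (h2 ^+ 2 * P) (a12 + a23) (h3 ^+ 2 * P) (a23 + a31) in
  2 * a12 * Num.min (Capp (P21 - 2^-1)) (Cap (h2 ^+ 2 * P))
  + 2 * a23 * Num.min (Capp (P31 - 2^-1)) (Cap (h3 ^+ 2 * P))
  + 2 * a31 * Num.min (Capp (P32 - 2^-1)) (Cap (h3 ^+ 2 * P)).

Definition C3_lower {R : realType} (h1 h2 h3 P : R) : R :=
  sup [set x : R | exists a12 a23 a31 : R,
        [/\ 0 <= a12 <= 1, 0 <= a23 <= 1, 0 <= a31 <= 1,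
            a12 + a23 + a31 = 1 & x = C3_objective h1 h2 h3 P a12 a23 a31]].

(* Users 1,2,3 are indexed by 'I_3 (0,1,2); nodes are option 'I_3,     *)
(* with None = the relay.  Time instants i = 1..n are 0..n-1.          *)

(* ordered pairs (j,k) of distinct users: message m_jk from j to k *)
Definition pair3 := {p : 'I_3 * 'I_3 | p.1 != p.2}.

Definition msgs (M : pair3 -> nat) := {dffun forall p : pair3, 'I_(M p)}.

Definition gain {R : realType} (h1 h2 h3 : R) (j : 'I_3) : R :=
  if val j == 0%N then h1 else if val j == 1%N then h2 else h3.

(* A code.  Encoder of user j at time i: function of its own messages
   (k |-> m_jk, for k <> j) and of its past received signal (only the
   entries at times < i are ever supplied, the rest being 0).  The relay
   maps its past received signal to its transmit symbol.  Decoder of user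
   j: from (Y_j^n, own messages) outputs an estimate of m_kj for each k. *)
Record code (R : realType) := Code {
  enc : 'I_3 -> nat -> ('I_3 -> nat) -> (nat -> R) -> R;
  relay : nat -> (nat -> R) -> R;
  dec : 'I_3 -> (nat -> R) -> ('I_3 -> nat) -> 'I_3 -> nat }.

(* own messages of user j : k |-> m_jk (0 for k = j, unused) *)
Definition own (M : pair3 -> nat) (m : msgs M) (j : 'I_3) : 'I_3 -> nat :=
  fun k => match @insub _ (fun p : 'I_3 * 'I_3 => p.1 != p.2) pair3 (j, k) with
           | Some p => val (m p) | None => 0%N end.

Section channel.
Context {R : realType} (h1 h2 h3 : R) (c : code R) (M : pair3 -> nat) (m : msgs M).
Context (z : nat -> option 'I_3 -> R).

Definition xmit_from (past : nat -> option 'I_3 -> R) (i : nat) (a : option 'I_3) : R :=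
  match a with
  | Some j => enc c j i (own m j) (fun s => past s (Some j))
  | None => relay c i (fun s => past s None)
  end.

Definition recv_from (past : nat -> option 'I_3 -> R) (i : nat) (a : option 'I_3) : R :=
  match a with
  | None => \sum_(j < 3) gain h1 h2 h3 j * xmit_from past i (Some j) + z i None
  | Some j => gain h1 h2 h3 j * xmit_from past i None + z i (Some j)
  end.

Fixpoint past (t : nat) : nat -> option 'I_3 -> R :=
  match t with
  | 0 => fun _ _ => 0
  | t'.+1 => fun s => if (s < t')%N then past t' s
                      else if s == t' then recv_from (past t') t'
                      else fun _ => 0
  end.

Definition xmit (i : nat) (a : option 'I_3) : R := xmit_from (past i) i a.

Definition dec_error (n : nat) : Prop :=
  exists p : pair3,
    dec c (val p).2 (fun s => past n s (Some (val p).2)) (own m (val p).2) (val p).1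
    != val (m p).
End channel.

Definition mutually_independent {d} {Omega : measurableType d} {R : realType}
  (Pr : probability Omega R) {I : eqType} (X : I -> Omega -> R) : Prop :=
  forall (s : seq I), uniq s ->
  forall B : I -> set R, (forall i, measurable (B i)) ->
  Pr (\bigcap_(i in [set` s]) (X i @^-1` B i)) = (\prod_(i <- s) Pr (X i @^-1` B i))%E.

Definition iid_std_normal {d} {Omega : measurableType d} {R : realType}
  (Pr : probability Omega R) (Z : nat -> option 'I_3 -> Omega -> R) : Prop :=
  [/\ forall i a, measurable_fun setT (Z i a),
      forall i a (B : set R), measurable B ->
        Pr (Z i a @^-1` B) = normal_prob 0 1 B
    & mutually_independent Pr (fun ia : nat * option 'I_3 => Z ia.1 ia.2)].

Section achievability.
Context {d} {Omega : measurableType d} {R : realType} (Pr : probability Omega R).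
Context (Z : nat -> option 'I_3 -> Omega -> R) (h1 h2 h3 P : R).

Definition noise (w : Omega) : nat -> option 'I_3 -> R := fun i a => Z i a w.

(* the events/variables involved are measurable (so that probabilities
   and expectations are meaningful) *)
Definition code_measurable (n : nat) (M : pair3 -> nat) (c : code R) : Prop :=
  forall m : msgs M,
    (forall i a, (i < n)%N -> measurable_fun setT
                   (fun w => xmit h1 h2 h3 c m (noise w) i a))
    /\ measurable [set w | dec_error h1 h2 h3 c m (noise w) n].

(* power constraints: (1/n) sum_i E[X_{a,i}^2] <= P, for every node a,
   the expectation being over uniform messages and the noise *)
Definition code_power (n : nat) (M : pair3 -> nat) (c : code R) : Prop :=
  forall a : option 'I_3,
    (\sum_(i < n) \sum_(m : msgs M)
        \int[Pr]_w ((xmit h1 h2 h3 c m (noise w) i a) ^+ 2)%:E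
     <= (n%:R * P * #|{: msgs M}|%:R)%:E)%E.

Definition err_prob (n : nat) (M : pair3 -> nat) (c : code R) : R :=
  (\sum_(m : msgs M) fine (Pr [set w | dec_error h1 h2 h3 c m (noise w) n]))
  / #|{: msgs M}|%:R.

Definition achievable (Rt : pair3 -> R) : Prop :=
  (forall p, 0 <= Rt p) /\
  exists (M : nat -> pair3 -> nat) (c : nat -> code R),
    [/\ forall n p, 2 `^ (n%:R * Rt p) <= (M n p)%:R,
        forall n, code_measurable n (M n) (c n),
        forall n, code_power n (M n) (c n)
      & (fun n => err_prob n (M n) (c n)) @ \oo --> (0 : R)].

Definition sum_capacity : \bar R :=
  ereal_sup [set (\sum_(p : pair3) Rt p)%:E | Rt in achievable].
End achievability.

(* Main.v *)
Require Import Defs.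
From HB Require Import structures.
From mathcomp Require Import all_boot all_order all_algebra.
From mathcomp Require Import all_classical all_reals all_analysis.
From mathcomp Require Import measurable_realfun normal_distribution.
From mathcomp Require Import zify ring lra.
Set Implicit Arguments. Unset Strict Implicit. Unset Printing Implicit Defensive.
Import Order.TTheory GRing.Theory Num.Theory.
Import numFieldNormedType.Exports.
Local Open Scope classical_set_scope.
Local Open Scope ring_scope.

(* Time is shared between pairs of users. Within a slot, the two users of a pair
   send words of cosets of one random F_q-linear code, lifted to centred integers
   and scaled; an auxiliary index is chosen so that the word meets the power
   constraint. The sum of the two words is again in a coset of that code, so the
   relay decodes the sum of the messages by thresholding a distance. The bound
   counts lattice points in balls and gives the rate log2(1/2 + S)/2 at received
   power S. The relay then broadcasts this sum with a random codebook, and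
   each user subtracts its own message. The relay works one round behind the
   users, and the loss of one round out of B + 1 vanishes for large B.

   The slot powers are taken from the objective. The fractions a23 and a31 are both
   split between the pairs {1,3} and {2,3} in one proportion l : 1 - l. By the
   definition of the P_jk*, user 3 spends at most its power, and users 1 and 2
   together spend at most theirs, so some l respects both individual constraints. *)

(** * Moments of the normal distribution *)

(** The term 1/2 in the rate comes from adding two words of power S. Their sum has power about 2S,
    its linear MMSE estimate in unit noise leaves an error of power 2S/(2S+1), and S divided by this
    error is S + 1/2.

    The modulus q faces two opposing demands. It must exceed a multiple of the square root of n, so
    that the real sum of two lifted words does not wrap around, yet be subexponential in n, so that
    factors q cost no rate. Hence a new prime is chosen for each length.

    Splitting the fractions is forced by the objective: its a23 term uses the power P31* of the pair
    {1,3}, but there the power of user 1 is divided by a12 + a31. Serving each term by one fixed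
    pair can overspend: with equal gains, a12 = a23 = 1/2 and a31 = 0, whichever of users 1 and 2
    serves the a23 term would need power 3P/2.

    Power bounds hold for every message and every noise outcome, and errors are added by a union
    bound over slots, so the dependence between slots never has to be analysed. *)

Section normal_moments.
Context {R : realType}.
Notation mu := (@lebesgue_measure R).
Notation N01 := (@normal_prob R 0 1).

(** The density agrees almost everywhere with the Radon-Nikodym derivative because both have the
    same integral over every measurable set. *)
Lemma ge0_integral_normal_prob (f : R -> \bar R) (m s : R) :
  measurable_fun setT f -> (forall x, (0 <= f x)%E) ->
  (\int[normal_prob m s]_x f x = \int[mu]_x (f x * (normal_pdf m s x)%:E))%E.
Proof.
move=> mf f0.
have dom := normal_prob_dominates m s.
rewrite -(Radon_Nikodym_SigmaFinite.change_of_variables dom)//=.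
apply: ae_eq_integral => //.
- apply: emeasurable_funM => //; apply: (measurable_int mu).
  exact: Radon_Nikodym_SigmaFinite.f_integrable.
- apply: emeasurable_funM => //; apply/measurable_EFinP.
  exact: measurable_normal_pdf.
- apply: ae_eqe_mul2l; apply: integral_ae_eq => //.
  + exact: Radon_Nikodym_SigmaFinite.f_integrable.
  + by apply/measurable_EFinP; exact: measurable_normal_pdf.
  + by move=> E _ mE; rewrite -Radon_Nikodym_SigmaFinite.f_integral.
Qed.

Lemma normal_mgf (t : R) :
  (\int[N01]_x (expR (t * x))%:E = (expR (t ^+ 2 / 2))%:E)%E.
Proof.
rewrite ge0_integral_normal_prob; first last.
- by move=> x; rewrite lee_fin expR_ge0.
- by apply/measurable_EFinP; apply: measurableT_comp => //; exact: mulrl_measurable.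
(* Completing the square turns the tilted density into the normal density of mean [t]. *)
transitivity (\int[mu]_x ((expR (t ^+ 2 / 2))%:E * (normal_pdf t 1 x)%:E))%E.
  apply: eq_integral => x _; rewrite -!EFinM; congr EFin.
  rewrite !normal_pdfE ?oner_eq0// /normal_fun !(mulrCA _ (normal_peak 1)) -!expRD.
  by congr (_ * expR _); field.
rewrite ge0_integralZl//; first by rewrite integral_normal_pdf mule1.
- by apply/measurable_EFinP; exact: measurable_normal_pdf.
- by move=> x _; rewrite lee_fin normal_pdf_ge0.
Qed.

Lemma normal_sqr_mgf (t : R) : t < 1 / 2 ->
  (\int[N01]_x (expR (t * x ^+ 2))%:E = ((Num.sqrt (1 - 2 * t))^-1)%:E)%E.
Proof.
move=> t12.
have a0 : 0 < 1 - 2 * t by lra.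
have sa0 : 0 < Num.sqrt (1 - 2 * t) by rewrite sqrtr_gt0.
pose s := (Num.sqrt (1 - 2 * t))^-1.
have s0 : s != 0 by rewrite invr_eq0 gt_eqF.
have s2 : s ^+ 2 = (1 - 2 * t)^-1 by rewrite exprVn sqr_sqrtr// ltW.
rewrite ge0_integral_normal_prob; first last.
- by move=> x; rewrite lee_fin expR_ge0.
- apply/measurable_EFinP; apply: measurableT_comp => //.
  by apply: measurable_funM => //; exact: measurable_funX.
(* The tilted density is, up to the factor [s], the centred normal density of standard deviation
   [s]. *)
transitivity (\int[mu]_x (s%:E * (normal_pdf 0 s x)%:E))%E.
  apply: eq_integral => x _; rewrite -!EFinM; congr EFin.
  have pk : normal_peak 1 = s * normal_peak s.
    rewrite /normal_peak -!mulrnAr expr1n mul1r sqrtrM ?sqr_ge0//.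
    rewrite invfM mulrA sqrtr_sqr ger0_norm.
      by rewrite divff// mul1r.
    by rewrite invr_ge0 ltW.
  rewrite !normal_pdfE ?oner_eq0// /normal_fun pk [LHS]mulrCA -expRD -[LHS]mulrA.
  congr (_ * (_ * expR _)); rewrite s2 !subr0.
  by field; rewrite gt_eqF.
rewrite ge0_integralZl//; first by rewrite integral_normal_pdf mule1.
- by apply/measurable_EFinP; exact: measurable_normal_pdf.
- by move=> x _; rewrite lee_fin normal_pdf_ge0.
- by rewrite lee_fin invr_ge0 ltW.
Qed.

Lemma ge0_integrable_bound d (T : measurableType d) (m : {measure set T -> \bar R})
  (f g : T -> R) : measurable_fun setT f -> (forall x, `|f x| <= g x) ->
  measurable_fun setT g -> (\int[m]_x (g x)%:E < +oo)%E ->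
  m.-integrable setT (EFin \o f).
Proof.
move=> mf fg mg g_fin; apply/integrableP; split; first exact/measurable_EFinP.
apply: le_lt_trans g_fin; apply: ge0_le_integral => //=.
- by apply/measurable_EFinP; exact: measurableT_comp.
- exact/measurable_EFinP.
- by move=> x _; rewrite lee_fin.
Qed.

Let mexpq : measurable_fun setT (fun x : R => expR ((1 / 4) * x ^+ 2)).
Proof.
apply: measurableT_comp => //.
by apply: measurable_funM => //; exact: measurable_funX.
Qed.

(** Squaring [1 + y <= expR y] at [y = x ^+ 2 / 8] produces the quartic term that dominates
    polynomials of degree four. *)
Let expq_lb (x : R) : 1 + x ^+ 2 / 4 + x ^+ 4 / 64 <= expR (1 / 4 * x ^+ 2).
Proof.
have -> : 1 / 4 * x ^+ 2 = x ^+ 2 / 8 + x ^+ 2 / 8 by field.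
have h : 1 + x ^+ 2 / 8 <= expR (x ^+ 2 / 8) by exact: expR_ge1Dx.
have x2 : 0 <= x ^+ 2 / 8 by rewrite divr_ge0 ?sqr_ge0.
rewrite expRD; apply: le_trans (ler_pM _ _ h h); [|lra|lra].
lra.
Qed.

Lemma normal_integrable_poly (f : R -> R) (C : R) : measurable_fun setT f ->
  (forall x, `|f x| <= C * (1 + x ^+ 4)) -> 0 <= C ->
  N01.-integrable setT (EFin \o f).
Proof.
move=> mf fC C0.
apply: (@ge0_integrable_bound _ _ N01 f (fun x => (C * 64) * expR ((1 / 4) * x ^+ 2))) => //.
- move=> x; apply: le_trans (fC x) _; rewrite -mulrA ler_wpM2l//.
  have := expq_lb x; have := sqr_ge0 x; have : 0 <= x ^+ 4 by rewrite exprn_even_ge0.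
  by lra.
- exact: measurable_funM.
under eq_integral do rewrite EFinM.
rewrite ge0_integralZl//; last 2 first.
- exact/measurable_EFinP.
- by rewrite lee_fin mulr_ge0.
by rewrite normal_sqr_mgf; [rewrite ltry|lra].
Qed.

Lemma normal_integrable1 : N01.-integrable setT (EFin \o (id : R -> R)).
Proof.
apply: (@normal_integrable_poly _ 2) => // x.
have h1 := sqr_ge0 (x ^+ 2 - 1/2); have h2 := sqr_ge0 (`|x| - 1).
have e : `|x| ^+ 2 = x ^+ 2 by rewrite real_normK// num_real.
rewrite /=; nra.
Qed.

Lemma normal_integrable2 : N01.-integrable setT (EFin \o (fun x : R => x ^+ 2)).
Proof.
apply: (@normal_integrable_poly _ 1) => //.
move=> x; have h1 := sqr_ge0 (x ^+ 2 - 1).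
rewrite ger0_norm ?sqr_ge0//.
by have := sqr_ge0 (x ^+ 2); nra.
Qed.

Let int1 : N01.-integrable setT (cst 1%E).
Proof. exact: finite_measure_integrable_cst. Qed.

(** Integrating [1 + u <= expR u] at [u = t * x] bounds [t * e], for [e] the mean, by
    [expR (t ^+ 2 / 2) - 1], hence by [t ^+ 2] for small [t]. A [t] with the sign of [e] and size at
    most half of [|e|] contradicts [e != 0]. *)
Lemma normal_mean : (\int[N01]_x x%:E = 0)%E.
Proof.
have fin1 : (\int[N01]_x x%:E)%E \is a fin_num.
  exact: integrable_fin_num normal_integrable1.
have key (t : R) : t * fine (\int[N01]_x x%:E)%E <= expR (t ^+ 2 / 2) - 1.
  rewrite -lee_fin EFinM fineK// EFinB -normal_mgf.
  have i1 : N01.-integrable setT (fun x => (t * x)%:E).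
    by under eq_fun do rewrite EFinM; apply: integrableZl => //; exact: normal_integrable1.
  rewrite -integralZl//; last exact: normal_integrable1.
  rewrite leeBrDr//.
  have <- : (\int[N01]_x (cst 1%E x) = 1)%E.
    by rewrite integral_cst//= probability_setT mul1e.
  rewrite -integralD//=.
  have mt : measurable_fun setT (fun x : R => expR (t * x)).
    by apply: measurableT_comp => //; exact: mulrl_measurable.
  apply: le_integral => //=.
  - exact: integrableD.
  - apply/integrableP; split; first exact/measurable_EFinP.
    under eq_integral do rewrite /= ger0_norm ?expR_ge0//.
    by rewrite normal_mgf ltry.
  - move=> x _; rewrite -EFinD lee_fin addrC; exact: expR_ge1Dx.
set e := fine _ in key.
suff e0 : e = 0 by rewrite -(fineK fin1) -/e e0.
have bound (t : R) : `|t| <= 1 -> expR (t ^+ 2 / 2) - 1 <= t ^+ 2.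
  move=> t1; have t2 : t ^+ 2 <= 1.
    by rewrite -real_normK ?num_real// expr_le1.
  have h : 1 - t ^+ 2 / 2 <= expR (- (t ^+ 2 / 2)) by apply: expR_ge1Dx.
  have t20 := sqr_ge0 t.
  rewrite lerBlDl -(invrK (1 + _)) -[expR _]invrK -expRN.
  have t21 : 0 < 1 + t ^+ 2 by lra.
  rewrite lef_pV2 ?posrE ?invr_gt0 ?expR_gt0//.
  apply: le_trans h; rewrite -div1r ler_pdivrMr//.
  by have := sqr_ge0 (t ^+ 2); nra.
apply/eqP/negPn/negP => e0.
pose t := Num.min 1 (`|e| / 2) * Num.sg e.
have e0' : 0 < `|e| by rewrite normr_gt0.
have m0 : 0 < Num.min 1 (`|e| / 2) by rewrite lt_min ltr01 divr_gt0.
have sg : Num.sg e ^+ 2 = 1 by rewrite sqr_sg e0.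
have t1 : `|t| <= 1.
  by rewrite normrM normr_sg e0 mulr1 gtr0_norm// ge_min lexx.
have := le_trans (key t) (bound t t1).
rewrite /t -mulrA -normrEsg exprMn sg mulr1 expr2 ler_pM2l//.
rewrite le_min => /andP[_ ]; lra.
Qed.

(** The same exponential inequality at [u = t * x ^+ 2] compares the moment with a function of [t]
    of slope 1 at 0. An upper bound suffices: the noise energy only has to stay below a
    threshold. *)
Lemma normal_second_moment : fine (\int[N01]_x (x ^+ 2)%:E)%E <= 1.
Proof.
have fin1 : (\int[N01]_x (x ^+ 2)%:E)%E \is a fin_num.
  exact: integrable_fin_num normal_integrable2.
have key (t : R) : 0 <= t -> t < 1/2 ->
   t * fine (\int[N01]_x (x ^+ 2)%:E)%E <= (Num.sqrt (1 - 2 * t))^-1 - 1.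
  move=> t0 t12; rewrite -lee_fin EFinM fineK// EFinB -normal_sqr_mgf//.
  have i1 : N01.-integrable setT (fun x => (t * x ^+ 2)%:E).
    by under eq_fun do rewrite EFinM; apply: integrableZl => //; exact: normal_integrable2.
  rewrite -integralZl//; last exact: normal_integrable2.
  rewrite leeBrDr//.
  have <- : (\int[N01]_x (cst 1%E x) = 1)%E.
    by rewrite integral_cst//= probability_setT mul1e.
  rewrite -integralD//=.
  have mt : measurable_fun setT (fun x : R => expR (t * x ^+ 2)).
    apply: measurableT_comp => //.
    by apply: measurable_funM => //; exact: measurable_funX.
  apply: le_integral => //=.
  - exact: integrableD.
  - apply/integrableP; split; first exact/measurable_EFinP.
    under eq_integral do rewrite /= ger0_norm ?expR_ge0//.
    by rewrite normal_sqr_mgf// ltry.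
  - move=> x _; rewrite -EFinD lee_fin addrC; exact: expR_ge1Dx.
set e := fine _ in key *.
rewrite leNgt; apply/negP => e1.
(* For [2 t = 1 - s^-2] the bound reads [(s + 1) e <= 2 s^2], and [s] tends to 1. *)
pose u := Num.min 2 ((1 + e) / 2).
have u1 : 1 < u by rewrite lt_min; apply/andP; split; lra.
have ue : u <= (1 + e) / 2 by rewrite ge_min lexx orbT.
have u2 : u <= 2 by rewrite ge_min lexx.
have u0 : 0 < u by lra.
pose s := 1 + (u - 1) / 4.
have s1 : 1 < s by rewrite /s; lra.
have s0 : 0 < s by lra.
pose t := (1 - s ^- 2) / 2.
have si : 0 < s ^- 2 by rewrite invr_gt0 exprn_gt0.
have si1 : s ^- 2 < 1 by rewrite invf_lt1 ?exprn_gt0// exprn_egt1.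
have t0 : 0 <= t by rewrite /t; lra.
have t12 : t < 1/2 by rewrite /t; lra.
have := key _ t0 t12.
have -> : 1 - 2 * t = (s^-1) ^+ 2 by rewrite /t exprVn; field; rewrite gt_eqF.
have sp : 0 <= s^-1 by rewrite invr_ge0 ltW.
rewrite sqrtr_sqr (ger0_norm sp) invrK => h.
have h' : (s ^+ 2 - 1) * e <= 2 * s ^+ 2 * (s - 1).
  have -> : (s ^+ 2 - 1) * e = 2 * s ^+ 2 * (t * e) by rewrite /t; field; rewrite gt_eqF.
  by rewrite ler_pM2l// mulr_gt0// exprn_gt0.
have h2 : (s + 1) * e <= 2 * s ^+ 2.
  have d : 0 < s - 1 by lra.
  rewrite -(ler_pM2l d); apply: le_trans (le_trans h' _); lra.
have : e >= 2 * u - 1 by lra.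
rewrite /s in h2; nra.
Qed.

End normal_moments.

(** * Concentration of i.i.d. noise *)

Section independence.
Context d (Omega : measurableType d) (R : realType) (Pr : probability Omega R).
Context (nu : probability (measurableTypeR R) R).

Lemma law_integral (X : Omega -> measurableTypeR R) (g : measurableTypeR R -> R) :
  measurable_fun setT X -> (forall B, measurable B -> Pr (X @^-1` B) = nu B) ->
  nu.-integrable setT (EFin \o g) ->
  Pr.-integrable setT (EFin \o (g \o X)) /\
  (\int[Pr]_w (g (X w))%:E = \int[nu]_x (g x)%:E)%E.
Proof.
move=> mX lX ig.
have mg : measurable_fun setT (EFin \o g) by exact: measurable_int ig.
pose phi : {mfun Omega >-> measurableTypeR R} := mfun_Sub (mem_set mX).
have law (f : R -> \bar R) :
    (\int[distribution Pr phi]_x f x = \int[nu]_x f x)%E.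
  by apply: eq_measure_integral => A mA _; exact: lX.
have iX : Pr.-integrable setT (EFin \o (g \o X)).
  apply/integrableP; split; first exact: (measurableT_comp mg mX).
  have /= <- := @ge0_integral_distribution _ _ _ _ _ Pr phi (abse \o EFin \o g).
  - by rewrite law; have /integrableP[] := ig.
  - by change (measurable_fun setT (abse \o (EFin \o g))); exact: measurableT_comp.
  - by move=> y; rewrite lee_fin.
split => //; rewrite -law.
by have := @integral_distribution _ _ _ _ _ Pr phi (EFin \o g) mg iX.
Qed.

(** The product formula on rectangles identifies the joint law of [(X, Y)] with the product measure,
    and Fubini factors the integral. *)
Lemma indep_integral_prod (X Y : Omega -> measurableTypeR R) (g : measurableTypeR R -> R) :
  measurable_fun setT X -> measurable_fun setT Y ->
  (forall A B, measurable A -> measurable B ->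
     Pr (X @^-1` A `&` Y @^-1` B) = (nu A * nu B)%E) ->
  nu.-integrable setT (EFin \o g) ->
  Pr.-integrable setT (EFin \o (fun w => g (X w) * g (Y w))) /\
  (\int[Pr]_w (g (X w) * g (Y w))%:E =
   (\int[nu]_x (g x)%:E) * (\int[nu]_x (g x)%:E))%E.
Proof.
move=> mX mY ind ig.
have mg : measurable_fun setT (EFin \o g) by exact: measurable_int ig.
have mg' : measurable_fun setT g by exact/measurable_EFinP.
have mXY : measurable_fun setT (fun w => (X w, Y w)) by exact: measurable_fun_pair.
pose phi : {mfun Omega >-> (measurableTypeR R * measurableTypeR R)%type} := mfun_Sub (mem_set mXY).
have law (f : measurableTypeR R * measurableTypeR R -> \bar R) :
    (\int[distribution Pr phi]_x f x = \int[(nu \x nu)%E]_x f x)%E.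
  apply: eq_measure_integral => A mA _; apply/esym/product_measure_unique => //.
pose G (z : measurableTypeR R * measurableTypeR R) := g z.1 * g z.2.
have mG : measurable_fun setT (EFin \o G).
  apply/measurable_EFinP; apply: measurable_funM; apply: measurableT_comp => //.
have fin : (\int[nu]_x `|g x|%:E)%E \is a fin_num.
  by have /integrableP[_] := ig; rewrite ge0_fin_numE//; apply: integral_ge0.
have ag : measurable_fun setT (fun x => `|g x|%:E).
  by apply/measurable_EFinP; exact: measurableT_comp.
have iG : (nu \x nu)%E.-integrable setT (EFin \o G).
  apply/integrable12ltyP => //=.
  have inner x : (\int[nu]_y `|G (x, y)|%:E = `|g x|%:E * \int[nu]_y `|g y|%:E)%E.
    rewrite -ge0_integralZl//.
    by apply: eq_integral => y _; rewrite normrM EFinM.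
  under eq_integral do rewrite inner.
  rewrite ge0_integralZr//; last by apply: integral_ge0.
  by rewrite ltey_eq fin_numM.
have iXY : Pr.-integrable setT (EFin \o (fun w => g (X w) * g (Y w))).
  apply/integrableP; split; first exact: (measurableT_comp mG mXY).
  have /= <- := @ge0_integral_distribution _ _ _ _ _ Pr phi (abse \o EFin \o G).
  - by rewrite law; have /integrableP[] := iG.
  - by change (measurable_fun setT (abse \o (EFin \o G))); exact: measurableT_comp.
  - by move=> y; rewrite lee_fin.
split => //.
have /= <- := @integral_distribution _ _ _ _ _ Pr phi (EFin \o G) mG iXY.
rewrite law -integral12_prod_meas1// /fubini_F /=.
have inner x : (\int[nu]_y (G (x, y))%:E = (g x)%:E * \int[nu]_y (g y)%:E)%E.
  rewrite -integralZl//.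
under eq_integral do rewrite inner.
have fin' : (\int[nu]_x (g x)%:E)%E \is a fin_num by exact: integrable_fin_num.
rewrite -(fineK fin').
by rewrite integralZr// fineK.
Qed.

(** Pairwise independence and mean zero kill the off-diagonal terms of the second moment. *)
Lemma chebyshev_weighted (n : nat) (X : 'I_n -> Omega -> measurableTypeR R) (c : 'I_n -> R)
    (g : measurableTypeR R -> R) (e : R) :
  (forall i, measurable_fun setT (X i)) ->
  (forall i B, measurable B -> Pr (X i @^-1` B) = nu B) ->
  (forall i j, i != j -> forall A B, measurable A -> measurable B ->
     Pr (X i @^-1` A `&` X j @^-1` B) = (nu A * nu B)%E) ->
  nu.-integrable setT (EFin \o g) ->
  nu.-integrable setT (EFin \o (fun x => g x ^+ 2)) ->
  (\int[nu]_x (g x)%:E = 0)%E -> 0 < e ->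
  (Pr [set w | (e <= `|\sum_i c i * g (X i w)|)%R] <=
   (e ^- 2 * (\sum_i c i ^+ 2) * fine (\int[nu]_x (g x ^+ 2)%:E)%E)%:E)%E.
Proof.
move=> mX lX iX ig ig2 g0 e0.
have mg : measurable_fun setT g.
  by apply/measurable_EFinP; exact: measurable_int ig.
pose S w := \sum_i c i * g (X i w).
have mS : measurable_fun setT S.
  apply: measurable_sum => i; apply: measurable_funM => //.
  by apply: measurableT_comp.
have fin2 : (\int[nu]_x (g x ^+ 2)%:E)%E \is a fin_num by exact: integrable_fin_num.
have ij (i j : 'I_n) :
  Pr.-integrable setT (EFin \o (fun w => g (X i w) * g (X j w))) /\
  (\int[Pr]_w (g (X i w) * g (X j w))%:E =
   if i == j then \int[nu]_x (g x ^+ 2)%:E else 0)%E.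
  case: eqVneq => [<-|ne].
    exact: (law_integral (g := fun x => g x ^+ 2) (mX i) (lX i) ig2).
  have [h1 h2] := indep_integral_prod (mX i) (mX j) (iX i j ne) ig.
  by rewrite h2 g0 mule0.
have S2 : (\int[Pr]_w (S w ^+ 2)%:E =
    ((\sum_i c i ^+ 2) * fine (\int[nu]_x (g x ^+ 2)%:E)%E)%:E)%E.
  have -> : (fun w => (S w ^+ 2)%:E) = (fun w =>
      \sum_(p : 'I_n * 'I_n) (c p.1 * c p.2)%:E * (g (X p.1 w) * g (X p.2 w))%:E)%E.
    apply/funext => w; rewrite expr2 /S big_distrlr /=.
    rewrite pair_big /= -sumEFin; apply: eq_bigr => p _.
    by rewrite -EFinM mulrACA.
  rewrite integral_sum//; last first.
    by move=> p; apply: integrableZl => //; have [] := ij p.1 p.2.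
  under eq_bigr => p _.
    rewrite integralZl//; last by have [] := ij p.1 p.2.
    rewrite (ij p.1 p.2).2; over.
  rewrite mulr_suml -sumEFin /=.
  rewrite -(pair_bigA _ (fun i j => (c i * c j)%:E * (if i == j then _ else _))%E)/=.
  apply: eq_bigr => i _; rewrite (bigD1 i)//= eqxx big1 ?adde0.
    by rewrite -expr2 [RHS]EFinM fineK.
  by move=> j ji; rewrite eq_sym (negbTE ji) mule0.
pose Y : {mfun Omega >-> R} := mfun_Sub (mem_set mS).
have := @markov _ _ _ Pr Y (fun x => x ^+ 2) e e0.
have -> : [set x | (e%:E <= `|(Y x)%:E|)%E] = [set w | e <= `|\sum_i c i * g (X i w)|].
  by apply/seteqP; split => w /=; rewrite lee_fin.
have -> : expectation Pr ((fun x => x ^+ 2) \o (fun x : R => `|x|) \o Y) = (\int[Pr]_w (S w ^+ 2)%:E)%E.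
  rewrite unlock; apply: eq_integral => w _ /=; congr EFin.
  by rewrite real_normK ?num_real.
rewrite S2 => h.
rewrite -mulrA EFinM lee_pdivlMl ?exprn_gt0//.
apply: h => //.
- by move=> r _; exact: sqr_ge0.
by move=> x y; rewrite !nnegrE => x0 y0 xy; rewrite ler_sqr.
Qed.

End independence.

(** * Energy of signal plus noise *)

Section noise.
Context d (Omega : measurableType d) (R : realType) (Pr : probability Omega R).
Context (Z : nat -> option 'I_3 -> Omega -> R).
Hypothesis iid : iid_std_normal Pr Z.

Let N01 : probability (measurableTypeR R) R := normal_prob 0 1.

Lemma iid_pair (p q : nat * option 'I_3) : p != q ->
  forall A B, measurable A -> measurable B ->
    Pr (Z p.1 p.2 @^-1` A `&` Z q.1 q.2 @^-1` B) = (N01 A * N01 B)%E.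
Proof.
move=> pq A B mA mB; case: iid => mZ lZ ind.
pose C (r : nat * option 'I_3) := if r == p then A else B.
have mC r : measurable (C r) by rewrite /C; case: ifP.
have Cp : C p = A by rewrite /C eqxx.
have Cq : C q = B by rewrite /C eq_sym (negbTE pq).
have u : uniq [:: p; q] by rewrite /= inE pq.
have := ind _ u C mC; rewrite big_cons big_seq1 Cp Cq !lZ// => <-.
congr (Pr _); apply/seteqP; split => w /=.
  move=> [wA wB] r /=; rewrite !inE => /orP[]/eqP->; rewrite ?Cp ?Cq//.
move=> h; split.
  by have := h p; rewrite /= Cp; apply; rewrite /= inE eqxx.
by have := h q; rewrite /= Cq; apply; rewrite /= !inE eqxx orbT.
Qed.

Lemma iid_chebyshev (n o : nat) (a : option 'I_3) (c : 'I_n -> R) (g : measurableTypeR R -> R) (e : R) :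
  N01.-integrable setT (EFin \o g) ->
  N01.-integrable setT (EFin \o (fun x => g x ^+ 2)) ->
  (\int[N01]_x (g x)%:E = 0)%E -> 0 < e ->
  (Pr [set w | (e <= `|\sum_i c i * g (Z (o + i)%N a w)|)%R] <=
   (e ^- 2 * (\sum_i c i ^+ 2) * fine (\int[N01]_x (g x ^+ 2)%:E)%E)%:E)%E.
Proof.
move=> ig ig2 g0 e0; have [mZ lZ _] := iid.
apply: (chebyshev_weighted (X := fun i : 'I_n => Z (o + i)%N a)) => //.
- by move=> i; exact: mZ.
- by move=> i B mB; exact: lZ.
- move=> i j ij; apply: (@iid_pair ((o + i)%N, a) ((o + j)%N, a)).
  by apply: contra ij => /eqP[/eqP]; rewrite eqn_add2l => /eqP /val_inj ->.
Qed.

(** The threshold [n0] precedes the node, the time offset and the signal, so that one code length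
    serves all messages and all slots. Expanding the square leaves a linear and a centred quadratic
    noise sum, each controlled by Chebyshev. *)
Lemma noise_concentration (B g V t : R) : 0 <= V -> B ^+ 2 * V + g ^+ 2 < t ->
  forall e, 0 < e -> exists n0, forall n, (n0 <= n)%N ->
  forall (a : option 'I_3) (o : nat) (x : 'I_n -> R), \sum_i x i ^+ 2 <= n%:R * V ->
  (Pr [set w | (n%:R * t < \sum_i (B * x i + g * Z (o + i)%N a w) ^+ 2)%R] <= e%:E)%E.
Proof.
move=> V0 tV e e0; have [mZ lZ _] := iid.
pose m2 := fine (\int[N01]_x (x ^+ 2)%:E)%E.
have m21 : m2 <= 1 by exact: normal_second_moment.
have m20 : 0 <= m2 by rewrite fine_ge0//; apply: integral_ge0 => x _; rewrite lee_fin sqr_ge0.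
pose q (x : R) := x ^+ 2 - m2.
have mq : measurable_fun setT q.
  by apply: measurable_funB => //; exact: exprn_measurable.
have iq : N01.-integrable setT (EFin \o q).
  apply: (@normal_integrable_poly _ _ 2) => // x; rewrite /q.
  have x2 := sqr_ge0 x; have h := sqr_ge0 (x ^+ 2 - 1).
  rewrite ler_norml; apply/andP; split; nra.
have iq2 : N01.-integrable setT (EFin \o (fun x => q x ^+ 2)).
  apply: (@normal_integrable_poly _ _ 4) => //; first exact: measurable_funX.
  move=> x; rewrite ger0_norm ?sqr_ge0// /q.
  have x2 := sqr_ge0 x; have h := sqr_ge0 (x ^+ 2 - 1).
  nra.
have q0 : (\int[N01]_x (q x)%:E = 0)%E.
  under eq_integral do rewrite /q EFinB.
  have i2 := @normal_integrable2 R.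
  have fin2 : (\int[N01]_x (x ^+ 2)%:E)%E \is a fin_num by exact: integrable_fin_num i2.
  have i1 : N01.-integrable setT (EFin \o cst m2) by exact: finite_measure_integrable_cst.
  have := integralB measurableT i2 i1 => /= ->.
  have P1 : N01 setT = 1%E by exact: probability_setT.
  rewrite integral_cst// [X in (_ * X)%E]P1 mule1 -(fineK fin2).
  by rewrite -EFinB subrr.
have ii := @normal_integrable1 R; have ii2 := @normal_integrable2 R.
have i0 := @normal_mean R.
pose v1 := fine (\int[N01]_x (id x ^+ 2)%:E)%E.
pose v2 := fine (\int[N01]_x (q x ^+ 2)%:E)%E.
have v10 : 0 <= v1 by rewrite fine_ge0//; apply: integral_ge0 => x _; rewrite lee_fin sqr_ge0.
have v20 : 0 <= v2 by rewrite fine_ge0//; apply: integral_ge0 => x _; rewrite lee_fin sqr_ge0.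
(* Each of the two deviations may use half of the slack. *)
pose k := (t - B ^+ 2 * V - g ^+ 2) / 2.
have k0 : 0 < k by rewrite /k; lra.
pose C := k ^- 2 * ((2 * B * g) ^+ 2 * V * v1 + g ^+ 4 * v2).
have C0 : 0 <= C.
  have g4 : 0 <= g ^+ 4 by rewrite exprn_even_ge0.
  by rewrite mulr_ge0 ?invr_ge0 ?sqr_ge0// addr_ge0// mulr_ge0// mulr_ge0// sqr_ge0.
exists (Num.truncn (C / e)).+1 => n nC a o x xV.
have n0 : (0 < n)%N by apply: leq_ltn_trans nC.
have nR : 0 < n%:R :> R by rewrite ltr0n.
have Cn : C / e < n%:R.
  apply: lt_le_trans (_ : (Num.truncn (C / e)).+1%:R <= _); last by rewrite ler_nat.
  exact: truncnS_gt.
pose A1 := [set w | n%:R * k <= `|\sum_i (2 * B * g * x i) * id (Z (o + i)%N a w)|].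
pose A2 := [set w | n%:R * k <= `|\sum_(i < n) g ^+ 2 * q (Z (o + i)%N a w)|].
have msum (f : 'I_n -> Omega -> R) : (forall i, measurable_fun setT (f i)) ->
    measurable [set w | n%:R * k <= `|\sum_i f i w|].
  move=> mf.
  have ms : measurable_fun setT (fun w => `|\sum_i f i w|).
    by apply: measurableT_comp => //; exact: measurable_sum.
  rewrite (_ : [set w | _] = (fun w => `|\sum_i f i w|) @^-1` `[n%:R * k, +oo[).
    by rewrite -[X in measurable X]setTI; apply: ms => //; exact: measurable_itv.
  by apply/seteqP; split => w /=; rewrite in_itv/= andbT.
have mA1 : measurable A1.
  by apply: msum => i; apply: measurable_funM.
have mA2 : measurable A2.
  by apply: msum => i; apply: measurable_funM => //; exact: measurableT_comp.
have mf : measurable [set w | (n%:R * t < \sum_i (B * x i + g * Z (o + i)%N a w) ^+ 2)%R].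
  have ms : measurable_fun setT (fun w => \sum_i (B * x i + g * Z (o + i)%N a w) ^+ 2).
    apply: measurable_sum => i; apply: measurable_funX; apply: measurable_funD => //.
    by apply: measurable_funM.
  rewrite (_ : [set w | _] = (fun w => \sum_i (B * x i + g * Z (o + i)%N a w) ^+ 2) @^-1` `]n%:R * t, +oo[).
    by rewrite -[X in measurable X]setTI; apply: ms => //; exact: measurable_itv.
  by apply/seteqP; split => w /=; rewrite in_itv/= andbT.
have sub : [set w | (n%:R * t < \sum_i (B * x i + g * Z (o + i)%N a w) ^+ 2)%R] `<=` A1 `|` A2.
  move=> w /= h; have [h1|h1] := lerP (n%:R * k) `|\sum_i (2 * B * g * x i) * id (Z (o + i)%N a w)|.
    by left.
  right; rewrite /A2 /= leNgt; apply/negP => h2.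
  move: h; apply/negP; rewrite -leNgt.
  have -> : \sum_i (B * x i + g * Z (o + i)%N a w) ^+ 2 = B ^+ 2 * (\sum_i x i ^+ 2) +
      \sum_i (2 * B * g * x i) * id (Z (o + i)%N a w) +
      \sum_(i < n) g ^+ 2 * q (Z (o + i)%N a w) + n%:R * (g ^+ 2 * m2).
    have -> : n%:R * (g ^+ 2 * m2) = \sum_(i < n) g ^+ 2 * m2.
      by rewrite sumr_const card_ord mulr_natl.
    rewrite mulr_sumr -!big_split /=.
    by apply: eq_bigr => i _; rewrite /q; ring.
  have {}h1 := le_lt_trans (ler_norm _) h1.
  have {}h2 := le_lt_trans (ler_norm _) h2.
  have h3 : B ^+ 2 * (\sum_i x i ^+ 2) <= B ^+ 2 * (n%:R * V).
    by rewrite ler_wpM2l// sqr_ge0.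
  have h4 : n%:R * (g ^+ 2 * m2) <= n%:R * g ^+ 2.
    by rewrite ler_wpM2l ?ler0n// ler_piMr// sqr_ge0.
  have -> : n%:R * t = B ^+ 2 * (n%:R * V) + n%:R * k + n%:R * k + n%:R * g ^+ 2.
    by rewrite /k; field.
  by apply: lerD => //; apply: lerD; [apply: lerD => //|]; exact: ltW.
apply: (le_trans (le_measure _ _ _ sub)); rewrite ?inE//; first exact: measurableU.
apply: (le_trans (measureU2 _ _ _)) => //.
have nk : 0 < n%:R * k by rewrite mulr_gt0.
have b1 := iid_chebyshev o a (fun i => 2 * B * g * x i) ii ii2 i0 nk.
have b2 := iid_chebyshev o a (fun i : 'I_n => g ^+ 2) iq iq2 q0 nk.
apply: (le_trans (leeD b1 b2)); rewrite -EFinD lee_fin -/v1 -/v2.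
rewrite sumr_const card_ord.
have -> : \sum_i (2 * B * g * x i) ^+ 2 = (2 * B * g) ^+ 2 * \sum_i x i ^+ 2.
  by rewrite mulr_sumr; apply: eq_bigr => i _; rewrite exprMn.
pose D := (2 * B * g) ^+ 2 * V * v1 + g ^+ 4 * v2.
have hD : (2 * B * g) ^+ 2 * (\sum_i x i ^+ 2) * v1 + (g ^+ 2) ^+ 2 *+ n * v2 <= n%:R * D.
  rewrite -(mulr_natl _ n) /D mulrDr lerD//.
    rewrite mulrA ler_wpM2r// mulrCA.
    by rewrite ler_wpM2l// sqr_ge0.
  by rewrite -exprM mulrA.
apply: (@le_trans _ _ (C / n%:R)).
  apply: (@le_trans _ _ ((n%:R * k) ^- 2 * (n%:R * D))).
    rewrite -!mulrA -mulrDr ler_wpM2l ?invr_ge0 ?sqr_ge0//.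
    by move: hD; rewrite -!mulrA.
  rewrite le_eqVlt; apply/orP; left; apply/eqP.
  have -> : C = k ^- 2 * D by [].
  move: (D) (k) k0 => D0 k1 k10; field.
  by rewrite !gt_eqF.
rewrite ler_pdivrMr//; rewrite ltr_pdivrMr// in Cn; rewrite mulrC; exact: ltW.
Qed.
End noise.

(** * Lattice points in balls *)

Section centred_lift.
Variable q : nat.
Hypothesis q_pr : prime q.

Definition clift (u : 'F_q) : int :=
  if (2 * val u <= q)%N then (val u)%:Z else (val u)%:Z - q%:Z.

Lemma cliftK (u : 'F_q) : (clift u)%:~R = u.
Proof.
have e : (val u)%:R = u by rewrite natr_Zp.
rewrite /clift; case: ifP => _; first exact: e.
have q0 : (q%:Z)%:~R = 0 :> 'F_q by rewrite -pmulrn pchar_Fp_0.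
by rewrite rmorphB /= q0 subr0; exact: e.
Qed.

Lemma clift_le (u : 'F_q) : (`|clift u| * 2 <= q%:Z)%R.
Proof.
have h : (val u < q)%N by rewrite -[X in (_ < X)%N](Fp_cast q_pr) ltn_ord.
rewrite /clift; case: leqP => h2.
  by rewrite ger0_norm//; move: h2; rewrite -lez_nat; lia.
by rewrite ler0_norm; move: h h2; lia.
Qed.

Lemma intr_Fp_eq0 (z : int) : z%:~R = 0 :> 'F_q -> (q %| `|z|)%N.
Proof.
have c : q \in [pchar 'F_q] by exact: pchar_Fp.
case: z => m; rewrite ?NegzE ?rmorphN /= => /eqP.
  by rewrite -pmulrn -(dvdn_pcharf c).
by rewrite oppr_eq0 -pmulrn -(dvdn_pcharf c).
Qed.

Lemma clift_intr (z : int) : (`|z| * 2 < q%:Z)%R -> clift z%:~R = z.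
Proof.
move=> zq; have lq := clift_le z%:~R; set l := clift _ in lq *.
have : (l - z)%:~R = 0 :> 'F_q by rewrite rmorphB /= cliftK subrr.
move/intr_Fp_eq0 => /dvdnP[k hk].
have : (`|l - z| < q)%N.
  have : `|l - z| <= `|l| + `|z| by exact: ler_normB.
  lia.
rewrite hk; case: k hk => [|k] hk; last by rewrite mulSn ltnNge leq_addr.
by move=> _; apply/eqP; rewrite -subr_eq0 -absz_eq0 hk.
Qed.

(** Without wraparound the lift of the field sum is the real sum that the channel forms. *)
Lemma cliftD (u v : 'F_q) : (`|clift u + clift v| * 2 < q%:Z)%R ->
  clift (u + v) = clift u + clift v.
Proof. by move=> h; rewrite -[RHS]clift_intr// rmorphD /= !cliftK. Qed.

Lemma clift0 : clift 0 = 0.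
Proof. by []. Qed.

End centred_lift.

Section balls.
Variables (R : realType) (q n : nat).

Definition sqdist (y : 'I_n -> R) (u : 'rV['F_q]_n) : R :=
  \sum_i (y i - (clift (u 0 i))%:~R) ^+ 2.

Definition qball (y : 'I_n -> R) (r : R) : {set 'rV['F_q]_n} :=
  finset (fun u => sqdist y u <= r).

Lemma qballE y r u : (u \in qball y r) = (sqdist y u <= r).
Proof. by rewrite inE. Qed.

Hypothesis q_pr : prime q.

Lemma sqr_add_le (th a e : R) : 0 < th ->
  (a + e) ^+ 2 <= (1 + th) * a ^+ 2 + (1 + th^-1) * e ^+ 2.
Proof.
move=> th0; rewrite -subr_ge0.
have -> : (1 + th) * a ^+ 2 + (1 + th^-1) * e ^+ 2 - (a + e) ^+ 2 =
  (th * a - e) ^+ 2 / th by field; rewrite gt_eqF.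
by rewrite divr_ge0 ?sqr_ge0// ltW.
Qed.

Lemma clift_sqr_small (z : int) (r : R) : z%:~R ^+ 2 <= r -> 4 * r < q%:R ^+ 2 ->
  (`|z| * 2 < q%:Z)%R.
Proof.
move=> zr rq; rewrite -(ltr_int R) -(ltr_pXn2r (_ : 0 < 2)%N) ?nnegrE ?ler0z//.
rewrite rmorphM /= exprMn intr_norm -normrX ger0_norm ?sqr_ge0//.
apply: le_lt_trans rq; rewrite mulrC.
have -> : (2%:~R : R) ^+ 2 = 4 by rewrite -natrX.
by rewrite ler_pM2l.
Qed.

(* Injection behind the volume comparison: [(x, c)] is sent to the quotient
   and the remainder of [p x + c] by [m], the quotient being recentred. *)
Lemma qball_card (p m : nat) (th b r : R) (y : 'I_n -> R) :
  (0 < p)%N -> (0 < m)%N -> 0 < th ->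
  (1 + th) * (p%:R / m%:R) ^+ 2 * b +
    n%:R * ((1 + th^-1) * (p%:R / m%:R + 2) ^+ 2) <= r ->
  4 * r < q%:R ^+ 2 ->
  (p ^ n * #|qball y b| <= m ^ n * #|qball (fun=> 0%R) r|)%N.
Proof.
case: p => // p; case: m => // m _ _ th0 hr rq.
set rho := _ / _ in hr.
pose x (u : 'rV['F_q]_n) i : int := clift (u 0 i).
pose z (uc : 'rV['F_q]_n * {ffun 'I_n -> 'I_p.+1}) i : int :=
  p.+1%:Z * x uc.1 i + (uc.2 i)%:Z.
pose v uc i : int := (z uc i %/ m.+1)%Z - Num.floor (rho * y i).
pose f uc : 'rV['F_q]_n * {ffun 'I_n -> 'I_m.+1} :=
  (\row_i (v uc i)%:~R, [ffun i => inord (absz (z uc i %% m.+1)%Z)]).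
have remE uc i : (inord (absz (z uc i %% m.+1)%Z) : 'I_m.+1)%:Z = (z uc i %% m.+1)%Z.
  have h0 : (0 <= z uc i %% m.+1)%Z by rewrite modz_ge0.
  have h1 : (z uc i %% m.+1 < m.+1)%Z by rewrite ltz_pmod.
  rewrite inordK; first by rewrite gez0_abs.
  by rewrite -ltz_nat gez0_abs.
pose S := finset.setX (qball y b) [set: {ffun 'I_n -> 'I_p.+1}]%SET.
have vsum uc : uc \in S -> \sum_i ((v uc i)%:~R : R) ^+ 2 <= r.
  rewrite inE => /andP[]; rewrite qballE => hu _.
  apply: le_trans hr; rewrite -mulrA.
  apply: (@le_trans _ _ ((1 + th) * (rho ^+ 2 * sqdist y uc.1) +
      n%:R * ((1 + th^-1) * (rho + 2) ^+ 2))); last first.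
    rewrite lerD2r ler_wpM2l ?ler_wpM2l ?sqr_ge0//; lra.
  rewrite mulr_natl -[X in _ *+ X]card_ord -sumr_const /sqdist !mulr_sumr -big_split /=.
  apply: ler_sum => i _.
  (* [e] is the rounding error of dilating by [rho] about [y]: the offset minus the remainder
     contributes a value between -1 and [rho], the floor a value between 0 and 1. *)
  set e := (v uc i)%:~R - rho * ((x uc.1 i)%:~R - y i) : R.
  have -> : (v uc i)%:~R = rho * ((x uc.1 i)%:~R - y i) + e by rewrite /e; ring.
  apply: le_trans (sqr_add_le _ _ th0) _.
  rewrite exprMn -(sqrrN (_ - y i)) opprB lerD2l.
  rewrite ler_wpM2l//; first by rewrite addr_ge0// invr_ge0 ltW.
  have m0 : 0 < (m.+1%:R : R) by rewrite ltr0n.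
  have rho0 : 0 <= rho by rewrite divr_ge0 ?ler0n.
  have eE : e = ((uc.2 i)%:R - ((z uc i %% m.+1)%Z)%:~R) / m.+1%:R +
      (rho * y i - (Num.floor (rho * y i))%:~R).
    have : (z uc i)%:~R = (z uc i %/ m.+1)%Z%:~R * m.+1%:R + (z uc i %% m.+1)%Z%:~R :> R.
      by rewrite {1}(divz_eq (z uc i) m.+1) rmorphD rmorphM /=.
    rewrite {1}/z rmorphD rmorphM /= => h.
    have -> : (z uc i %% m.+1)%Z%:~R = p.+1%:R * (x uc.1 i)%:~R + (uc.2 i)%:R - (z uc i %/ m.+1)%Z%:~R * m.+1%:R :> R.
      by move: h; rewrite -!pmulrn => ->; ring.
    rewrite /e /v rmorphB /= /rho; field.
    by rewrite gt_eqF.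
  have f0 : 0 <= rho * y i - (Num.floor (rho * y i))%:~R by rewrite subr_ge0 floor_le.
  have f1 : rho * y i - (Num.floor (rho * y i))%:~R <= 1.
    by rewrite lerBlDl ltW// -[X in _ + X]/(1%:~R) -rmorphD /= floorD1_gt.
  have h0 : (0 <= z uc i %% m.+1)%Z by rewrite modz_ge0.
  have h1 : (z uc i %% m.+1 < m.+1)%Z by rewrite ltz_pmod.
  have c0 : 0 <= ((z uc i %% m.+1)%Z)%:~R :> R by rewrite ler0z.
  have c1 : ((z uc i %% m.+1)%Z)%:~R <= m.+1%:R :> R by rewrite (_ : m.+1%:R = (m.+1%:Z)%:~R :> R)// ler_int ltW.
  have d1 : (uc.2 i)%:R <= p.+1%:R :> R by rewrite ler_nat ltnW.
  have g1 : ((uc.2 i)%:R - ((z uc i %% m.+1)%Z)%:~R) / m.+1%:R <= rho.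
    by rewrite ler_pM2r ?invr_gt0//; lra.
  have g2 : -1 <= ((uc.2 i)%:R - ((z uc i %% m.+1)%Z)%:~R) / m.+1%:R :> R.
    rewrite ler_pdivlMr//; have : 0 <= (uc.2 i)%:R :> R by rewrite ler0n.
    lra.
  have e2 : `|e| <= rho + 2.
    have aux (a c s : R) : -1 <= a -> a <= s -> 0 <= c -> c <= 1 -> 0 <= s ->
        `|a + c| <= s + 2.
      by move=> *; rewrite ler_norml; apply/andP; split; lra.
    by rewrite eE; exact: aux.
  by rewrite -(real_normK (num_real e)) ler_sqr ?nnegrE ?addr_ge0.
have vlift uc i : uc \in S -> clift ((v uc i)%:~R : 'F_q) = v uc i.
  move=> /vsum h; apply: clift_intr => //; apply: clift_sqr_small rq.
  apply: le_trans h; rewrite (bigD1 i)//= lerDl; apply: sumr_ge0 => j _; exact: sqr_ge0.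
(* The recentred quotients are below [q / 2] in absolute value, so their residues determine them.
   Quotient and remainder give back [p x + c], and division by [p] gives [x] and [c]. *)
have finj : {in S &, injective f}.
  move=> uc uc' S1 S2 [] /rowP e1 /ffunP e2.
  have ez i : z uc i = z uc' i.
    have := e1 i; rewrite !mxE => /(congr1 (@clift q)); rewrite !vlift//.
    move=> /(congr1 (+%R^~ (Num.floor (rho * y i)))); rewrite /v !subrK => h1.
    have := e2 i; rewrite !ffunE => /(congr1 (fun j : 'I__ => j%:Z)); rewrite !remE => h2.
    by rewrite (divz_eq (z uc i) m.+1) (divz_eq (z uc' i) m.+1) h1 h2.
  have exc i : x uc.1 i = x uc'.1 i /\ uc.2 i = uc'.2 i.
    have := ez i; rewrite /z; move: (x uc.1 i) (x uc'.1 i) => a a' h.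
    have dv (b1 : int) (c1 : 'I_p.+1) : ((p.+1%:Z * b1 + c1%:Z) %/ p.+1%:Z)%Z = b1.
      by rewrite mulrC divzMDl// divz_small ?addr0//= ltz_nat ltn_ord.
    have ea : a = a' by rewrite -(dv a (uc.2 i)) -(dv a' (uc'.2 i)) h.
    split=> //; apply: val_inj => /=; move: h; rewrite ea => /addrI /eqP.
    by rewrite eqz_nat => /eqP.
  case: uc uc' exc {S1 S2 e1 e2 ez} => [u c] [u' c'] /= exc; congr pair.
    by apply/rowP => i; rewrite -(cliftK q_pr (u 0 i)) -(cliftK q_pr (u' 0 i)) -/(x u i) (exc i).1.
  by apply/ffunP => i; rewrite (exc i).2.
have fS : f @: S \subset finset.setX (qball (fun=> 0) r) [set: {ffun 'I_n -> 'I_m.+1}]%SET.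
  apply/fintype.subsetP => _ /imsetP[uc ucS ->]; rewrite !inE andbT /= /sqdist.
  apply: le_trans (vsum _ ucS); apply: ler_sum => i _.
  by rewrite mxE vlift// sub0r sqrrN.
have := subset_leq_card fS; rewrite card_in_imset// !cardsX !cardsT !card_ffun !card_ord.
by rewrite mulnC (mulnC (m.+1 ^ n)%N).
Qed.

End balls.

(** * Random linear coset codes *)

Section ensemble.
Variables (R : realType) (F : finFieldType) (K n : nat).
Notation Q := (#|{: 'rV[F]_n}|%:R : R).
Notation W := (#|{: 'M[F]_(K, n)}|%:R : R).

Definition word (G : 'M[F]_(K, n)) (d : 'rV[F]_n) (x : 'rV[F]_K) : 'rV[F]_n :=
  x *m G + d.

Lemma sum_cst (I : finType) (x : R) : \sum_(i : I) x = #|I|%:R * x.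
Proof. by rewrite sumr_const mulr_natl. Qed.

(** A nonzero [c] sends a uniform [G] to a uniform vector: adding [G0 v] to [G] shifts [c *m G] by
    [v], so averaging over [v] changes nothing. *)
Lemma sum_mulmx (c : 'rV[F]_K) (f : 'rV[F]_n -> R) : c != 0 ->
  Q * \sum_G f (c *m G) = W * \sum_v f v.
Proof.
move=> /rV0Pn[i ci].
pose G0 (v : 'rV[F]_n) : 'M[F]_(K, n) := delta_mx i 0 *m ((c 0 i)^-1 *: v).
have cG0 v : c *m G0 v = v.
  by rewrite mulmxA -colE [col i c]mx11_scalar mul_scalar_mx !mxE scalerA divff// scale1r.
transitivity (\sum_(v : 'rV[F]_n) \sum_G f (c *m G)).
  by rewrite sum_cst.
transitivity (\sum_(v : 'rV[F]_n) \sum_G f (c *m G + v)).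
  apply: eq_bigr => v _; rewrite (reindex_inj (addIr (G0 v))) /=.
  by apply: eq_bigr => G _; rewrite mulmxDr cG0.
rewrite exchange_big /= -sum_cst; apply: eq_bigr => G _.
by rewrite [RHS](reindex_inj (addrI (c *m G))).
Qed.

Lemma sum_word1 (x : 'rV[F]_K) (f : 'rV[F]_n -> R) :
  \sum_G \sum_d f (word G d x) = W * \sum_u f u.
Proof.
rewrite -sum_cst; apply: eq_bigr => G _.
by rewrite [RHS](reindex_inj (addrI (x *m G))).
Qed.

Lemma sum_word12 (x y : 'rV[F]_K) (f : 'rV[F]_n -> 'rV[F]_n -> R) : x != y ->
  Q * \sum_G \sum_d f (word G d x) (word G d y) = W * \sum_u \sum_v f u v.
Proof.
move=> xy.
have -> : \sum_G \sum_d f (word G d x) (word G d y) =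
    \sum_u \sum_(G : 'M[F]_(K, n)) f u ((y - x) *m G + u).
  rewrite [RHS]exchange_big /=; apply: eq_bigr => G _.
  rewrite [RHS](reindex_inj (addrI (x *m G))); apply: eq_bigr => d _.
  by rewrite /word mulmxBl addrA subrK.
rewrite !mulr_sumr; apply: eq_bigr => u _.
rewrite (sum_mulmx (fun v => f u (v + u))) ?subr_eq0 1?eq_sym//.
by rewrite [in RHS](reindex_inj (addIr u)).
Qed.

(** The independent shifts make the two words independent although they share [G]. *)
Lemma sum_word2 (x1 x2 : 'rV[F]_K) (f : 'rV[F]_n -> 'rV[F]_n -> R) :
  \sum_G \sum_d1 \sum_d2 f (word G d1 x1) (word G d2 x2) = W * \sum_u1 \sum_u2 f u1 u2.
Proof.
rewrite -(sum_word1 x1 (fun u => \sum_u2 f u u2)).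
apply: eq_bigr => G _; apply: eq_bigr => d1 _.
by rewrite [RHS](reindex_inj (addrI (x2 *m G))).
Qed.

(** The shift of the third word is fixed by the other two; its independence comes from the nonzero
    vector [x - (x1 + x2)] acting on [G]. *)
Lemma sum_word3 (x1 x2 x : 'rV[F]_K) (f : 'rV[F]_n -> 'rV[F]_n -> 'rV[F]_n -> R) :
  x != x1 + x2 ->
  Q * \sum_G \sum_d1 \sum_d2
    f (word G d1 x1) (word G d2 x2) (word G (d1 + d2) x) =
  W * \sum_u1 \sum_u2 \sum_u f u1 u2 u.
Proof.
move=> xx.
have -> : \sum_G \sum_d1 \sum_d2
    f (word G d1 x1) (word G d2 x2) (word G (d1 + d2) x) =
    \sum_u1 \sum_u2 \sum_(G : 'M[F]_(K, n)) f u1 u2 ((x - (x1 + x2)) *m G + (u1 + u2)).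
  under [RHS]eq_bigr do rewrite exchange_big.
  rewrite [RHS]exchange_big /=; apply: eq_bigr => G _.
  rewrite [RHS](reindex_inj (addrI (x1 *m G))); apply: eq_bigr => d1 _.
  rewrite [RHS](reindex_inj (addrI (x2 *m G))); apply: eq_bigr => d2 _.
  rewrite /word mulmxBl mulmxDl; congr f.
  by rewrite [X in _ = _ + X]addrACA [RHS]addrA subrK.
rewrite !mulr_sumr; apply: eq_bigr => u1 _.
rewrite !mulr_sumr; apply: eq_bigr => u2 _.
rewrite (sum_mulmx (fun v => f u1 u2 (v + (u1 + u2)))) ?subr_eq0//.
by rewrite [in RHS](reindex_inj (addIr (u1 + u2))).
Qed.

Lemma sum_mem (I : finType) (T : {set I}) : \sum_u (u \in T)%:R = #|T|%:R :> R.
Proof.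
by rewrite -natr_sum -sum1_card [in RHS]big_mkcond; congr (_%:R).
Qed.

(* Second moment method: the words [x l G + d] are pairwise independent. *)
Lemma covering_bound (L : finType) (x : L -> 'rV[F]_K) (T : {set 'rV[F]_n}) :
  injective x ->
  (#|L|%:R * #|T|%:R) * \sum_G \sum_d [forall l, word G d (x l) \notin T]%:R <= W * Q ^+ 2.
Proof.
move=> xinj.
have Q0 : 0 < Q by rewrite ltr0n; apply/card_gt0P; exists 0.
have W0 : 0 < W by rewrite ltr0n; apply/card_gt0P; exists 0.
pose E : R := #|L|%:R * #|T|%:R / Q.
have E0 : 0 <= E by rewrite divr_ge0 ?mulr_ge0 ?ler0n.
pose N G d : R := \sum_l (word G d (x l) \in T)%:R.
have sN : \sum_G \sum_d N G d = W * Q * E.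
  transitivity (\sum_l \sum_G \sum_d ((word G d (x l) \in T)%:R : R)).
    rewrite [RHS]exchange_big; apply: eq_bigr => G _.
    by rewrite [RHS]exchange_big.
  rewrite (eq_bigr (fun=> W * #|T|%:R)); last first.
    by move=> l _; rewrite (sum_word1 _ (fun u => (u \in T)%:R)) sum_mem.
  rewrite sum_cst /E; field; exact: lt0r_neq0.
have sN2 : \sum_G \sum_d N G d ^+ 2 <= W * Q * E + W * Q * E ^+ 2.
  have -> : \sum_G \sum_d N G d ^+ 2 = \sum_l \sum_l' \sum_G \sum_d
     (((word G d (x l) \in T)%:R : R) * (word G d (x l') \in T)%:R).
    rewrite [RHS]pair_big [RHS]exchange_big; apply: eq_bigr => G _ /=.
    rewrite [RHS]exchange_big; apply: eq_bigr => d _ /=.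
    by rewrite expr2 /N big_distrlr pair_big.
  have cross l l' : \sum_G \sum_d
     (((word G d (x l) \in T)%:R : R) * (word G d (x l') \in T)%:R) <=
     W * #|T|%:R * (l == l')%:R + W * #|T|%:R ^+ 2 / Q.
    have [<-|ll] := eqVneq l l'.
      rewrite mulr1 -[leLHS]addr0 lerD//.
      have -> : \sum_G \sum_d (((word G d (x l) \in T)%:R : R) * (word G d (x l) \in T)%:R) =
         \sum_G \sum_d ((word G d (x l) \in T)%:R : R).
        by do 2 apply: eq_bigr => ? _; rewrite -natrM mulnb andbb.
      by rewrite (sum_word1 _ (fun u => (u \in T)%:R)) sum_mem.
    rewrite mulr0 add0r ler_pdivlMr// mulrC.
    rewrite (sum_word12 (fun u v => (u \in T)%:R * (v \in T)%:R)); last first.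
      by apply: contra ll => /eqP /xinj ->.
    by rewrite -big_distrlr /= !sum_mem expr2.
  apply: le_trans (ler_sum _ (fun l _ => ler_sum _ (fun l' _ => cross l l'))) _.
  under eq_bigr => l _.
    rewrite big_split /= -mulr_sumr (bigD1 l)//= eqxx big1; last first.
      by move=> i il; rewrite eq_sym (negbTE il).
    rewrite addr0 mulr1 sum_cst; over.
  rewrite sum_cst le_eqVlt; apply/orP; left; apply/eqP.
  rewrite /E; field; exact: lt0r_neq0.
have [E0'|E0'] := eqVneq E 0.
  have -> : #|L|%:R * #|T|%:R = 0 :> R.
    by apply/eqP; have /eqP := E0'; rewrite mulf_eq0 invr_eq0 (gt_eqF Q0) orbF.
  by rewrite mul0r mulr_ge0 ?sqr_ge0// ltW.
have Ep : 0 < E by rewrite lt_neqAle eq_sym E0'.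
(* Chebyshev: where no word falls in [T] the count [N] is 0, and its squared deviation from the mean
   [E] is [E ^+ 2]. *)
have key : E ^+ 2 * \sum_G \sum_d [forall l, word G d (x l) \notin T]%:R <= W * Q * E.
  apply: (@le_trans _ _ (\sum_G \sum_d (N G d - E) ^+ 2)).
    rewrite mulr_sumr; apply: ler_sum => G _; rewrite mulr_sumr; apply: ler_sum => d _.
    case: forallP => [h|_]; last by rewrite mulr0 sqr_ge0.
    rewrite /N big1 ?sub0r ?sqrrN ?mulr1// => l _; by rewrite (negbTE (h l)).
  have -> : \sum_G \sum_d (N G d - E) ^+ 2 =
      \sum_G \sum_d N G d ^+ 2 - 2 * E * (\sum_G \sum_d N G d) + W * Q * E ^+ 2.
    have -> : W * Q * E ^+ 2 = \sum_(G : 'M[F]_(K, n)) \sum_(d : 'rV[F]_n) E ^+ 2.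
      by rewrite !sum_cst mulrA.
    rewrite mulr_sumr -sumrB -big_split; apply: eq_bigr => G _ /=.
    rewrite mulr_sumr -sumrB -big_split; apply: eq_bigr => d _ /=; ring.
  rewrite sN; lra.
have e : #|L|%:R * #|T|%:R = E * Q by rewrite /E; field; exact: lt0r_neq0.
rewrite e -(ler_pM2l Ep); have {}key := ler_wpM2l (ltW Q0) key.
rewrite [leLHS](_ : _ = Q * (E ^+ 2 * \sum_G \sum_d [forall l, word G d (x l) \notin T]%:R)); last by ring.
by rewrite [leRHS](_ : _ = Q * (W * Q * E))//; ring.
Qed.

End ensemble.

(** * Uplink: decoding the sum of two codewords *)

Section real_probability.
Context d (Omega : measurableType d) (R : realType) (Pr : probability Omega R).

Definition rprob (A : set Omega) : R := fine (Pr A).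

Lemma rprobE (A : set Omega) : measurable A -> (rprob A)%:E = Pr A.
Proof. by move=> mA; rewrite /rprob fineK// fin_num_measure. Qed.

Lemma rprob_ge0 (A : set Omega) : 0 <= rprob A.
Proof. by rewrite fine_ge0. Qed.

Lemma rprob_le1 (A : set Omega) : measurable A -> rprob A <= 1.
Proof. by move=> mA; rewrite -lee_fin rprobE//; exact: probability_le1. Qed.

Lemma rprob_le (A B : set Omega) : measurable A -> measurable B -> A `<=` B ->
  rprob A <= rprob B.
Proof. by move=> mA mB AB; rewrite -lee_fin !rprobE// le_measure ?inE. Qed.

Lemma rprobU (A B : set Omega) : measurable A -> measurable B ->
  rprob (A `|` B) <= rprob A + rprob B.
Proof.
move=> mA mB; rewrite -lee_fin EFinD !rprobE//; last exact: measurableU.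
exact: measureU2.
Qed.

Lemma measurable_exists_fin (I : finType) (A : I -> set Omega) :
  (forall i, measurable (A i)) -> measurable [set w | exists i, A i w].
Proof.
move=> mA; rewrite (_ : [set w | _] = \bigcup_(i in [set: I]) A i).
  by apply: fin_bigcup_measurable => //; exact: finite_finset.
by apply/seteqP; split => w [i]; [move=> Ai; exists i|move=> _ Ai; exists i].
Qed.

Lemma measurable_andb (a : bool) (p : Omega -> bool) :
  measurable [set w | p w] -> measurable [set w | a && p w].
Proof.
by case: a => //= _; rewrite (_ : [set w | _] = set0)//; apply/seteqP; split.
Qed.

(** The event is a finite union over the truth patterns of the family. Decoders that search with
    [pick] are measurable for this reason. *)
Lemma measurable_finfun (J : finType) (P : J -> Omega -> bool) (Q : {ffun J -> bool} -> bool) :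
  (forall j, measurable [set w | P j w]) ->
  measurable [set w | Q [ffun j => P j w]].
Proof.
move=> mP.
rewrite (_ : [set w | _] = [set w | exists s, Q s && ([ffun j => P j w] == s)]); last first.
  apply/seteqP; split => w /=; first by move=> h; exists [ffun j => P j w]; rewrite h eqxx.
  by move=> [s /andP[h /eqP ->]].
apply: measurable_exists_fin => s; apply: measurable_andb.
rewrite (_ : [set w | _ == s] = \bigcap_(j in [set: J]) [set w | P j w = s j]); last first.
  apply/seteqP; split => w; first by move=> /eqP h j _ /=; rewrite -h ffunE.
  by move=> h; apply/eqP/ffunP => j; rewrite ffunE; exact: h.
apply: fin_bigcap_measurable => [|j _]; first exact: finite_finset.
case: (s j); first exact: mP.
rewrite (_ : [set w | _] = ~` [set w | P j w]); first exact: measurableC.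
by apply/seteqP; split => w /=; case: (P j w).
Qed.

Lemma measurable_pick (J : finType) (P : J -> Omega -> bool) (j0 j1 : J) :
  (forall j, measurable [set w | P j w]) ->
  measurable [set w | odflt j0 [pick j | P j w] = j1].
Proof.
move=> mP; pose Q (s : {ffun J -> bool}) := odflt j0 [pick j | s j] == j1.
have := measurable_finfun Q mP; congr (measurable _).
by apply/seteqP; split => w /=; rewrite /Q (eq_pick (ffunE _)); move/eqP.
Qed.

Lemma rprob_exists_le (I : finType) (A : I -> set Omega) :
  (forall i, measurable (A i)) ->
  rprob [set w | exists i, A i w] <= \sum_i rprob (A i).
Proof.
move=> mA.
have key (s : seq I) : measurable [set w | exists2 i, i \in s & A i w] /\
    rprob [set w | exists2 i, i \in s & A i w] <= \sum_(i <- s) rprob (A i).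
  elim: s => [|j s [ms hs]].
    rewrite big_nil (_ : [set w | _] = set0).
      by split => //; rewrite /rprob measure0.
    by apply/seteqP; split => w // -[].
  have -> : [set w | exists2 i, i \in j :: s & A i w] =
      A j `|` [set w | exists2 i, i \in s & A i w].
    apply/seteqP; split => w /=.
      by move=> [i]; rewrite inE => /orP[/eqP->|si] Ai; [left|right; exists i].
    move=> [Aj|[i si Ai]]; first by exists j => //; rewrite mem_head.
    by exists i => //; rewrite inE si orbT.
  split; first exact: measurableU.
  rewrite big_cons; apply: le_trans (rprobU _ _) _ => //.
  by rewrite lerD2l.
have [_] := key (index_enum I); congr (_ <= _); congr rprob.
apply/seteqP; split => w /=; first by move=> [i _ Ai]; exists i.
by move=> [i Ai]; exists i => //; rewrite mem_index_enum.
Qed.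

(** The noise can be frozen: a bound on the number of bad indices at each outcome bounds the sum of
    probabilities. The average over random codes is thus taken at fixed noise. *)
Lemma sum_rprob_le (I : finType) (A : I -> set Omega) (C : R) :
  (forall i, measurable (A i)) ->
  (forall w, \sum_i (`[< A i w >])%:R <= C) -> \sum_i rprob (A i) <= C.
Proof.
move=> mA h.
rewrite -lee_fin -sumEFin.
under eq_bigr => i _ do rewrite rprobE// -[A i]setIT -integral_indic//.
rewrite -ge0_integral_sum//; last first.
  by move=> i; apply/measurable_EFinP; exact: measurable_indic.
rewrite -[leRHS]mule1 -(probability_setT Pr) -integral_cst//.
apply: ge0_le_integral => //.
- by move=> w _; apply: sume_ge0 => i _; rewrite lee_fin.
- by apply: emeasurable_sum => i; apply/measurable_EFinP; exact: measurable_indic.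
- move=> w _; rewrite sumEFin lee_fin; apply: le_trans (h w).
  by apply: ler_sum => i _; rewrite indicE.
Qed.

End real_probability.

Section uplink.
Context d (Omega : measurableType d) (R : realType) (Pr : probability Omega R).
Variables (q k kap n : nat) (beta delta r b V Cb Nm e0 : R) (Y : 'I_n -> Omega -> R).
Hypothesis q_pr : prime q.
Hypothesis delta0 : 0 < delta.
Hypothesis mY : forall i, measurable_fun setT (Y i).
Hypothesis wrap : 16 * r < q%:R ^+ 2.

Notation vec := 'rV['F_q]_n.
Notation mat := 'M['F_q]_(k + kap, n).
Notation T := (@qball R q n (fun=> 0) r).
Notation c u i := ((clift ((u : vec) 0 i))%:~R : R).

(** The first two bounds will come from comparing volumes of balls, the third from concentration of
    the noise. *)
Hypothesis near_le : forall y, #|@qball R q n y b|%:R <= Nm.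
Hypothesis cap_le : forall u1 : vec, u1 \in T ->
  (\sum_(u2 : vec) ((u2 \in T) && (V < \sum_i (c u1 i + c u2 i) ^+ 2))%:R) <= Cb.
Hypothesis noise_le : forall x : 'I_n -> R, \sum_i x i ^+ 2 <= V ->
  rprob Pr [set w | b < \sum_i ((beta - 1) * x i + beta / delta * Y i w) ^+ 2] <= e0.

(** A message without a word in the ball is sent as silence, so that the power bound holds for every
    message. *)
Definition up_enc (G : mat) (dd : vec) (m : 'rV['F_q]_k) : option vec :=
  [pick u in T | [exists l : 'rV['F_q]_kap, word G dd (row_mx m l) == u]].

Definition amp (o : option vec) (i : 'I_n) : R :=
  if o is Some u then delta * c u i else 0.

(** The factor [beta] is that of a linear MMSE estimate: it damps the noise at the price of the
    residual signal [(beta - 1) * x]. *)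
Definition up_dec (G : mat) (dd : vec) (y : 'I_n -> R) : 'rV['F_q]_k :=
  odflt 0 [pick w | [exists l : 'rV['F_q]_kap,
    word G dd (row_mx w l) \in qball q (fun i => beta / delta * y i) b]].

Definition up_err (G : mat) (d1 d2 : vec) (m1 m2 : 'rV['F_q]_k) : set Omega := [set w |
  up_dec G (d1 + d2) (fun i => amp (up_enc G d1 m1) i + amp (up_enc G d2 m2) i + Y i w)
    != m1 + m2].

Lemma measurable_qball (a : 'I_n -> R) (s t : R) (u : vec) :
  measurable [set w | u \in qball q (fun i => s * (a i + Y i w)) t].
Proof.
pose f w := \sum_i (s * (a i + Y i w) - c u i) ^+ 2.
have mf : measurable_fun setT f.
  apply: measurable_sum => i; apply: measurable_funX; apply: measurable_funB => //.
  by apply: measurable_funM => //; apply: measurable_funD.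
rewrite (_ : [set w | _] = f @^-1` `]-oo, t]).
  by rewrite -[X in measurable X]setTI; apply: mf => //; exact: measurable_itv.
by apply/seteqP; split => w /=; rewrite qballE in_itv.
Qed.

Lemma sqdist0 (u : vec) : sqdist (fun=> 0) u = \sum_i c u i ^+ 2.
Proof. by apply: eq_bigr => i _; rewrite sub0r sqrrN. Qed.

(** The constant 16 in [wrap] keeps every coordinate of a word of the ball below [q / 4], hence a
    sum of two below [q / 2]. *)
Lemma T_liftD (u v : vec) i : u \in T -> v \in T ->
  c (u + v) i = c u i + c v i.
Proof.
rewrite !qballE !sqdist0 => hu hv; rewrite mxE cliftD ?rmorphD//.
have h (w : vec) : \sum_i c w i ^+ 2 <= r -> (`|clift (w 0 i)| * 4 < q%:Z)%R.
  move=> hw; rewrite -(ltr_int R) -(ltr_pXn2r (_ : 0 < 2)%N) ?nnegrE ?ler0z//.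
  rewrite rmorphM /= exprMn intr_norm -normrX ger0_norm ?sqr_ge0//.
  apply: le_lt_trans wrap; rewrite mulrC.
  have -> : (4%:~R : R) ^+ 2 = 16 by rewrite -natrX.
  rewrite ler_pM2l//; apply: le_trans hw; rewrite (bigD1 i)//= lerDl.
  by apply: sumr_ge0 => j _; exact: sqr_ge0.
have := h _ hu; have := h _ hv; have := ler_normD (clift (u 0 i)) (clift (v 0 i)).
move: (clift (u 0 i)) (clift (v 0 i)) => x y h1 h2 h3.
apply: le_lt_trans (ler_wpM2r _ h1) _ => //; lia.
Qed.

(* A wrong message has a word close to the received signal; the union runs over
   all auxiliary indices that the encoders may have picked. *)
Definition confused (G : mat) (d1 d2 : vec) (m1 m2 : 'rV['F_q]_k) : set Omega := [set w |
  exists s : ('rV['F_q]_kap * 'rV['F_q]_kap) * ('rV['F_q]_k * 'rV['F_q]_kap),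
  [&& s.2.1 != m1 + m2, word G d1 (row_mx m1 s.1.1) \in T, word G d2 (row_mx m2 s.1.2) \in T
   & word G (d1 + d2) (row_mx s.2.1 s.2.2) \in qball q (fun i =>
      beta / delta * (delta * c (word G d1 (row_mx m1 s.1.1)) i +
         delta * c (word G d2 (row_mx m2 s.1.2)) i + Y i w)) b]].

(** Two words of energy [r] may add up to energy [4 * r]; the effective noise bound needs a sum of
    energy at most [V], later chosen close to twice that of one word. All pairs of auxiliary indices
    are included since the choice of the encoders depends on [G]. *)
Definition atypical (G : mat) (d1 d2 : vec) (m1 m2 : 'rV['F_q]_k) : bool :=
  [exists l : 'rV['F_q]_kap * 'rV['F_q]_kap,
  [&& word G d1 (row_mx m1 l.1) \in T, word G d2 (row_mx m2 l.2) \in T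
   & V < \sum_i (c (word G d1 (row_mx m1 l.1)) i + c (word G d2 (row_mx m2 l.2)) i) ^+ 2]].

Definition uncovered (G : mat) dd (m : 'rV['F_q]_k) : bool :=
  [forall l : 'rV['F_q]_kap, word G dd (row_mx m l) \notin T].

Lemma measurable_confused G d1 d2 m1 m2 : measurable (confused G d1 d2 m1 m2).
Proof.
apply: measurable_exists_fin => s.
do 3 apply: measurable_andb.
exact: measurable_qball.
Qed.

Lemma measurable_up_dec G dd (a : 'I_n -> R) m :
  measurable [set w | up_dec G dd (fun i => a i + Y i w) = m].
Proof.
pose P (w' : 'rV['F_q]_k) w := [exists l : 'rV['F_q]_kap,
    word G dd (row_mx w' l) \in qball q (fun i => beta / delta * (a i + Y i w)) b].
have mP w' : measurable [set w | P w' w].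
  rewrite (_ : [set w | _] = [set w | exists l : 'rV['F_q]_kap,
      word G dd (row_mx w' l) \in qball q (fun i => beta / delta * (a i + Y i w)) b]).
    by apply: measurable_exists_fin => l; exact: measurable_qball.
  by apply/seteqP; split => w /=; [move/existsP|move=> h; apply/existsP].
by rewrite /up_dec; exact: (measurable_pick _ m mP).
Qed.

Lemma up_encP G dd m : (exists u l, [/\ up_enc G dd m = Some u, u \in T & u = word G dd (row_mx m l)])
   \/ (uncovered G dd m).
Proof.
rewrite /up_enc; case: pickP => [u /andP[uT /existsP[l /eqP e]]|h].
  by left; exists u, l.
right; apply/forallP => l; have := h (word G dd (row_mx m l)).
by case: (_ \in T) => //= /existsP[]; exists l.
Qed.

Lemma measurable_up_err G d1 d2 m1 m2 : measurable (up_err G d1 d2 m1 m2).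
Proof.
rewrite (_ : up_err _ _ _ _ _ = ~` [set w | up_dec G (d1 + d2) (fun i => (amp (up_enc G d1 m1) i + amp (up_enc G d2 m2) i) + Y i w) = m1 + m2]).
  by apply: measurableC; exact: measurable_up_dec.
by apply/seteqP; split => w /=; [move/eqP|move=> h; apply/eqP].
Qed.

Lemma up_err_le G d1 d2 m1 m2 : 0 <= e0 ->
  rprob Pr (up_err G d1 d2 m1 m2) <= (uncovered G d1 m1)%:R + (uncovered G d2 m2)%:R +
   (atypical G d1 d2 m1 m2)%:R + e0 + rprob Pr (confused G d1 d2 m1 m2).
Proof.
move=> e00.
have mE := measurable_up_err G d1 d2 m1 m2.
have p0 := rprob_ge0 Pr (confused G d1 d2 m1 m2).
have p1 := rprob_le1 Pr mE.
have bge (x : bool) : 0 <= x%:R :> R by [].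
have [[u1 [l1 [h1 T1 E1]]]|->] := up_encP G d1 m1; last first.
  rewrite /=; have := bge (uncovered G d2 m2); have := bge (atypical G d1 d2 m1 m2); lra.
have [[u2 [l2 [h2 T2 E2]]]|->] := up_encP G d2 m2; last first.
  rewrite /=; have := bge (uncovered G d1 m1); have := bge (atypical G d1 d2 m1 m2); lra.
have [_|hat] := boolP (atypical G d1 d2 m1 m2).
  rewrite /=; have := bge (uncovered G d1 m1); have := bge (uncovered G d2 m2); lra.
pose x i := c u1 i + c u2 i.
have xV : \sum_i x i ^+ 2 <= V.
  rewrite leNgt; apply: contra hat => hV; apply/existsP; exists (l1, l2).
  by rewrite /= -E1 -E2 T1 T2.
pose N := [set w | b < \sum_i ((beta - 1) * x i + beta / delta * Y i w) ^+ 2].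
have mN : measurable N.
  pose f w := \sum_i ((beta - 1) * x i + beta / delta * Y i w) ^+ 2.
  have mf : measurable_fun setT f.
    apply: measurable_sum => i; apply: measurable_funX; apply: measurable_funD => //.
    by apply: measurable_funM.
  rewrite (_ : N = f @^-1` `]b, +oo[).
    by rewrite -[X in measurable X]setTI; apply: mf => //; exact: measurable_itv.
  by apply/seteqP; split => w /=; rewrite in_itv /= andbT.
have sub : up_err G d1 d2 m1 m2 `<=` N `|` confused G d1 d2 m1 m2.
  move=> w; rewrite /up_err /= h1 h2 /= => /negP err.
  have [hN|hN] := boolP (b < \sum_i ((beta - 1) * x i + beta / delta * Y i w) ^+ 2).
    by left.
  right; rewrite -leNgt in hN.
  move: err; rewrite /up_dec; case: pickP => [w' /existsP[l' hl']|].
    move=> /negP ww; exists ((l1, l2), (w', l')) => /=.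
    by rewrite ww -E1 -E2 T1 T2.
  (* The search cannot fail: by linearity [u1 + u2] is the word of [m1 + m2] with auxiliary index
     [l1 + l2], and it passes the distance test. *)
  move=> /(_ (m1 + m2)) /negbT /negP[]; apply/existsP; exists (l1 + l2).
  have -> : word G (d1 + d2) (row_mx (m1 + m2) (l1 + l2)) = u1 + u2.
    by rewrite E1 E2 -add_row_mx /word mulmxDl addrACA.
  rewrite qballE; apply: le_trans hN; rewrite le_eqVlt; apply/orP; left; apply/eqP.
  apply: eq_bigr => i _; rewrite T_liftD// /x; congr (_ ^+ 2); field.
  by rewrite gt_eqF.
have := rprob_le Pr mE (measurableU _ _ mN (measurable_confused _ _ _ _ _)) sub.
move=> /le_trans /(_ (rprobU Pr mN (measurable_confused _ _ _ _ _))).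
have nl : rprob Pr N <= e0 := noise_le xV.
rewrite /= => h; have := bge (uncovered G d1 m1); have := bge (uncovered G d2 m2); lra.
Qed.

Notation Qn := (#|{: vec}|%:R : R).
Notation Lk := (#|{: 'rV['F_q]_kap}|%:R : R).
Notation Mk := (#|{: 'rV['F_q]_k}|%:R : R).
Notation Wn := (#|{: mat}|%:R : R).
Notation t := (#|T|%:R : R).

Let cardV_gt0 (p m : nat) : 0 < #|{: 'M['F_q]_(p, m)}|%:R :> R.
Proof. by rewrite ltr0n; apply/card_gt0P; exists 0. Qed.

Lemma sum_uncovered m : 0 < t ->
  \sum_G \sum_dd (uncovered G dd m)%:R <= Wn * Qn ^+ 2 / (Lk * t).
Proof.
move=> t0; rewrite ler_pdivlMr ?mulr_gt0// mulrC.
apply: (covering_bound R (x := fun l : 'rV['F_q]_kap => row_mx m l) T).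
by move=> l l' /eq_row_mx[].
Qed.

Lemma nat_exists_le (I : finType) (p : pred I) :
  ([exists i, p i])%:R <= \sum_i (p i)%:R :> R.
Proof.
case: existsP => [[i pi]|_]; last by apply: sumr_ge0.
by rewrite (bigD1 i)//= pi lerDl; apply: sumr_ge0.
Qed.

Lemma sum_atypical m1 m2 :
  \sum_G \sum_d1 \sum_d2 (atypical G d1 d2 m1 m2)%:R <= Wn * Lk ^+ 2 * t * Cb.
Proof.
pose f (u1 u2 : vec) : R :=
  [&& u1 \in T, u2 \in T & V < \sum_i (c u1 i + c u2 i) ^+ 2]%:R.
apply: (@le_trans _ _ (\sum_(l : 'rV['F_q]_kap * 'rV['F_q]_kap) \sum_G \sum_d1 \sum_d2
    f (word G d1 (row_mx m1 l.1)) (word G d2 (row_mx m2 l.2)))).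
  rewrite [leRHS]exchange_big /=; apply: ler_sum => G _; rewrite [leRHS]exchange_big /=.
  apply: ler_sum => d1 _; rewrite [leRHS]exchange_big /=; apply: ler_sum => d2 _.
  exact: nat_exists_le.
under eq_bigr do rewrite (sum_word2 _ _ f).
rewrite sum_cst card_prod natrM.
rewrite [leLHS](_ : _ = (Wn * Lk ^+ 2) * \sum_u1 \sum_u2 f u1 u2); last by ring.
rewrite -[leRHS]mulrA ler_wpM2l ?mulr_ge0 ?sqr_ge0//.
rewrite -sum_mem mulr_suml; apply: ler_sum => u1 _; rewrite /f.
case: (boolP (u1 \in T)) => [h|_]; last by rewrite mul0r big1.
by rewrite mul1r; exact: cap_le.
Qed.

(** At fixed noise, for each choice of auxiliary indices and wrong message, the three words are
    uniform and independent over the ensemble, so at most a fraction [t ^+ 2 * Nm / Qn ^+ 3] of the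
    codes is confused. *)
Lemma sum_confused m1 m2 :
  \sum_G \sum_d1 \sum_d2 rprob Pr (confused G d1 d2 m1 m2)
   <= Wn * Lk ^+ 3 * Mk * t ^+ 2 * Nm / Qn.
Proof.
have Q0 : 0 < Qn by exact: cardV_gt0.
have pairE (g : mat -> vec -> vec -> R) : \sum_G \sum_d1 \sum_d2 g G d1 d2 =
    \sum_(e : mat * vec * vec) g e.1.1 e.1.2 e.2.
  by rewrite !pair_bigA.
rewrite pairE; apply: sum_rprob_le => [e|w]; first exact: measurable_confused.
rewrite -(pairE (fun G d1 d2 => (`[< confused G d1 d2 m1 m2 w >])%:R)).
pose f (u1 u2 u : vec) : R := [&& u1 \in T, u2 \in T & u \in qball q (fun i =>
   beta / delta * (delta * c u1 i + delta * c u2 i + Y i w)) b]%:R.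
apply: (@le_trans _ _ (\sum_(s : ('rV['F_q]_kap * 'rV['F_q]_kap) * ('rV['F_q]_k * 'rV['F_q]_kap))
    \sum_G \sum_d1 \sum_d2 (s.2.1 != m1 + m2)%:R *
    f (word G d1 (row_mx m1 s.1.1)) (word G d2 (row_mx m2 s.1.2))
      (word G (d1 + d2) (row_mx s.2.1 s.2.2)))).
  rewrite [leRHS]exchange_big /=; apply: ler_sum => G _; rewrite [leRHS]exchange_big /=.
  apply: ler_sum => d1 _; rewrite [leRHS]exchange_big /=; apply: ler_sum => d2 _.
  case: asboolP => [[s hs]|_]; last first.
    by apply: sumr_ge0 => s _; rewrite mulr_ge0// /f.
  rewrite (bigD1 s)//= -[leLHS]addr0 lerD//.
    by case/and4P: hs => h1 h2 h3 h4; rewrite h1 /f h2 h3 h4 /= mulr1.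
  by apply: sumr_ge0 => s' _; rewrite mulr_ge0// /f.
apply: (@le_trans _ _ (\sum_(s : ('rV['F_q]_kap * 'rV['F_q]_kap) * ('rV['F_q]_k * 'rV['F_q]_kap))
    Wn * t ^+ 2 * Nm / Qn)); last first.
  rewrite sum_cst !card_prod !natrM le_eqVlt; apply/orP; left; apply/eqP.
  by field; rewrite gt_eqF.
apply: ler_sum => s _.
have Nm0 : 0 <= Nm by apply: le_trans (near_le (fun=> 0)); rewrite ler0n.
have [e|ne] := eqVneq s.2.1 (m1 + m2).
  rewrite big1 ?divr_ge0 ?mulr_ge0 ?sqr_ge0 ?ler0n// => G _.
  by rewrite big1// => d1 _; rewrite big1// => d2 _; rewrite mul0r.
rewrite /= ler_pdivlMr// mulrC.
have -> : \sum_G \sum_d1 \sum_d2 1 * f (word G d1 (row_mx m1 s.1.1))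
    (word G d2 (row_mx m2 s.1.2)) (word G (d1 + d2) (row_mx s.2.1 s.2.2)) =
    \sum_G \sum_d1 \sum_d2 f (word G d1 (row_mx m1 s.1.1))
    (word G d2 (row_mx m2 s.1.2)) (word G (d1 + d2) (row_mx s.2.1 s.2.2)).
  by do 3 apply: eq_bigr => ? _; rewrite mul1r.
rewrite (sum_word3 f); last first.
  by rewrite add_row_mx; apply: contra ne => /eqP /eq_row_mx[->].
rewrite -[leRHS]mulrA ler_wpM2l ?ler0n//.
have -> : t ^+ 2 * Nm = \sum_(u1 : vec) \sum_(u2 : vec) (u1 \in T)%:R * ((u2 \in T)%:R * Nm).
  under [RHS]eq_bigr do rewrite -mulr_sumr -mulr_suml sum_mem.
  by rewrite -mulr_suml sum_mem expr2 mulrA.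
apply: ler_sum => u1 _; apply: ler_sum => u2 _; rewrite /f.
case: (u1 \in T) => /=; last by rewrite mul0r big1.
case: (u2 \in T) => /=; last by rewrite mul0r mulr0 big1.
by rewrite !mul1r sum_mem; exact: near_le.
Qed.

Lemma sum3_split (A B : finType) (f g : A -> B -> R) (h k3 : A -> B -> B -> R) (e : R) :
  \sum_a \sum_b1 \sum_b2 (f a b1 + g a b2 + h a b1 b2 + e + k3 a b1 b2) =
  #|B|%:R * (\sum_a \sum_b1 f a b1) + #|B|%:R * (\sum_a \sum_b2 g a b2) +
  (\sum_a \sum_b1 \sum_b2 h a b1 b2) + #|A|%:R * #|B|%:R ^+ 2 * e +
  \sum_a \sum_b1 \sum_b2 k3 a b1 b2.
Proof.
have -> : #|A|%:R * #|B|%:R ^+ 2 * e = \sum_(a : A) \sum_(b1 : B) \sum_(b2 : B) e.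
  by rewrite !sum_cst; ring.
have -> : #|B|%:R * (\sum_a \sum_b1 f a b1) = \sum_a \sum_b1 \sum_(b2 : B) f a b1.
  rewrite mulr_sumr; apply: eq_bigr => a _; rewrite mulr_sumr; apply: eq_bigr => b1 _.
  by rewrite sum_cst.
have -> : #|B|%:R * (\sum_a \sum_b2 g a b2) = \sum_a \sum_(b1 : B) \sum_b2 g a b2.
  by rewrite mulr_sumr; apply: eq_bigr => a _; rewrite sum_cst.
by rewrite -!big_split; apply: eq_bigr => a _; rewrite -!big_split; apply: eq_bigr => b1 _; rewrite -!big_split.
Qed.

Lemma exists_le_average (I : finType) (S : I -> R) (B : R) : (0 < #|I|)%N ->
  \sum_e S e <= #|I|%:R * B -> exists e, S e <= B.
Proof.
move=> /card_gt0P[e0' _] h.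
have [e _ he] := Order.TotalTheory.arg_minP S (erefl : xpredT e0').
exists e; have I0 : 0 < #|I|%:R :> R by rewrite ltr0n; apply/card_gt0P; exists e.
rewrite -(ler_pM2l I0); apply: le_trans h; rewrite -sum_cst.
by apply: ler_sum => i _; exact: he.
Qed.

(** The average is over codes and message pairs together; a code good on average over messages is
    what the error probability asks for. *)
Lemma up_code_exists : 0 < t -> 0 <= e0 -> exists G d1 d2,
  \sum_m1 \sum_m2 rprob Pr (up_err G d1 d2 m1 m2) <= Mk ^+ 2 *
   (2 * Qn / (Lk * t) + (Lk * t / Qn) ^+ 2 * (Cb / t) + e0
     + (Lk * t / Qn) ^+ 3 * (Mk * Nm / t)).
Proof.
move=> t0 e00; set Bd := (_ + _ + _ + _).
have Q0 : 0 < Qn by exact: cardV_gt0.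
have L0 : 0 < Lk by exact: cardV_gt0.
have upper m1 m2 : \sum_G \sum_d1 \sum_d2 rprob Pr (up_err G d1 d2 m1 m2) <= Wn * Qn ^+ 2 * Bd.
  apply: le_trans (ler_sum _ (fun G _ => ler_sum _ (fun d1 _ => ler_sum _ (fun d2 _ =>
    up_err_le G d1 d2 m1 m2 e00)))) _.
  rewrite (sum3_split (fun G d1 => (uncovered G d1 m1)%:R) (fun G d2 => (uncovered G d2 m2)%:R)
    (fun G d1 d2 => (atypical G d1 d2 m1 m2)%:R) (fun G d1 d2 => rprob Pr (confused G d1 d2 m1 m2))).
  have u1 := sum_uncovered m1 t0; have u2 := sum_uncovered m2 t0.
  have a := sum_atypical m1 m2; have co := sum_confused m1 m2.
  have -> : Wn * Qn ^+ 2 * Bd = Qn * (Wn * Qn ^+ 2 / (Lk * t)) + Qn * (Wn * Qn ^+ 2 / (Lk * t)) +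
    Wn * Lk ^+ 2 * t * Cb + Wn * Qn ^+ 2 * e0 + Wn * Lk ^+ 3 * Mk * t ^+ 2 * Nm / Qn.
    rewrite /Bd; field; rewrite !gt_eqF//.
  apply: lerD co; rewrite lerD2r; apply: lerD a.
  by apply: lerD; apply: ler_wpM2l; [exact: ltW|exact: u1|exact: ltW|exact: u2].
have [||e he] := @exists_le_average (mat * vec * vec)%type
   (fun e => \sum_m1 \sum_m2 rprob Pr (up_err e.1.1 e.1.2 e.2 m1 m2)) (Mk ^+ 2 * Bd); last by exists e.1.1, e.1.2, e.2.
- by apply/card_gt0P; exists (0, 0, 0).
rewrite exchange_big /=; under eq_bigr do rewrite exchange_big /=.
apply: (@le_trans _ _ (\sum_(m1 : 'rV['F_q]_k) \sum_(m2 : 'rV['F_q]_k) Wn * Qn ^+ 2 * Bd)).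
  apply: ler_sum => m1 _; apply: ler_sum => m2 _; apply: le_trans (upper m1 m2).
  by rewrite !pair_bigA.
rewrite !sum_cst !card_prod !natrM le_eqVlt; apply/orP; left; apply/eqP; ring.
Qed.

End uplink.

(** * Downlink: random codebooks *)

Section coordinate_replacement.
Variables (R : realType) (I : finType) (T_ : I -> finType).
Notation D := {dffun forall i, T_ i}.

Definition fupd (f : D) (i : I) (a : T_ i) : D := [ffun j => @eqtype.dfwith I T_ f i a j].

Lemma fupd_in f i (a : T_ i) : fupd f a i = a.
Proof. by rewrite ffunE eqtype.dfwith_in. Qed.

Lemma fupd_out f i (a : T_ i) j : i != j -> fupd f a j = f j.
Proof. by move=> ij; rewrite ffunE eqtype.dfwith_out. Qed.

(** Resampling a coordinate: exchanging the value [a] with coordinate [i] of [f] is an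
    involution. *)
Lemma sum_fupd (i : I) (G : D -> R) :
  #|T_ i|%:R * \sum_f G f = \sum_f \sum_(a : T_ i) G (fupd f a).
Proof.
rewrite mulr_sumr; under eq_bigr => f _ do rewrite -sum_cst.
rewrite !pair_bigA /=.
pose h (p : D * T_ i) : D * T_ i := (fupd p.1 p.2, p.1 i).
have hK : involutive h.
  case=> f a; rewrite /h /= fupd_in; congr pair; apply/ffunP => j.
  have [<-|ij] := eqVneq i j; first by rewrite fupd_in.
  by rewrite !fupd_out.
by rewrite (reindex_inj (inv_inj hK)).
Qed.

Lemma sum_coord1 (i : I) (F : T_ i -> R) :
  #|T_ i|%:R * \sum_(f : D) F (f i) = #|{: D}|%:R * \sum_a F a.
Proof.
rewrite (sum_fupd i (fun f => F (f i))) -sum_cst; apply: eq_bigr => f _.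
by apply: eq_bigr => a _; rewrite fupd_in.
Qed.

Lemma sum_coord2 (i j : I) (F : T_ i -> T_ j -> R) : i != j ->
  #|T_ i|%:R * (#|T_ j|%:R * \sum_(f : D) F (f i) (f j)) =
  #|{: D}|%:R * \sum_a \sum_b F a b.
Proof.
move=> ij; rewrite (sum_fupd j (fun f => F (f i) (f j))).
rewrite (eq_bigr (fun f : D => \sum_b F (f i) b)); last first.
  by move=> f _; apply: eq_bigr => b _; rewrite fupd_in fupd_out// eq_sym.
exact: (sum_coord1 (fun a => \sum_b F a b)).
Qed.

End coordinate_replacement.

Section downlink.
Context d (Omega : measurableType d) (R : realType) (Pr : probability Omega R).
Variables (I : finType) (t0 : I) (q n : nat) (beta delta r b Nm e0 : R).
Variables (g : bool -> R) (Y : bool -> 'I_n -> Omega -> R).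
Hypothesis delta0 : 0 < delta.
Hypothesis g0 : forall e, g e != 0.
Hypothesis mY : forall e i, measurable_fun setT (Y e i).

Notation vec := 'rV['F_q]_n.
Notation T := (@qball R q n (fun=> 0) r).
Notation c u i := ((clift ((u : vec) 0 i))%:~R : R).
Notation sc e := (beta / delta / g e).

Hypothesis near_le : forall y, #|@qball R q n y b|%:R <= Nm.
Hypothesis noise_le : forall e (x : 'I_n -> R), \sum_i x i ^+ 2 <= r ->
  rprob Pr [set w | b < \sum_i ((beta - 1) * x i + sc e * Y e i w) ^+ 2] <= e0.

(** The relay is the only sender on the downlink, so its codebook needs no linear structure and its
    words are drawn from the ball itself, without a covering step. *)
Definition dn_word (phi : {ffun I -> 'I_#|T|}) (t : I) : vec := enum_val (phi t).

Definition dn_dec (phi : {ffun I -> 'I_#|T|}) e (y : 'I_n -> R) : I :=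
  odflt t0 [pick t | dn_word phi t \in qball q (fun i => sc e * y i) b].

Definition dn_err phi e t : set Omega := [set w |
  dn_dec phi e (fun i => g e * (delta * c (dn_word phi t) i) + Y e i w) != t].

Definition dn_confused phi e t : set Omega := [set w | exists t', (t' != t) &&
  (dn_word phi t' \in qball q (fun i => sc e * (g e * (delta * c (dn_word phi t) i) + Y e i w)) b)].

Lemma dn_wordT phi t : dn_word phi t \in T.
Proof. exact: enum_valP. Qed.

Lemma measurable_dn_confused phi e t : measurable (dn_confused phi e t).
Proof.
apply: measurable_exists_fin => t'; apply: measurable_andb.
by apply: measurable_qball => i; exact: mY.
Qed.

Lemma measurable_dn_dec phi e (a : 'I_n -> R) t :
  measurable [set w | dn_dec phi e (fun i => a i + Y e i w) = t].
Proof.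
pose P s w := dn_word phi s \in qball q (fun i => sc e * (a i + Y e i w)) b.
have mP s : measurable [set w | P s w] by apply: measurable_qball => i; exact: mY.
by rewrite /dn_dec; exact: (measurable_pick _ t mP).
Qed.

Lemma measurable_dn_err phi e t : measurable (dn_err phi e t).
Proof.
rewrite (_ : dn_err _ _ _ = ~` [set w | dn_dec phi e (fun i => g e * (delta * c (dn_word phi t) i) + Y e i w) = t]).
  by apply: measurableC; exact: measurable_dn_dec.
by apply/seteqP; split => w /=; [move/eqP|move=> h; apply/eqP].
Qed.

Lemma dn_err_le phi e t :
  rprob Pr (dn_err phi e t) <= e0 + rprob Pr (dn_confused phi e t).
Proof.
have mE := measurable_dn_err phi e t.
pose x i := c (dn_word phi t) i.
have xV : \sum_i x i ^+ 2 <= r.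
  by have := dn_wordT phi t; rewrite qballE sqdist0.
pose N := [set w | b < \sum_i ((beta - 1) * x i + sc e * Y e i w) ^+ 2].
have mN : measurable N.
  pose f w := \sum_i ((beta - 1) * x i + sc e * Y e i w) ^+ 2.
  have mf : measurable_fun setT f.
    apply: measurable_sum => i; apply: measurable_funX; apply: measurable_funD => //.
    by apply: measurable_funM => //; exact: mY.
  rewrite (_ : N = f @^-1` `]b, +oo[).
    by rewrite -[X in measurable X]setTI; apply: mf => //; exact: measurable_itv.
  by apply/seteqP; split => w /=; rewrite in_itv /= andbT.
have sub : dn_err phi e t `<=` N `|` dn_confused phi e t.
  move=> w; rewrite /dn_err /= => /negP err.
  have [hN|hN] := boolP (b < \sum_i ((beta - 1) * x i + sc e * Y e i w) ^+ 2).
    by left.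
  right; rewrite -leNgt in hN.
  move: err; rewrite /dn_dec; case: pickP => [t' ht'|].
    by move=> /negP tt; exists t'; rewrite tt.
  move=> /(_ t) /negbT /negP[].
  rewrite qballE; apply: le_trans hN; rewrite le_eqVlt; apply/orP; left; apply/eqP.
  apply: eq_bigr => i _; rewrite /x; congr (_ ^+ 2); field.
  by rewrite g0 gt_eqF.
have := rprob_le Pr mE (measurableU _ _ mN (measurable_dn_confused _ _ _)) sub.
move=> /le_trans /(_ (rprobU Pr mN (measurable_dn_confused _ _ _))) h.
apply: le_trans h _; rewrite lerD2r; exact: noise_le.
Qed.

Lemma sum_near y : \sum_(a : 'I_#|T|) (enum_val a \in qball q y b)%:R <= Nm.
Proof.
apply: le_trans (near_le y).
pose A := finset (fun a : 'I_#|T| => enum_val a \in qball q y b).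
rewrite (eq_bigr (fun a => (a \in A)%:R)) => [|a _]; last by rewrite [a \in A]inE.
rewrite sum_mem ler_nat -(card_imset _ (@enum_val_inj _ (mem T))).
by apply/subset_leq_card/fintype.subsetP => _ /imsetP[a ha ->]; move: ha; rewrite [a \in A]inE.
Qed.

(** A competing word is uniform on the ball and independent of the sent one, hence close to the
    received signal with probability at most [Nm / #|T|]. Adding the errors of both users before
    averaging yields one codebook good for both. *)
Lemma dn_code_exists : (0 < #|T|)%N -> exists phi : {ffun I -> 'I_#|T|},
  \sum_t (rprob Pr (dn_err phi false t) + rprob Pr (dn_err phi true t))
    <= 2 * #|I|%:R * (e0 + #|I|%:R * Nm / #|T|%:R).
Proof.
move=> T0.
have Tr : 0 < #|T|%:R :> R by rewrite ltr0n.
have Nm0 : 0 <= Nm by apply: le_trans (near_le (fun=> 0)); rewrite ler0n.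
apply: exists_le_average.
  by apply/card_gt0P; exists [ffun=> Ordinal T0].
have conf e t : \sum_(phi : {ffun I -> 'I_#|T|}) rprob Pr (dn_confused phi e t) <=
    #|{ffun I -> 'I_#|T|}|%:R * (#|I|%:R * Nm / #|T|%:R).
  apply: sum_rprob_le => [phi|w]; first exact: measurable_dn_confused.
  pose near (u u' : vec) : R := (u' \in qball q (fun i =>
     sc e * (g e * (delta * c u i) + Y e i w)) b)%:R.
  apply: (@le_trans _ _ (\sum_t' \sum_(phi : {ffun I -> 'I_#|T|})
      (t' != t)%:R * near (dn_word phi t) (dn_word phi t'))).
    rewrite [leRHS]exchange_big /=; apply: ler_sum => phi _.
    case: asboolP => [[t' /andP[h1 h2]]|_]; last first.
      by apply: sumr_ge0 => t' _; rewrite mulr_ge0 // /near.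
    rewrite (bigD1 t')//= -[leLHS]addr0 lerD//.
      by rewrite h1 /near h2 mulr1.
    by apply: sumr_ge0 => s' _; rewrite mulr_ge0 // /near.
  rewrite mulrCA -[leRHS]mulrA -sum_cst; apply: ler_sum => t' _.
  have [->|tt] := eqVneq t' t.
    rewrite big1 ?mulr_ge0 ?divr_ge0 ?ler0n// => phi _; by rewrite mul0r.
  rewrite mulrA ler_pdivlMr// mulrC.
  (* Resampling the word of [t'] leaves that of [t], and so the received signal, unchanged. *)
  have := sum_fupd t' (fun phi : {ffun I -> 'I_#|T|} => true%:R * near (dn_word phi t) (dn_word phi t')).
  rewrite card_ord => ->.
  rewrite mulrC -sum_cst; apply: ler_sum => phi _.
  apply: le_trans (sum_near (fun i => sc e * (g e * (delta * c (dn_word phi t) i) + Y e i w))).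
  apply: ler_sum => a _; rewrite mul1r /near /dn_word fupd_in fupd_out//.
rewrite exchange_big /=.
rewrite [leRHS](_ : _ = \sum_(t : I) (#|{ffun I -> 'I_#|T|}|%:R * (2 * (e0 + #|I|%:R * Nm / #|T|%:R)))); last first.
  by rewrite sum_cst; ring.
apply: ler_sum => t _; rewrite big_split /=.
have one e : \sum_(phi : {ffun I -> 'I_#|T|}) rprob Pr (dn_err phi e t) <=
    #|{ffun I -> 'I_#|T|}|%:R * (e0 + #|I|%:R * Nm / #|T|%:R).
  apply: le_trans (ler_sum _ (fun phi _ => dn_err_le phi e t)) _.
  by rewrite big_split /= sum_cst mulrDr lerD2l.
by apply: le_trans (lerD (one false) (one true)) _; rewrite le_eqVlt; apply/orP; left; apply/eqP; ring.
Qed.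

End downlink.

(** * Asymptotics of the code parameters *)

Section asymptotics.
Variable R : realType.

Lemma natr_upper (x : R) : exists n0 : nat, forall n, (n0 <= n)%N -> x <= n%:R.
Proof.
exists (Num.truncn x).+1 => n h.
by rewrite (le_trans (ltW (truncnS_gt x)))// ler_nat.
Qed.

Lemma expR_ge_nat (k : R) : 0 < k -> exists n0 : nat, forall n, (n0 <= n)%N ->
  n%:R <= expR (k * n%:R).
Proof.
move=> k0; have [n0 h] := natr_upper (4 / k ^+ 2); exists n0 => n /h hn.
have n_ge0 : 0 <= n%:R :> R by [].
have e : expR (k * n%:R) = expR (k * n%:R / 2) ^+ 2.
  by rewrite expr2 -expRD; congr expR; field.
have h1 : 1 + k * n%:R / 2 <= expR (k * n%:R / 2) by exact: expR_ge1Dx.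
have h2 : (k * n%:R / 2) ^+ 2 <= expR (k * n%:R).
  rewrite e ler_sqr ?nnegrE ?expR_ge0//; first lra.
  by rewrite divr_ge0// mulr_ge0// ltW.
apply: le_trans h2; rewrite ler_pdivrMr ?exprn_gt0// in hn.
have : 0 <= (n%:R * k ^+ 2 - 4) * n%:R by rewrite mulr_ge0// subr_ge0.
nra.
Qed.

Lemma expR_small (k e : R) : 0 < k -> 0 < e -> exists n0 : nat, forall n, (n0 <= n)%N ->
  expR (- (k * n%:R)) <= e.
Proof.
move=> k0 e0; have [n0 h] := natr_upper (e^-1 / k); exists n0 => n /h hn.
rewrite expRN -[e]invrK lef_pV2 ?posrE ?expR_gt0 ?invr_gt0//.
rewrite ler_pdivrMr// in hn; apply: le_trans hn _; rewrite mulrC.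
by apply: le_trans (expR_ge1Dx _); rewrite lerDr.
Qed.

Lemma fact_le_expn (m : nat) : (m`! <= m ^ m)%N.
Proof.
elim: m => // m IH; rewrite factS expnS leq_mul2l /=.
by apply: leq_trans IH _; case: m => // m; rewrite leq_exp2r.
Qed.

Lemma exists_prime_le_fact (m : nat) : exists2 q, prime q & (m < q <= m`!.+1)%N.
Proof.
have m1 : (1 < m`!.+1)%N by rewrite ltnS fact_gt0.
exists (pdiv m`!.+1); first exact: pdiv_prime.
rewrite pdiv_leq// andbT ltnNge; apply/negP => h.
have d1 : (pdiv m`!.+1 %| m`!)%N by rewrite dvdn_fact// h pdiv_gt0.
have : (pdiv m`!.+1 %| 1)%N by rewrite -(dvdn_addr 1 d1) addn1 pdiv_dvd.
by rewrite dvdn1 => /eqP h1; have := pdiv_prime m1; rewrite h1.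
Qed.

Lemma ln_le_lin (a : R) : 0 < a -> exists2 C, 0 <= C & forall x, 0 < x -> ln x <= a * x + C.
Proof.
move=> a0; exists `|ln a| => // x x0.
have h : ln (a * x) <= a * x - 1.
  have := @le_ln1Dx R (a * x - 1); rewrite addrCA subrr addr0; apply.
  by rewrite ltrBrDr addNr mulr_gt0.
rewrite lnM ?posrE// in h; have := ler_norm (- ln a); rewrite normrN; lra.
Qed.

(** A prime above [m] is at most [m! + 1]. With [m] of the order of the square root of [n] this
    crude bound is [exp (O (sqrt n * ln n))], hence subexponential. *)
Lemma prime_subexp (w k : R) : 0 <= w -> 0 < k -> exists n0 : nat, forall n, (n0 <= n)%N ->
  exists q, [/\ prime q, w * n%:R < q%:R ^+ 2 & q%:R <= expR (k * n%:R)].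
Proof.
move=> w0 k0.
pose c := (Num.truncn w).+1; have wc : w <= c%:R ^+ 2.
  have h : w < c%:R by exact: truncnS_gt.
  have h1 : 1 <= c%:R :> R by rewrite ler1n.
  nra.
have c0 : 0 < (c.+1%:R : R) by rewrite ltr0n.
(* Chosen to give [a * M ^+ 2 <= k / 2 * j ^+ 2] for [M <= 2 * c.+1 * j]; the term linear in [M]
   takes the other half of [k]. *)
pose a := k / (8 * c.+1%:R ^+ 2).
have a0 : 0 < a by rewrite divr_gt0// mulr_gt0// exprn_gt0.
have [C C0 hC] := ln_le_lin a0.
have [j0 hj0] := natr_upper (4 * C * c.+1%:R / k).
exists (maxn 1 j0 ^ 2)%N => n hn.
have ex : exists j : nat, (j ^ 2 <= n)%N by exists 0%N.
have ub j : (j ^ 2 <= n)%N -> (j <= n)%N.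
  by apply: leq_trans; case: j => // j; rewrite -mulnn leq_pmulr.
(* [j] is the integer square root of [n]. *)
case: (ex_maxnP ex ub) => j jn jmax.
have jj : (maxn 1 j0 <= j)%N by exact: jmax.
have nj : (n < j.+1 ^ 2)%N by rewrite ltnNge; apply/negP => /jmax; rewrite ltnn.
pose m := (c * j.+1)%N.
have [q q_pr /andP[mq qm]] := exists_prime_le_fact m.
exists q; split => //.
  apply: (@lt_le_trans _ _ (m%:R ^+ 2)).
    rewrite /m natrM exprMn.
    apply: (@le_lt_trans _ _ (c%:R ^+ 2 * n%:R)); first exact: ler_wpM2r.
    by rewrite ltr_pM2l ?exprn_gt0 ?ltr0n// -natrX ltr_nat.
  by rewrite -!natrX ler_nat leq_exp2r// ltnW.
have M0 : (0 < m.+1%:R :> R) by rewrite ltr0n.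
have qM : (q <= m.+1 ^ m.+1)%N.
  apply: leq_trans qm _; apply: leq_trans (fact_le_expn m.+1); rewrite factS.
  have : (1 <= m)%N by rewrite muln_gt0.
  have : (0 < m`!)%N by rewrite fact_gt0.
  nia.
apply: (@le_trans _ _ (m.+1%:R ^+ m.+1)); first by rewrite -natrX ler_nat.
rewrite -[m.+1%:R]lnK ?posrE// -expRM_natl ler_expR.
have Mc : m.+1%:R <= c.+1%:R * j.+1%:R :> R.
  by rewrite -natrM ler_nat /m; lia.
have := hC _ M0; set M := m.+1%:R in M0 Mc *; move=> hM.
have h1 : M * ln M <= a * M ^+ 2 + C * M by nra.
have j1 : 1 <= j%:R :> R by rewrite ler1n; exact: leq_trans (leq_maxl _ _) jj.
have j4 : 4 * C * c.+1%:R / k <= j%:R by apply: hj0; exact: leq_trans (leq_maxr _ _) jj.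
rewrite ler_pdivrMr// in j4.
have jn' : j%:R ^+ 2 <= n%:R :> R by rewrite -natrX ler_nat.
have j2 : j.+1%:R <= 2 * j%:R :> R by rewrite -[j.+1]addn1 natrD; lra.
have M2 : M <= 2 * c.+1%:R * j%:R by nra.
have M3 : M ^+ 2 <= 4 * c.+1%:R ^+ 2 * j%:R ^+ 2.
  rewrite (_ : 4 * _ * _ = (2 * c.+1%:R * j%:R) ^+ 2); last by ring.
  rewrite ler_sqr//; first by rewrite nnegrE (ltW M0).
  by rewrite nnegrE mulr_ge0// mulr_ge0// (ltW c0).
have h2 : a * M ^+ 2 <= k / 2 * j%:R ^+ 2.
  have -> : k / 2 * j%:R ^+ 2 = a * (4 * c.+1%:R ^+ 2 * j%:R ^+ 2).
    by rewrite /a; field; rewrite gt_eqF.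
  by rewrite ler_pM2l.
have h3 : C * M <= k / 2 * j%:R ^+ 2.
  apply: (@le_trans _ _ (C * (2 * c.+1%:R * j%:R))); first exact: ler_wpM2l.
  nra.
nra.
Qed.

Lemma exists_ratio_between (x y : R) : 0 <= x -> x < y ->
  exists p m : nat, [/\ (0 < p)%N, (0 < m)%N, x < p%:R / m%:R & p%:R / m%:R < y].
Proof.
move=> x0 xy; pose m := (Num.truncn (1 / (y - x))).+1.
have m0 : 0 < (m%:R : R) by rewrite ltr0n.
have hm : 1 / (y - x) < m%:R by exact: truncnS_gt.
rewrite ltr_pdivrMr ?subr_gt0// in hm.
pose p := (Num.truncn (x * m%:R)).+1.
exists p, m; split => //.
  by rewrite ltr_pdivlMr//; exact: truncnS_gt.
rewrite ltr_pdivrMr//.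
have : p%:R <= x * m%:R + 1.
  rewrite /p -addn1 natrD lerD2r truncn_le// mulr_ge0// ltW//.
lra.
Qed.

(** In dimension n volumes scale like the power n/2 of the squared radius, so there is room for a
    rational dilation between [expR L] and [sqrt (A / B)]. The rounding costs a constant per
    coordinate, negligible against radii of order [1 / d ^+ 2] once [d] is small. *)
Lemma ball_ratio (A B L : R) : 0 < B -> expR (2 * L) * B < A ->
  exists2 d0, 0 < d0 & forall d, 0 < d -> d <= d0 -> forall (n q : nat), prime q ->
  4 * (n%:R * A / d ^+ 2) < q%:R ^+ 2 -> forall y : 'I_n -> R,
  expR (L * n%:R) * #|qball q y (n%:R * B / d ^+ 2)|%:R <= #|@qball R q n (fun=> 0) (n%:R * A / d ^+ 2)|%:R.
Proof.
move=> B0 BA.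
have A0 : 0 < A by apply: le_lt_trans BA; rewrite mulr_ge0 ?expR_ge0// ltW.
have e2 : expR (2 * L) = expR L ^+ 2 by rewrite expr2 -expRD; congr expR; ring.
have [||p [m [p0 m0 h1 h2]]] := @exists_ratio_between (expR L) (Num.sqrt (A / B)).
- exact: expR_ge0.
- rewrite -(ltr_pXn2r (_ : 0 < 2)%N) ?nnegrE ?expR_ge0 ?sqrtr_ge0//.
  by rewrite sqr_sqrtr ?divr_ge0 ?ltW// ltr_pdivlMr// -e2.
set rho := _ / _ in h1 h2.
have rho0 : 0 < rho by apply: lt_trans h1; exact: expR_gt0.
have hr : rho ^+ 2 * B < A.
  rewrite -ltr_pdivlMr// -[A / B]sqr_sqrtr ?divr_ge0 ?ltW//.
  by rewrite ltr_pXn2r// ?nnegrE ?sqrtr_ge0// ltW.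
have rB : 0 < rho ^+ 2 * B by rewrite mulr_gt0// exprn_gt0.
(* With this [th] the dilated radius [(1 + th) * rho ^+ 2 * B] is halfway between [rho ^+ 2 * B] and
   [A]; the other half [g] of the gap pays for the rounding. *)
pose th := (A - rho ^+ 2 * B) / (2 * (rho ^+ 2 * B)).
have th0 : 0 < th by rewrite divr_gt0 ?subr_gt0// mulr_gt0.
pose K := (1 + th^-1) * (rho + 2) ^+ 2.
have K0 : 0 < K.
  by rewrite mulr_gt0 ?exprn_gt0 ?addr_gt0 ?invr_gt0.
have half : (1 + th) * (rho ^+ 2 * B) = (A + rho ^+ 2 * B) / 2.
  by rewrite /th; field; rewrite !gt_eqF.
pose g := (A - rho ^+ 2 * B) / 2.
have g0 : 0 < g by rewrite divr_gt0 ?subr_gt0.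
exists (Num.sqrt (g / K)); first by rewrite sqrtr_gt0 divr_gt0.
move=> d d0 dd n q q_pr wr y.
have d2 : d ^+ 2 * K <= g.
  have gK : 0 <= g / K by apply: ltW; exact: divr_gt0.
  rewrite -ler_pdivlMr// -[g / K]sqr_sqrtr// ler_pXn2r//.
    by rewrite nnegrE ltW.
  by rewrite nnegrE sqrtr_ge0.
have dd0 : 0 < d ^+ 2 by rewrite exprn_gt0.
have := @qball_card R q n q_pr p m th (n%:R * B / d ^+ 2) (n%:R * A / d ^+ 2) y p0 m0 th0.
rewrite -/rho -/K => /(_ _ wr) h.
have {}h : (p ^ n * #|qball q y ((n%:R * B / d ^+ 2)%R)| <= m ^ n * #|@qball R q n (fun=> 0%R) ((n%:R * A / d ^+ 2)%R)|)%N.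
  apply: h; rewrite ler_pdivlMr// mulrDl.
  have -> : (1 + th) * rho ^+ 2 * (n%:R * B / d ^+ 2) * d ^+ 2 = n%:R * ((1 + th) * (rho ^+ 2 * B)).
    by field; rewrite gt_eqF.
  rewrite half -[_ * K * _]mulrA -mulrDr ler_wpM2l//.
  rewrite [K * _]mulrC; rewrite /g in d2; lra.
have mr : 0 < (m%:R : R) by rewrite ltr0n.
have mn : 0 < (m%:R : R) ^+ n by rewrite exprn_gt0.
apply: (@le_trans _ _ (rho ^+ n * #|qball q y (n%:R * B / d ^+ 2)|%:R)).
  rewrite ler_wpM2r// mulrC expRM_natl lerXn2r ?nnegrE ?expR_ge0 ?ltW//.
rewrite /rho expr_div_n mulrAC ler_pdivrMr// mulrC [leRHS]mulrC -!natrX -!natrM ler_nat.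
by rewrite mulnC.
Qed.

End asymptotics.

(** * Rate slack and code dimensions *)

Section gaps.
Variable R : realType.

Lemma exists_rate_gap (A B r : R) : 0 < B -> expR (2 * r) * B < A ->
  exists2 L, r < L & expR (2 * L) * B < A.
Proof.
move=> B0 h; have e0 := expR_gt0 (2 * r).
have A0 : 0 < A by apply: lt_trans h; rewrite mulr_gt0.
pose x := A / (expR (2 * r) * B).
have x1 : 1 < x by rewrite ltr_pdivlMr ?mulr_gt0// mul1r.
have x0 : 0 < x by apply: lt_trans x1.
have lx : 0 < ln x by rewrite ln_gt0.
exists (r + ln x / 4); first by rewrite ltrDl divr_gt0.
have -> : 2 * (r + ln x / 4) = 2 * r + ln x / 2 by field.
rewrite expRD -mulrA mulrCA -ltr_pdivlMr; last by rewrite mulr_gt0.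
rewrite -/x -[ltRHS]lnK ?posrE// ltr_expR; lra.
Qed.

Lemma card_rV_Fp (q m : nat) : prime q -> #|{: 'rV['F_q]_m}| = (q ^ m)%N.
Proof. by move=> q_pr; rewrite card_mx card_Fp// mul1n. Qed.

(** The least exponent overshoots by a factor of at most [q], which is free for subexponential
    [q]. *)
Lemma exists_dim (q : nat) (x : R) : (1 < q)%N -> 1 <= x ->
  exists k, x <= (q ^ k)%:R /\ (q ^ k)%:R <= q%:R * x.
Proof.
move=> q1 x1.
have ex : exists k, x <= (q ^ k)%:R.
  exists (Num.truncn x).+1; apply: le_trans (ltW (truncnS_gt x)) _.
  by rewrite ler_nat ltnW// ltn_expl.
case: (ex_minnP ex) => k hk kmin; exists k; split => //.
case: k hk kmin => [|k] hk kmin.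
  rewrite expn0 mulr1n; have q1R : 1 <= q%:R :> R by rewrite ler1n ltnW.
  by apply: (le_trans x1); rewrite ler_peMl//; exact: (le_trans ler01 x1).
rewrite expnS natrM ler_wpM2l// ltW// ltNge; apply/negP => /kmin.
by rewrite ltnn.
Qed.

End gaps.

(* [Lk * t / Q] is the mean number of typical words per message. *)
Lemma up_error_budget (R : realType) (N q k0 Lc L r e Lk t Q M : R) :
  0 < N -> 0 < t -> 0 < Lk -> 0 < Q -> 0 <= q -> 0 < e -> 0 <= M -> 0 < k0 ->
  N * Q / t <= Lk -> Lk <= q * (N * Q / t) ->
  N <= expR (k0 * N) -> q <= expR (k0 * N) -> M <= q * expR (r * N) ->
  16 * k0 <= Lc -> 16 * k0 <= L - r -> expR (- (k0 * N)) <= e / 4 -> 8 / e <= N ->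
  2 * Q / (Lk * t) + (Lk * t / Q) ^+ 2 * (t * expR (- (Lc * N)) / t) + e / 4
    + (Lk * t / Q) ^+ 3 * (M * (t * expR (- (L * N))) / t) <= e.
Proof.
move=> N0 t0 Lk0 Q0 q0 e0 M0 k00 kap1 kap2 N2 qexp qk k0c k0L N3 N4.
pose EE := Lk * t / Q.
(* The mean [EE] is at least [N], so covering succeeds, and at most [q * N], so the union over
   auxiliary indices is subexponential. *)
have EE1 : N <= EE by rewrite /EE ler_pdivlMr// -ler_pdivrMr.
have EE2 : EE <= q * N.
  by rewrite /EE ler_pdivrMr// -ler_pdivlMr// -!mulrA; rewrite -!mulrA in kap2.
have EE0 : 0 < EE by apply: lt_le_trans EE1.
have x0 := expR_ge0 (k0 * N).
have EEe : EE <= expR (2 * (k0 * N)).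
  apply: le_trans EE2 _; rewrite (_ : 2 * _ = k0 * N + k0 * N); last by ring.
  by rewrite expRD ler_pM// ltW.
have b1 : 2 * Q / (Lk * t) <= e / 4.
  have -> : 2 * Q / (Lk * t) = 2 / EE by rewrite /EE; field; rewrite !gt_eqF.
  rewrite ler_pdivrMr//; apply: (@le_trans _ _ (e / 4 * N)); last first.
    by rewrite ler_pM2l// divr_gt0.
  by rewrite ler_pdivrMr// in N4; lra.
have b2 : (Lk * t / Q) ^+ 2 * (t * expR (- (Lc * N)) / t) <= e / 4.
  apply: le_trans N3; rewrite [t * _]mulrC mulfK ?gt_eqF// -/EE.
  apply: (@le_trans _ _ (expR (2 * (k0 * N)) ^+ 2 * expR (- (Lc * N)))).
    by rewrite ler_wpM2r ?expR_ge0// lerXn2r ?nnegrE ?expR_ge0// ltW.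
  rewrite expr2 -!expRD ler_expR.
  have : 16 * k0 * N <= Lc * N by rewrite ler_wpM2r// ltW.
  have : 0 < k0 * N by rewrite mulr_gt0.
  lra.
have b3 : (Lk * t / Q) ^+ 3 * (M * (t * expR (- (L * N))) / t) <= e / 4.
  apply: le_trans N3; rewrite -/EE (_ : M * (t * _) / t = M * expR (- (L * N))); last first.
    by field; rewrite gt_eqF.
  apply: (@le_trans _ _ (expR (2 * (k0 * N)) ^+ 3 * (expR (k0 * N) * expR (r * N) * expR (- (L * N))))).
    apply: ler_pM.
    - by rewrite exprn_ge0// ltW.
    - by rewrite mulr_ge0 ?expR_ge0.
    - by rewrite lerXn2r ?nnegrE ?expR_ge0// ltW.
    - rewrite ler_wpM2r ?expR_ge0//; apply: le_trans qk _.
      by rewrite ler_wpM2r ?expR_ge0.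
  rewrite !exprS expr0 mulr1 -!expRD ler_expR.
  have : 16 * k0 * N <= (L - r) * N by rewrite ler_wpM2r// ltW.
  have : 0 < k0 * N by rewrite mulr_gt0.
  lra.
lra.
Qed.

(** * Uplink and downlink codes at all large lengths *)

Section up_asym.
Context d (Omega : measurableType d) (R : realType) (Pr : probability Omega R).
Context (Z : nat -> option 'I_3 -> Omega -> R).
Hypothesis iid : iid_std_normal Pr Z.

Lemma measurable_iid i a : measurable_fun setT (Z i a).
Proof. by case: iid. Qed.

Lemma rprob_noise (n : nat) (B g b : R) (a : option 'I_3) (o : nat) (x : 'I_n -> R) (e : R) :
  (Pr [set w | (b < \sum_i (B * x i + g * Z (o + i)%N a w) ^+ 2)%R] <= e%:E)%E ->
  rprob Pr [set w | b < \sum_i (B * x i + g * Z (o + i)%N a w) ^+ 2] <= e.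
Proof.
move=> h; rewrite -lee_fin rprobE//.
pose f w := \sum_i (B * x i + g * Z (o + i)%N a w) ^+ 2.
have mf : measurable_fun setT f.
  apply: measurable_sum => i; apply: measurable_funX; apply: measurable_funD => //.
  by apply: measurable_funM => //; exact: measurable_iid.
rewrite (_ : [set w | _] = f @^-1` `]b, +oo[).
  by rewrite -[X in measurable X]setTI; apply: mf => //; exact: measurable_itv.
by apply/seteqP; split => w /=; rewrite in_itv /= andbT.
Qed.

(** A long sum forces an inner product above [r * e1], so [u2] lies in a cap around the direction of
    [u1]; this cap fits into a ball of smaller radius, which holds an exponentially small share of
    the points. *)
Lemma cap_in_ball (q n : nat) (r e1 : R) (u1 u2 : 'rV['F_q]_n) : 0 < e1 ->
  u1 \in qball q (fun=> 0) r -> u2 \in qball q (fun=> 0) r ->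
  2 * r * (1 + e1) < \sum_i (((clift (u1 0 i))%:~R : R) + (clift (u2 0 i))%:~R) ^+ 2 ->
  u2 \in qball q (fun i => e1 * (clift (u1 0 i))%:~R) (r * (1 - e1 ^+ 2)).
Proof.
move=> e10; rewrite !qballE !sqdist0 => h1 h2 h3; rewrite /sqdist.
pose c1 i := (clift (u1 0 i))%:~R : R; pose c2 i := (clift (u2 0 i))%:~R : R.
pose I12 := \sum_i c1 i * c2 i.
have e3 : \sum_i (c1 i + c2 i) ^+ 2 = \sum_i c1 i ^+ 2 + \sum_i c2 i ^+ 2 + 2 * I12.
  by rewrite /I12 mulr_sumr -!big_split /=; apply: eq_bigr => i _; ring.
have e4 : \sum_i (e1 * c1 i - c2 i) ^+ 2 =
    e1 ^+ 2 * (\sum_i c1 i ^+ 2) + \sum_i c2 i ^+ 2 - 2 * e1 * I12.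
  by rewrite /I12 !mulr_sumr -!big_split -sumrB /=; apply: eq_bigr => i _; ring.
rewrite -/c1 -/c2 in h1 h2 h3 *; rewrite e4; rewrite e3 in h3.
have h4 : r * e1 < I12 by lra.
have h5 : e1 ^+ 2 * (\sum_i c1 i ^+ 2) <= e1 ^+ 2 * r by rewrite ler_wpM2l// sqr_ge0.
have h6 : e1 * (r * e1) <= e1 * I12 by rewrite ler_pM2l// ltW.
by rewrite /c1 /c2 in h5 h6 *; nra.
Qed.

Lemma up_asym (S r e : R) : 0 < S -> expR (2 * r) < 1 / 2 + S -> 0 < e ->
  exists (delta tB : R) (k0 : R) (n0 : nat), let beta := 2 * S / (2 * S + 1) in
  [/\ 0 < delta, 0 < k0 & forall n, (n0 <= n)%N -> forall q k, prime q ->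
    16 * (n%:R * S / delta ^+ 2) < q%:R ^+ 2 -> q%:R <= expR (k0 * n%:R) ->
    (q ^ k)%:R <= q%:R * expR (r * n%:R) -> forall (o : nat) (a : option 'I_3),
    exists kap (G : 'M['F_q]_(k + kap, n)) d1 d2,
    \sum_m1 \sum_m2 rprob Pr (up_err beta delta (n%:R * S / delta ^+ 2)
       (n%:R * tB / delta ^+ 2) (fun i : 'I_n => Z (o + i)%N a) G d1 d2 m1 m2)
    <= ((q ^ k)%:R) ^+ 2 * e].
Proof.
move=> S0 rS e0; pose beta := 2 * S / (2 * S + 1).
have S21 : 0 < 2 * S + 1 by lra.
have b0 : 0 < beta by rewrite divr_gt0 ?mulr_gt0.
have E0 := expR_gt0 (2 * r).
have bS : expR (2 * r) * beta < S.
  by rewrite /beta mulrA ltr_pdivrMr//; nra.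
(* The threshold lies strictly between the effective noise power, equal to [beta] by [Xb], and the
   largest power at which the ball ratio supports the rate [r]. *)
pose tB := (beta + S / expR (2 * r)) / 2.
have bS' : beta < S / expR (2 * r) by rewrite ltr_pdivlMr// mulrC.
have tB1 : beta < tB by rewrite /tB; lra.
have tB2 : tB < S / expR (2 * r) by rewrite /tB; lra.
have tB0 : 0 < tB by lra.
have [L rL LS] : exists2 L, r < L & expR (2 * L) * tB < S.
  by apply: exists_rate_gap => //; rewrite mulrC -ltr_pdivlMr.
pose X := (1 - beta) ^+ 2 * (2 * S).
have X0 : 0 <= X by rewrite mulr_ge0 ?sqr_ge0// mulr_ge0// ltW.
have Xb : X + beta ^+ 2 = beta by rewrite /X /beta; field; rewrite gt_eqF.
(* The excess energy of a typical sum adds [X * e1] to the effective noise, which must fit into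
   [tB - beta]; the bound 1/2 keeps the radius of the cap ball positive. *)
pose e1 := Num.min (1 / 2) ((tB - beta) / (2 * (X + 1))).
have X1 : 0 < 2 * (X + 1) by lra.
have e10 : 0 < e1 by rewrite lt_min divr_gt0//= divr_gt0// subr_gt0.
have e11 : e1 <= 1 / 2 by rewrite ge_min lexx.
have e1X : X * e1 < tB - beta.
  have : e1 <= (tB - beta) / (2 * (X + 1)) by rewrite ge_min lexx orbT.
  rewrite ler_pdivlMr//; nra.
have e1s : 0 < 1 - e1 ^+ 2 by nra.
have [Lc Lc0 LcS] : exists2 L, 0 < L & expR (2 * L) * (S * (1 - e1 ^+ 2)) < S.
  apply: exists_rate_gap; first exact: mulr_gt0.
  by rewrite mulr0 expR0 mul1r gtr_pMr// ltrBlDr ltrDl exprn_gt0.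
have Sc0 : 0 < S * (1 - e1 ^+ 2) by exact: mulr_gt0.
have [dl1 dl10 R1] := ball_ratio tB0 LS.
have [dl2 dl20 R2] := ball_ratio Sc0 LcS.
pose delta := Num.min dl1 dl2.
have dl0 : 0 < delta by rewrite lt_min dl10.
have hd1 : delta <= dl1 by rewrite ge_min lexx.
have hd2 : delta <= dl2 by rewrite ge_min lexx orbT.
have d20 : 0 < delta ^+ 2 by rewrite exprn_gt0.
(* Confusion loses [expR (7 * k0 * n)]: six from the cube of the mean number of words, one from [q]
   in the number of messages. One more [k0] is left for the decay, and 16 covers this amply. *)
pose k0 := Num.min Lc (L - r) / 16.
have k00 : 0 < k0 by rewrite divr_gt0// lt_min Lc0 subr_gt0.
have k0c : 16 * k0 <= Lc by rewrite /k0 mulrC divfK// ge_min lexx.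
have k0L : 16 * k0 <= L - r by rewrite /k0 mulrC divfK// ge_min lexx orbT.
pose V := 2 * S * (1 + e1) / delta ^+ 2.
have V0 : 0 <= V by rewrite divr_ge0 ?mulr_ge0 ?ltW//; lra.
have cond : (beta - 1) ^+ 2 * V + (beta / delta) ^+ 2 < tB / delta ^+ 2.
  rewrite /V expr_div_n mulrA -mulrDl ltr_pM2r ?invr_gt0//.
  have -> : (beta - 1) ^+ 2 * (2 * S * (1 + e1)) + beta ^+ 2 = X + beta ^+ 2 + X * e1.
    by rewrite /X; ring.
  rewrite Xb; lra.
have e4 : 0 < e / 4 by lra.
have [n1 N1] := noise_concentration iid V0 cond e4.
have [n2 N2] := expR_ge_nat k00.
have [n3 N3] := expR_small k00 e4.
have [n4 N4] := natr_upper (8 / e).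
exists delta, tB, k0, (maxn 2 (maxn (maxn n1 n2) (maxn n3 n4))); split=> // n.
rewrite !geq_max => /andP[n_ge2 /andP[/andP[/N1 {}N1 /N2 {}N2] /andP[/N3 {}N3 /N4 {}N4]]].
move=> q k q_pr wrap qexp qk o a.
have nR : 0 < n%:R :> R by rewrite ltr0n; exact: ltnW.
set rr := n%:R * S / delta ^+ 2 in wrap *.
have rr0 : 0 < rr by rewrite divr_gt0 ?mulr_gt0.
have wrap4 : 4 * rr < q%:R ^+ 2 by lra.
pose T := @qball R q n (fun=> 0) rr.
have T_gt0 : 0 < #|T|%:R :> R.
  rewrite ltr0n; apply/card_gt0P; exists 0; rewrite qballE sqdist0 big1 ?ltW//.
  by move=> i _; rewrite mxE clift0 expr0n.
pose Q : R := (q ^ n)%:R.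
have Q0 : 0 < Q by rewrite ltr0n expn_gt0 prime_gt0.
have TQ : #|T|%:R <= Q by rewrite ler_nat -card_rV_Fp// max_card.
have q1 : (1 < q)%N by exact: prime_gt1.
(* This many auxiliary words put at least [n] words of each message into the ball on average, which
   makes a failed covering unlikely. *)
have [kap [kap1 kap2]] : exists kap, n%:R * Q / #|T|%:R <= (q ^ kap)%:R /\
    (q ^ kap)%:R <= q%:R * (n%:R * Q / #|T|%:R).
  apply: exists_dim => //; rewrite ler_pdivlMr// mul1r; apply: le_trans TQ _.
  by rewrite ler_peMl ?(ltW Q0)// ler1n; exact: ltnW.
exists kap.
have near (y : 'I_n -> R) : #|qball q y (n%:R * tB / delta ^+ 2)|%:R <= #|T|%:R * expR (- (L * n%:R)) :> R.
  rewrite expRN ler_pdivlMr ?expR_gt0// [leLHS]mulrC.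
  exact: (R1 delta dl0 hd1 n q q_pr wrap4 y).
have cap (u1 : 'rV['F_q]_n) : u1 \in T ->
   \sum_(u2 : 'rV['F_q]_n) ((u2 \in T) && (n%:R * V < \sum_i ((clift (u1 0 i))%:~R + (clift (u2 0 i))%:~R) ^+ 2))%:R
     <= #|T|%:R * expR (- (Lc * n%:R)).
  move=> u1T.
  apply: (@le_trans _ _ (#|qball q (fun i => e1 * (clift (u1 0 i))%:~R) (n%:R * (S * (1 - e1 ^+ 2)) / delta ^+ 2)|%:R)); last first.
    rewrite expRN ler_pdivlMr ?expR_gt0// [leLHS]mulrC.
    exact: (R2 delta dl0 hd2 n q q_pr wrap4).
  rewrite -sum_mem; apply: ler_sum => u2 _; rewrite ler_nat.
  case: (boolP (u2 \in T)) => //= u2T; case: ltP => //= hV.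
  rewrite (_ : n%:R * (S * (1 - e1 ^+ 2)) / delta ^+ 2 = rr * (1 - e1 ^+ 2)); last first.
    by rewrite /rr; ring.
  rewrite (cap_in_ball (u1 := u1))//.
  apply: le_lt_trans hV; rewrite le_eqVlt; apply/orP; left; apply/eqP.
  by rewrite /rr /V; ring.
have noise (x : 'I_n -> R) : \sum_i x i ^+ 2 <= n%:R * V ->
  rprob Pr [set w | n%:R * tB / delta ^+ 2 < \sum_i ((beta - 1) * x i + beta / delta * Z (o + i)%N a w) ^+ 2] <= e / 4.
  by move=> hx; apply: rprob_noise; rewrite -mulrA; exact: N1.
have [] := @up_code_exists _ _ R Pr q k kap n beta delta rr _ _ _ _ _ _ q_pr dl0
  (fun i => measurable_iid _ _) wrap near cap noise T_gt0 (ltW e4).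
rewrite -/T !card_rV_Fp// => G [d1 [d2 h]]; exists G, d1, d2.
apply: le_trans h _; rewrite ler_wpM2l ?sqr_ge0//.
rewrite -/Q; apply: (up_error_budget (N := n%:R) (q := q%:R) (k0 := k0) (r := r)) => //.
by rewrite ltr0n expn_gt0 ltnW.
Qed.

Lemma dn_asym (P r e : R) (g : bool -> R) : 0 < P -> (forall b, g b != 0) ->
  (forall b, expR (2 * r) < 1 + g b ^+ 2 * P) -> 0 < e ->
  exists (beta delta tB : R) (k0 : R) (n0 : nat),
  [/\ 0 < delta, 0 < k0 & forall n, (n0 <= n)%N -> forall q, prime q ->
    16 * (n%:R * P / delta ^+ 2) < q%:R ^+ 2 -> q%:R <= expR (k0 * n%:R) ->
    forall (I : finType) (t0 : I), #|I|%:R <= q%:R * expR (r * n%:R) ->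
    forall (o : nat) (a : bool -> option 'I_3),
    exists phi : {ffun I -> 'I_#|@qball R q n (fun=> 0) (n%:R * P / delta ^+ 2)|},
    let Y b (i : 'I_n) := Z (o + i)%N (a b) in
    \sum_t (rprob Pr (dn_err t0 beta delta (n%:R * tB / delta ^+ 2) g Y phi false t) +
       rprob Pr (dn_err t0 beta delta (n%:R * tB / delta ^+ 2) g Y phi true t))
    <= #|I|%:R * e].
Proof.
move=> P0 g0 rP e0.
(* The weaker gain sets [beta]; by [sgb] the same [beta] leaves the other user no more effective
   noise. *)
pose ga := Num.min (g false ^+ 2) (g true ^+ 2).
have g20 b : 0 < g b ^+ 2 by rewrite exprn_even_gt0 //= g0.
have ga0 : 0 < ga by rewrite lt_min !g20.
have gab b : ga <= g b ^+ 2 by case: b; rewrite ge_min lexx ?orbT.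
have rga : expR (2 * r) < 1 + ga * P by rewrite /ga minElt; case: ifP => _; exact: rP.
have gP0 : 0 < P * ga by rewrite mulr_gt0.
have gP1 : 0 < P * ga + 1 by rewrite addr_gt0.
pose beta := P * ga / (P * ga + 1).
(* The minimal mean square error at squared gain [ga]. As a single word is sent,
   [P / sg = 1 + P * ga] and nothing of the capacity is lost. *)
pose sg := P / (P * ga + 1).
have sg0 : 0 < sg by rewrite divr_gt0.
have sgE : (beta - 1) ^+ 2 * P + beta ^+ 2 / ga = sg.
  by rewrite /sg /beta; field; rewrite !gt_eqF.
have sgb b : (beta - 1) ^+ 2 * P + beta ^+ 2 / g b ^+ 2 <= sg.
  by rewrite -sgE lerD2l ler_wpM2l ?sqr_ge0// lef_pV2 ?posrE.
have rs : expR (2 * r) * sg < P.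
  rewrite /sg mulrCA gtr_pMr// ltr_pdivrMr// mul1r.
  by apply: lt_le_trans rga _; rewrite addrC mulrC.
have E0 := expR_gt0 (2 * r).
pose tB := (sg + P / expR (2 * r)) / 2.
have rs' : sg < P / expR (2 * r) by rewrite ltr_pdivlMr// mulrC.
have tB1 : sg < tB by rewrite /tB; lra.
have tB2 : tB < P / expR (2 * r) by rewrite /tB; lra.
have tB0 : 0 < tB by apply: lt_trans tB1.
have [L rL LS] : exists2 L, r < L & expR (2 * L) * tB < P.
  by apply: exists_rate_gap => //; rewrite mulrC -ltr_pdivlMr.
have [delta dl0 R1] := ball_ratio tB0 LS.
have d20 : 0 < delta ^+ 2 by rewrite exprn_gt0.
pose k0 := (L - r) / 16.
have k00 : 0 < k0 by rewrite divr_gt0// subr_gt0.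
have V0 : 0 <= P / delta ^+ 2 by rewrite divr_ge0 ?(ltW P0) ?(ltW d20).
have cond b : (beta - 1) ^+ 2 * (P / delta ^+ 2) + (beta / delta / g b) ^+ 2 < tB / delta ^+ 2.
  have -> : (beta - 1) ^+ 2 * (P / delta ^+ 2) + (beta / delta / g b) ^+ 2 =
      ((beta - 1) ^+ 2 * P + beta ^+ 2 / g b ^+ 2) / delta ^+ 2.
    by field; rewrite g0 gt_eqF.
  by rewrite ltr_pM2r ?invr_gt0//; apply: le_lt_trans tB1.
have e4 : 0 < e / 4 by rewrite divr_gt0.
have [n1 N1] := noise_concentration iid V0 (cond false) e4.
have [n2 N2] := noise_concentration iid V0 (cond true) e4.
have [n3 N3] := expR_small k00 e4.
exists beta, delta, tB, k0, (maxn (maxn n1 n2) n3); split=> // n.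
rewrite !geq_max => /andP[/andP[/N1 {}N1 /N2 {}N2] /N3 {}N3].
move=> q q_pr wrap qexp I t0 cI o a.
set rr := n%:R * P / delta ^+ 2 in wrap *.
have rr0 : 0 <= rr by rewrite mulr_ge0 ?invr_ge0 ?(ltW d20)// mulr_ge0// ltW.
have wrap4 : 4 * rr < q%:R ^+ 2.
  by apply: le_lt_trans wrap; rewrite ler_wpM2r// ler_nat.
pose T := @qball R q n (fun=> 0) rr.
have T0 : (0 < #|T|)%N.
  apply/card_gt0P; exists 0; rewrite qballE sqdist0 big1// => i _.
  by rewrite mxE clift0 expr0n.
have T_gt0 : 0 < #|T|%:R :> R by rewrite ltr0n.
have near (y : 'I_n -> R) : #|qball q y (n%:R * tB / delta ^+ 2)|%:R <= #|T|%:R * expR (- (L * n%:R)) :> R.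
  rewrite expRN ler_pdivlMr ?expR_gt0// [leLHS]mulrC.
  exact: (R1 delta dl0 (lexx _) n q q_pr wrap4 y).
pose Y b (i : 'I_n) := Z (o + i)%N (a b).
have noise b (x : 'I_n -> R) : \sum_i x i ^+ 2 <= rr ->
  rprob Pr [set w | n%:R * tB / delta ^+ 2 < \sum_i ((beta - 1) * x i + beta / delta / g b * Y b i w) ^+ 2] <= e / 4.
  move=> hx; apply: rprob_noise; rewrite -mulrA.
  by case: b; [apply: N2|apply: N1]; apply: le_trans hx _; rewrite /rr mulrA.
have [phi h] := @dn_code_exists _ _ R Pr I t0 q n beta delta rr _ _ _ g Y dl0 g0
  (fun b i => measurable_iid _ _) near noise T0.
exists phi => /=; apply: le_trans h _.
rewrite (mulrC 2) -[leLHS]mulrA ler_wpM2l//.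
have -> : #|I|%:R * (#|T|%:R * expR (- (L * n%:R))) / #|T|%:R = #|I|%:R * expR (- (L * n%:R)).
  by field; rewrite gt_eqF.
have : #|I|%:R * expR (- (L * n%:R)) <= e / 4.
  apply: le_trans N3; apply: (@le_trans _ _ (expR (k0 * n%:R) * expR (r * n%:R) * expR (- (L * n%:R)))).
    rewrite ler_wpM2r ?expR_ge0//; apply: le_trans cI _.
    by rewrite ler_wpM2r ?expR_ge0.
  rewrite -!expRD ler_expR.
  have -> : - (k0 * n%:R) = - (2 * k0 * n%:R) + k0 * n%:R by ring.
  have -> : k0 * n%:R + r * n%:R - L * n%:R = - ((L - r) * n%:R) + k0 * n%:R by ring.
  rewrite lerD2r lerN2 ler_wpM2r//.
  have -> : L - r = 16 * k0 by rewrite /k0; field.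
  by rewrite ler_pM2r// ler_nat.
move=> hh; rewrite [leRHS](_ : e = 2 * (e / 4 + e / 4)); last by field.
by rewrite ler_pM2l// lerD2l.
Qed.

End up_asym.

(** * Codes for one slot *)

(* The slot serves a pair of users, [false] and [true], who exchange messages
   below [sl_size]; the relay decodes an index and broadcasts it. *)
Record slotcode (R : realType) := SlotCode {
  sl_size : nat;
  sl_up : bool -> nat -> nat -> R;
  sl_rel : (nat -> R) -> nat;
  sl_down : nat -> nat -> R;
  sl_dec : bool -> (nat -> R) -> nat -> nat }.

(** Samples outside the slot are replaced by 0, so that a slot code sees its own window only. *)
Definition trunc_sig (R : realType) (n : nat) (y : nat -> R) : nat -> R :=
  fun i => if (i < n)%N then y i else 0.

Section slot.
Context d (Omega : measurableType d) (R : realType) (Pr : probability Omega R).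
Context (Z : nat -> option 'I_3 -> Omega -> R).

Section slot_def.
Variables (s : slotcode R) (n : nat) (g : bool -> R) (j : bool -> 'I_3) (u dn : nat).

Definition slot_relay (m : bool -> nat) (w : Omega) : nat :=
  sl_rel s (trunc_sig n (fun i => g false * sl_up s false (m false) i +
    g true * sl_up s true (m true) i + Z (u + i)%N None w)).

Definition slot_dec (m : bool -> nat) (b : bool) (w : Omega) : nat :=
  sl_dec s b (trunc_sig n (fun i => g b * sl_down s (slot_relay m w) i +
    Z (dn + i)%N (Some (j b)) w)) (m b).

Definition slot_err (m : bool -> nat) : set Omega :=
  [set w | exists b, slot_dec m b w != m (~~ b)].

Definition pairm (m0 m1 : nat) (b : bool) := if b then m1 else m0.

(** Rates are in nats. The power [p] of a user within a slot may exceed [P], as the budget is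
    balanced over all slots later. Power bounds hold for each message and each broadcast index,
    hence also after a relay error. *)
Record slot_ok (r e P : R) (p : bool -> R) : Prop := SlotOk {
  sl_size_gt0 : (0 < sl_size s)%N;
  sl_rate : expR (r * n%:R) <= (sl_size s)%:R;
  sl_up_power : forall b m, \sum_(i < n) sl_up s b m i ^+ 2 <= n%:R * p b;
  sl_down_power : forall t, \sum_(i < n) sl_down s t i ^+ 2 <= n%:R * P;
  sl_rel_meas : forall y : nat -> Omega -> R, (forall i, measurable_fun setT (y i)) ->
    forall t, measurable [set w | sl_rel s (y^~ w) = t];
  sl_dec_meas : forall (y : nat -> Omega -> R) b m, (forall i, measurable_fun setT (y i)) ->
    forall t, measurable [set w | sl_dec s b (y^~ w) m = t];
  sl_err : \sum_(m0 < sl_size s) \sum_(m1 < sl_size s) rprob Pr (slot_err (pairm m0 m1))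
     <= (sl_size s)%:R ^+ 2 * e }.

End slot_def.

(** Fills the slots of zero rate or zero length, for which random coding has nothing to offer. *)
Definition trivial_slot : slotcode R :=
  @SlotCode R 1 (fun _ _ _ => 0) (fun _ => 0%N) (fun _ _ => 0) (fun _ _ _ => 0%N).

Lemma measurable_fun_const_eq (x t : nat) : measurable [set w : Omega | x = t].
Proof.
have [->|/eqP xt] := eqVneq x t.
  rewrite (_ : [set w | _] = setT); first exact: measurableT.
  by apply/seteqP; split => w _ /=.
rewrite (_ : [set w | _] = set0); first exact: measurable0.
by apply/seteqP; split => w /=.
Qed.

Lemma trivial_slot_ok n g j u dn (r e P : R) (p : bool -> R) :
  r * n%:R <= 0 -> 0 <= e -> 0 <= P -> (forall b, 0 <= p b) ->
  slot_ok trivial_slot n g j u dn r e P p.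
Proof.
move=> r0 e0 P0 p0; split => //=.
- by rewrite -[leRHS]expR0 ler_expR.
- by move=> b _; rewrite big1 ?mulr_ge0// => i _; rewrite expr0n.
- by move=> _; rewrite big1 ?mulr_ge0// => i _; rewrite expr0n.
- by move=> y _ t; exact: measurable_fun_const_eq.
- by move=> y b m _ t; exact: measurable_fun_const_eq.
rewrite big1 ?expr1n ?mul1r// => m0 _; rewrite big1// => m1 _.
rewrite (_ : slot_err _ _ _ _ _ _ _ = set0) /rprob ?measure0//.
by apply/seteqP; split => w // [b]; rewrite !ord1; case: b.
Qed.

Lemma measurable_nat_comp (T : Omega -> nat) (f : nat -> R) :
  (forall t, measurable [set w | T w = t]) -> measurable_fun setT (fun w => f (T w)).
Proof.
move=> mT _ B mB; rewrite setTI.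
rewrite (_ : _ @^-1` B = \bigcup_(t in [set t | B (f t)]) [set w | T w = t]).
  by apply: bigcup_measurable => t _; exact: mT.
apply/seteqP; split => w /=; first by move=> h; exists (T w).
by move=> [t Bt ->].
Qed.

Lemma measurable_trunc n (y : nat -> Omega -> R) i :
  (forall i, measurable_fun setT (y i)) ->
  measurable_fun setT (fun w => trunc_sig n (y^~ w) i).
Proof. by move=> my; rewrite /trunc_sig; case: (i < n)%N; [exact: my|exact: measurable_cst]. Qed.

Hypothesis iid : iid_std_normal Pr Z.

Section slot_measurable.
Variables (s : slotcode R) (n : nat) (g : bool -> R) (j : bool -> 'I_3) (u dn : nat).
Hypothesis rel_meas : forall y : nat -> Omega -> R, (forall i, measurable_fun setT (y i)) ->
  forall t, measurable [set w | sl_rel s (y^~ w) = t].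
Hypothesis dec_meas : forall (y : nat -> Omega -> R) b m, (forall i, measurable_fun setT (y i)) ->
  forall t, measurable [set w | sl_dec s b (y^~ w) m = t].

Lemma measurable_slot_relay m t : measurable [set w | slot_relay s n g u m w = t].
Proof.
apply: (rel_meas (y := fun i w => trunc_sig n (fun i => g false * sl_up s false (m false) i +
    g true * sl_up s true (m true) i + Z (u + i)%N None w) i)) => i.
apply: (measurable_trunc _ (y := fun i w => g false * sl_up s false (m false) i +
    g true * sl_up s true (m true) i + Z (u + i)%N None w)) => k.
by apply: measurable_funD => //; exact: (measurable_iid iid).
Qed.

Lemma measurable_slot_dec m b t : measurable [set w | slot_dec s n g j u dn m b w = t].
Proof.
apply: (dec_meas (y := fun i w => trunc_sig n (fun i => g b * sl_down s (slot_relay s n g u m w) i +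
    Z (dn + i)%N (Some (j b)) w) i)) => i.
apply: (measurable_trunc _ (y := fun i w => g b * sl_down s (slot_relay s n g u m w) i +
    Z (dn + i)%N (Some (j b)) w)) => k.
apply: measurable_funD; last exact: (measurable_iid iid).
apply: measurable_funM => //.
by apply: (measurable_nat_comp (sl_down s ^~ k)) => t'; exact: measurable_slot_relay.
Qed.

Lemma measurable_slot_err m : measurable (slot_err s n g j u dn m).
Proof.
have mA b : measurable [set w | slot_dec s n g j u dn m b w != m (~~ b)].
  rewrite (_ : [set w | _] = ~` [set w | slot_dec s n g j u dn m b w = m (~~ b)]).
    by apply: measurableC; exact: measurable_slot_dec.
  by apply/seteqP; split => w /=; [move/eqP|move=> h; apply/eqP].
exact: (measurable_exists_fin mA).
Qed.

End slot_measurable.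

Lemma measurable_fin_comp (I : finType) (f : Omega -> I) (h : I -> nat) t :
  (forall v, measurable [set w | f w = v]) -> measurable [set w | h (f w) = t].
Proof.
move=> mf.
rewrite (_ : [set w | _] = \bigcup_(v in [set v | h v = t]) [set w | f w = v]).
  by apply: fin_bigcup_measurable => // v _; exact: mf.
apply/seteqP; split => w /=; first by move=> e; exists (f w).
by move=> [v /= <- ->].
Qed.

Section assembly.
Variables (q k kap n : nat) (g : bool -> R) (j : bool -> 'I_3) (u dn : nat).
Variables (bu du ru tu bd dd rd td : R).
Variables (G : 'M['F_q]_(k + kap, n)) (d1 d2 : 'rV['F_q]_n).
Variable phi : {ffun 'rV['F_q]_k -> 'I_#|@qball R q n (fun=> 0) rd|}.
Hypothesis q_pr : prime q.
Hypothesis g0 : forall b, g b != 0.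
Hypothesis ru0 : 0 <= ru.

Notation msg := ('rV['F_q]_k).

Definition msg_of (m : nat) : msg :=
  if insub m is Some i then enum_val (i : 'I_#|{: msg}|) else 0.
Definition nat_of_msg (v : msg) : nat := val (enum_rank v).

Lemma msg_of_ord (m : 'I_#|{: msg}|) : msg_of m = enum_val m.
Proof. by rewrite /msg_of valK. Qed.

Lemma msg_ofK (m : 'I_#|{: msg}|) : nat_of_msg (msg_of m) = m.
Proof. by rewrite msg_of_ord /nat_of_msg enum_valK. Qed.

Definition ext_sig (x : 'I_n -> R) (i : nat) : R := if insub i is Some i' then x i' else 0.

Lemma ext_sigE (x : 'I_n -> R) (i : 'I_n) : ext_sig x i = x i.
Proof. by rewrite /ext_sig valK. Qed.

(** Dividing by the gain aligns the two words at the common scale [du], so the relay receives [du]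
    times a sum of two integer words plus noise. *)
Definition assembled : slotcode R := @SlotCode R #|{: msg}|
  (fun b m => ext_sig (fun i => amp du (up_enc ru G (if b then d2 else d1) (msg_of m)) i / g b))
  (fun y => nat_of_msg (up_dec bu du tu G (d1 + d2) (fun i : 'I_n => y i)))
  (fun t => ext_sig (fun i => dd * (clift (dn_word phi (msg_of t) 0 i))%:~R))
  (fun b y m => nat_of_msg (dn_dec 0 bd dd td g phi b (fun i : 'I_n => y i) - msg_of m)).

Let Yu (i : 'I_n) := Z (u + i)%N None.
Let Yd b (i : 'I_n) := Z (dn + i)%N (Some (j b)).

Lemma assembled_relay (m : bool -> nat) w :
  slot_relay assembled n g u m w =
  nat_of_msg (up_dec bu du tu G (d1 + d2) (fun i => amp du (up_enc ru G d1 (msg_of (m false))) i +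
     amp du (up_enc ru G d2 (msg_of (m true))) i + Yu i w)).
Proof.
rewrite /slot_relay /=; congr (nat_of_msg (up_dec _ _ _ _ _ _)).
apply/funext => i; rewrite /trunc_sig ltn_ord !ext_sigE.
by rewrite ![g _ * _]mulrC !divfK.
Qed.

(** Unless the uplink fails, the broadcast index is the true sum and no longer random, so the
    downlink bound for a fixed index applies. *)
Lemma assembled_err (m0 m1 : 'I_#|{: msg}|) :
  slot_err assembled n g j u dn (pairm m0 m1) `<=`
  up_err bu du ru tu Yu G d1 d2 (enum_val m0) (enum_val m1) `|`
  (dn_err 0 bd dd td g Yd phi false (enum_val m0 + enum_val m1) `|`
   dn_err 0 bd dd td g Yd phi true (enum_val m0 + enum_val m1)).
Proof.
move=> w [b] berr.
have [hu|hu] := boolP (up_dec bu du tu G (d1 + d2)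
    (fun i => amp du (up_enc ru G d1 (enum_val m0)) i + amp du (up_enc ru G d2 (enum_val m1)) i + Yu i w)
    == enum_val m0 + enum_val m1); last by left.
right; have {}hu := eqP hu.
suff : dn_err 0 bd dd td g Yd phi b (enum_val m0 + enum_val m1) w by case: (b); [right|left].
move: berr; rewrite /dn_err /slot_dec assembled_relay /= !msg_of_ord hu.
apply: contra => /eqP h.
have e : dn_dec 0 bd dd td g phi b (fun i : 'I_n => trunc_sig n
     (fun i0 => g b * ext_sig (fun i1 => dd * (clift (dn_word phi
        (enum_val (enum_rank (enum_val m0 + enum_val m1 : msg))) 0 i1))%:~R) i0 + Z (dn + i0)%N (Some (j b)) w) i)
     = enum_val m0 + enum_val m1.
  rewrite -[RHS]h; congr (dn_dec _ _ _ _ _ _ _ _); apply/funext => i.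
  by rewrite /trunc_sig ltn_ord ext_sigE enum_rankK.
rewrite e; apply/eqP; case: (b); rewrite /pairm /= msg_of_ord.
  by rewrite addrK -msg_of_ord msg_ofK.
by rewrite addrC addKr -msg_of_ord msg_ofK.
Qed.

Lemma assembled_meas_rel (y : nat -> Omega -> R) t : (forall i, measurable_fun setT (y i)) ->
  measurable [set w | sl_rel assembled (y^~ w) = t].
Proof.
move=> my; apply: (measurable_fin_comp nat_of_msg) => v.
have := @measurable_up_dec _ Omega R q k kap n bu du tu (fun i : 'I_n => y i)
  (fun i => my i) G (d1 + d2) (fun=> 0) v.
congr (measurable _); apply/seteqP; split => w /=;
  by have -> : (fun i : 'I_n => 0 + y i w) = (fun i : 'I_n => y i w) by apply/funext => i; rewrite add0r.
Qed.

Lemma assembled_meas_dec (y : nat -> Omega -> R) b m t : (forall i, measurable_fun setT (y i)) ->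
  measurable [set w | sl_dec assembled b (y^~ w) m = t].
Proof.
move=> my; apply: (measurable_fin_comp (fun v => nat_of_msg (v - msg_of m))) => v.
have := @measurable_dn_dec _ Omega R msg 0 q n bd dd rd td g (fun b (i : 'I_n) => y i)
  (fun b i => my i) phi b (fun=> 0) v.
congr (measurable _); apply/seteqP; split => w /=;
  by have -> : (fun i : 'I_n => 0 + y i w) = (fun i : 'I_n => y i w) by apply/funext => i; rewrite add0r.
Qed.

Lemma assembled_up_power b m :
  \sum_(i < n) sl_up assembled b m i ^+ 2 <= du ^+ 2 * ru / g b ^+ 2.
Proof.
under eq_bigr do rewrite /= ext_sigE exprMn exprVn.
rewrite -mulr_suml ler_wpM2r ?invr_ge0 ?sqr_ge0//.
have [[v [l [-> vT _]]]|] := up_encP ru G (if b then d2 else d1) (msg_of m).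
  rewrite /amp; under eq_bigr do rewrite exprMn.
  by rewrite -mulr_sumr ler_wpM2l ?sqr_ge0//; rewrite qballE sqdist0 in vT.
move=> /forallP unc; rewrite /up_enc; case: pickP => [v /andP[vT /existsP[l /eqP e]]|_].
  by have := unc l; rewrite e vT.
rewrite big1 => [|i _]; last by rewrite expr0n.
by apply: mulr_ge0 => //; exact: sqr_ge0.
Qed.

Lemma assembled_down_power t :
  \sum_(i < n) sl_down assembled t i ^+ 2 <= dd ^+ 2 * rd.
Proof.
under eq_bigr do rewrite /= ext_sigE exprMn.
rewrite -mulr_sumr ler_wpM2l ?sqr_ge0//.
by have := dn_wordT phi (msg_of t); rewrite qballE sqdist0.
Qed.

End assembly.

Lemma sum_enum_val (I : finType) (F : I -> R) : \sum_(i < #|I|) F (enum_val i) = \sum_v F v.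
Proof. by rewrite [RHS](reindex _ (onW_bij _ (@enum_val_bij I))). Qed.

Lemma pair_code (g : bool -> R) (j : bool -> 'I_3) (p : bool -> R) (S P r e : R) :
  0 < S -> (forall b, S <= g b ^+ 2 * p b) -> 0 < P -> 0 <= r ->
  expR (2 * r) < 1 / 2 + S -> (forall b, expR (2 * r) < 1 + g b ^+ 2 * P) -> 0 < e ->
  exists n0 : nat, forall n, (n0 <= n)%N -> forall u dn,
  exists s, slot_ok s n g j u dn r e P p.
Proof.
move=> S0 Sp P0 r0 rS rP e0.
have g0 b : g b != 0.
  by apply/eqP => h; have := Sp b; rewrite h expr0n mul0r leNgt S0.
have e4 : 0 < e / 4 by rewrite divr_gt0.
have [du [tu [ku [nu [du0 ku0 U]]]]] := up_asym iid S0 rS e4.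
have [beta [dd [td [kd [nd [dd0 kd0 D]]]]]] := dn_asym iid P0 g0 rP e4.
have k00 : 0 < Num.min ku kd by rewrite lt_min ku0.
(* One prime has to meet the wraparound conditions of both uplink and downlink. *)
pose w := Num.max (16 * (S / du ^+ 2)) (16 * (P / dd ^+ 2)) + 1.
have su0 : 0 < S / du ^+ 2 by rewrite divr_gt0 ?exprn_gt0.
have sd0 : 0 < P / dd ^+ 2 by rewrite divr_gt0 ?exprn_gt0.
have w1 : 16 * (S / du ^+ 2) <= w by rewrite /w ler_wpDr// le_max lexx.
have w2 : 16 * (P / dd ^+ 2) <= w by rewrite /w ler_wpDr// le_max lexx orbT.
have w0 : 0 <= w by apply: le_trans w1; rewrite mulr_ge0// ltW.
have [nq Q] := prime_subexp w0 k00.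
exists (maxn nq (maxn nu nd)) => n; rewrite !geq_max => /andP[/Q {}Q /andP[/U {}U /D {}D]] u dn.
have [q [q_pr wq qk]] := Q.
have n_ge0 : 0 <= n%:R :> R by [].
have wrapu : 16 * (n%:R * S / du ^+ 2) < q%:R ^+ 2.
  apply: le_lt_trans wq; rewrite -mulrA mulrCA mulrC; exact: ler_wpM2r.
have wrapd : 16 * (n%:R * P / dd ^+ 2) < q%:R ^+ 2.
  apply: le_lt_trans wq; rewrite -mulrA mulrCA mulrC; exact: ler_wpM2r.
have qku : q%:R <= expR (ku * n%:R).
  by apply: le_trans qk _; rewrite ler_expR ler_wpM2r// ge_min lexx.
have qkd : q%:R <= expR (kd * n%:R).
  by apply: le_trans qk _; rewrite ler_expR ler_wpM2r// ge_min lexx orbT.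
have [k [hk1 hk2]] : exists k, expR (r * n%:R) <= (q ^ k)%:R /\ (q ^ k)%:R <= q%:R * expR (r * n%:R).
  apply: exists_dim; first exact: prime_gt1.
  by rewrite -[leLHS]expR0 ler_expR mulr_ge0.
have [kap [G [d1 [d2 hU]]]] := U q k q_pr wrapu qku hk2 u None.
have cI : #|{: 'rV['F_q]_k}|%:R <= q%:R * expR (r * n%:R) :> R by rewrite card_rV_Fp.
have [phi hD] := D q q_pr wrapd qkd 'rV['F_q]_k (0 : 'rV['F_q]_k) cI dn (fun b => Some (j b)).
set ru := n%:R * S / du ^+ 2 in hU *.
have ru0 : 0 <= ru by rewrite divr_ge0 ?sqr_ge0// mulr_ge0// ltW.
set bu := 2 * S / (2 * S + 1) in hU.
set tu' := n%:R * tu / du ^+ 2 in hU; set rd := n%:R * P / dd ^+ 2 in phi hD; set td' := n%:R * td / dd ^+ 2 in hD.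
exists (assembled g bu du ru tu' beta dd td' G d1 d2 phi); split.
- by apply/card_gt0P; exists 0.
- by rewrite /= card_rV_Fp.
- move=> b m; apply: le_trans (assembled_up_power g bu du tu' beta dd td' G d1 d2 phi ru0 b m) _.
  rewrite /ru ler_pdivrMr; last by rewrite exprn_even_gt0//= g0.
  rewrite mulrC divfK ?gt_eqF ?exprn_gt0// -mulrA ler_wpM2l//.
  by rewrite mulrC; exact: Sp.
- move=> t; apply: le_trans (assembled_down_power g bu du ru tu' beta dd td' G d1 d2 phi t) _.
  by rewrite /rd mulrC divfK// gt_eqF// exprn_gt0.
- by move=> y my t; exact: assembled_meas_rel.
- by move=> y b m my t; exact: assembled_meas_dec.
set s := assembled _ _ _ _ _ _ _ _ _ _ _ _.
pose up v v' := rprob Pr (up_err bu du ru tu' (fun i : 'I_n => Z (u + i)%N None) G d1 d2 v v').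
pose down b v := rprob Pr (dn_err 0 beta dd td' g (fun b (i : 'I_n) => Z (dn + i)%N (Some (j b))) phi b v).
have mZ i a : measurable_fun setT (Z i a) by exact: (measurable_iid iid).
have one (m0 m1 : 'I_#|{: 'rV['F_q]_k}|) : rprob Pr (slot_err s n g j u dn (pairm m0 m1)) <=
    up (enum_val m0) (enum_val m1) + (down false (enum_val m0 + enum_val m1) +
     down true (enum_val m0 + enum_val m1)).
  have m1' := measurable_up_err bu du ru tu' (fun i : 'I_n => mZ (u + i)%N None) G d1 d2 (enum_val m0) (enum_val m1).
  have m2' b v := measurable_dn_err 0 beta dd td' g (fun b (i : 'I_n) => mZ (dn + i)%N (Some (j b))) phi b v.
  have sub := @assembled_err q k kap n g j u dn bu du ru tu' beta dd rd td' G d1 d2 phi g0 m0 m1.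
  apply: le_trans (rprob_le Pr _ _ sub) _.
  - apply: measurable_slot_err; first by move=> y my t; exact: assembled_meas_rel.
    by move=> y b m my t; exact: assembled_meas_dec.
  - by apply: measurableU => //; apply: measurableU; exact: m2'.
  apply: le_trans (rprobU Pr _ _) _ => //; first by apply: measurableU; exact: m2'.
  by rewrite lerD2l; apply: rprobU; exact: m2'.
rewrite /sl_size /=.
apply: le_trans (ler_sum _ (fun m0 _ => ler_sum _ (fun m1 _ => one m0 m1))) _.
rewrite (sum_enum_val (fun v => \sum_(m1 < #|{: 'rV['F_q]_k}|) (up v (enum_val m1) +
  (down false (v + enum_val m1) + down true (v + enum_val m1))))).
under eq_bigr do rewrite (sum_enum_val (fun v' => up _ v' + (down false (_ + v') + down true (_ + v')))).
(* For a fixed message of one user the sum runs once through all indices, so the downlink average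
   over indices applies. *)
have sh (v : 'rV['F_q]_k) : \sum_v' (down false (v + v') + down true (v + v')) =
    \sum_v' (down false v' + down true v') by rewrite [RHS](reindex_inj (addrI v)).
under eq_bigr do rewrite big_split /= sh.
rewrite big_split /= sum_cst.
have hD' : \sum_v (down false v + down true v) <= #|{: 'rV['F_q]_k}|%:R * (e / 4) := hD.
have hU' : \sum_v \sum_v' up v v' <= #|{: 'rV['F_q]_k}|%:R ^+ 2 * (e / 4) by rewrite card_rV_Fp.
have := ler_wpM2l (ler0n R #|{: 'rV['F_q]_k}|) hD'.
have : 0 <= #|{: 'rV['F_q]_k}|%:R ^+ 2 * e by rewrite mulr_ge0 ?sqr_ge0// ltW.
move: (\sum_v \sum_v' up v v') hU' (\sum_v (down false v + down true v)) => A hA B.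
move: (#|{: 'rV['F_q]_k}|%:R : R) hA => C hA hC hB.
apply: le_trans (lerD hA hB) _.
have -> : C ^+ 2 * (e / 4) + C * (C * (e / 4)) = (C ^+ 2 * e) / 2 by field.
by rewrite ler_pdivrMr// ler_peMr// ler1n.
Qed.
End slot.

(** * Scheduling slots *)

Section windows.
Variable R : realType.

Lemma sqr_sum_disjoint (I : finType) (f : I -> R) :
  (forall i j, i != j -> f i * f j = 0) -> (\sum_i f i) ^+ 2 = \sum_i f i ^+ 2.
Proof.
move=> h; rewrite expr2 big_distrlr /=; apply: eq_bigr => i _.
by rewrite (bigD1 i)//= big1 ?addr0 ?expr2// => j ji; rewrite h// eq_sym.
Qed.

Definition win (u l i : nat) : bool := (u <= i < u + l)%N.

Lemma sum_window (f : nat -> R) (n u l : nat) : (u + l <= n)%N ->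
  \sum_(i < n) (if win u l i then f (i - u)%N else 0) = \sum_(i < l) f i.
Proof.
move=> uln; rewrite -(big_mkord xpredT (fun i => if win u l i then f (i - u)%N else 0)).
rewrite (big_cat_nat _ (n := u))//=; last by apply: leq_trans uln; exact: leq_addr.
rewrite big_nat_cond big1 ?add0r; last first.
  by move=> i /andP[/andP[_ iu] _]; rewrite /win leqNgt iu.
rewrite (big_cat_nat _ (n := (u + l)%N))//= ?leq_addr//.
rewrite [X in _ + X]big_nat_cond [X in _ + X]big1 ?addr0; last first.
  by move=> i /andP[/andP[iu _] _]; rewrite /win ltnNge iu andbF.
rewrite -[X in \sum_(X <= _ < _) _](add0n u) [(u + l)%N]addnC big_addn addnK big_mkord.
apply: eq_bigr => i _; rewrite addnK /win leq_addl/= addnC ltn_add2l ltn_ord//.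
Qed.

Lemma card_dffun_prod (I : finType) (T_ : I -> finType) :
  #|{dffun forall i, T_ i}| = (\prod_i #|T_ i|)%N.
Proof. by rewrite card_dep_ffun foldrE big_image. Qed.

Lemma natr_prod_expR (I : finType) (L : I -> nat) (x : I -> R) :
  (forall i, expR (x i) <= (L i)%:R) -> expR (\sum_i x i) <= (\prod_i L i)%N%:R.
Proof.
move=> h; rewrite expR_sum natr_prod; apply: ler_prod => i _.
by rewrite expR_ge0 h.
Qed.

End windows.

Lemma sum_coord2_ord (R : realType) (I : finType) (M : I -> nat) (i j : I) (F : nat -> nat -> R) :
  i != j ->
  (M i)%:R * ((M j)%:R * \sum_(f : {dffun forall i, 'I_(M i)}) F (f i) (f j)) =
  #|{: {dffun forall i, 'I_(M i)}}|%:R * \sum_(k < M i) \sum_(l < M j) F k l.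
Proof.
move=> ij; have := sum_coord2 (T_ := fun i => 'I_(M i)) (fun k l => F (val k) (val l)) ij.
by rewrite (card_ord (M i)) (card_ord (M j)).
Qed.

(** Cancels the sizes when an average over all message tuples ([D]) is reduced to two messages
    ([N0], [N1]) and then to their digits in one slot ([l]). *)
Lemma avg_bound (R : realType) (S1 S2 S3 N0 N1 l D e : R) : 0 < N0 -> 0 < N1 -> 0 < l -> 0 <= D ->
  N0 * (N1 * S1) = D * S2 -> l * (l * S2) = N0 * (N1 * S3) -> S3 <= l ^+ 2 * e -> S1 <= D * e.
Proof.
move=> N0p N1p lp Dp E outer bound.
have {}bound : l * (l * S2) <= N0 * (N1 * (l ^+ 2 * e)) by rewrite outer !ler_pM2l.
have {}bound : S2 <= N0 * (N1 * e).
  rewrite -(ler_pM2l lp) -(ler_pM2l lp); apply: le_trans bound _.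
  by rewrite le_eqVlt; apply/orP; left; apply/eqP; ring.
rewrite -(ler_pM2l N1p) -(ler_pM2l N0p) E.
apply: le_trans (ler_wpM2l Dp bound) _.
by rewrite le_eqVlt; apply/orP; left; apply/eqP; ring.
Qed.

Section schedule.
Context d (Omega : measurableType d) (R : realType) (Pr : probability Omega R).
Context (Z : nat -> option 'I_3 -> Omega -> R).
Hypothesis iid : iid_std_normal Pr Z.
Variables (h1 h2 h3 P : R) (J : finType) (s : J -> slotcode R) (len u dn : J -> nat).
Variables (a : J -> bool -> 'I_3) (r e : J -> R) (p : J -> bool -> R) (n : nat).
Notation g := (gain h1 h2 h3).
Hypothesis a_neq : forall x b, a x b != a x (~~ b).
Hypothesis u_dn : forall x, (u x + len x <= dn x)%N.
Hypothesis dn_n : forall x, (dn x + len x <= n)%N.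
Hypothesis u_disj : forall x y i, win (u x) (len x) i -> win (u y) (len y) i -> x = y.
Hypothesis dn_disj : forall x y i, win (dn x) (len x) i -> win (dn y) (len y) i -> x = y.
Hypothesis ok : forall x, slot_ok Pr Z (s x) (len x) (fun b => g (a x b)) (a x) (u x) (dn x)
  (r x) (e x) P (p x).

Definition upair (x : J) (b : bool) : pair3 :=
  exist _ (a x b, a x (~~ b)) (a_neq x b).

Definition carries (q : pair3) (x : J) : bool := (q == upair x false) || (q == upair x true).

(** A message is a tuple with one digit per slot. Slots serving other pairs get a one-valued digit,
    so that the number of messages is a product over all slots. *)
Definition sizes (q : pair3) (x : J) : nat := if carries q x then sl_size (s x) else 1.
Notation msgT q := {dffun forall x : J, 'I_(sizes q x)}.
Definition nmsg (q : pair3) : nat := #|{: msgT q}|.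

Definition comp (q : pair3) (m : nat) (x : J) : nat :=
  if insub m is Some i then val ((enum_val (i : 'I_(nmsg q)) : msgT q) x) else 0%N.

Definition jobmsg (ow : 'I_3 -> nat) (x : J) (b : bool) : nat :=
  comp (upair x b) (ow (a x (~~ b))) x.

Definition side (j : 'I_3) (x : J) : bool := a x true == j.

Definition estimate (j : 'I_3) (y : nat -> R) (ow : 'I_3 -> nat) (x : J) : nat :=
  sl_dec (s x) (side j x) (trunc_sig (len x) (fun i => y (dn x + i)%N)) (jobmsg ow x (side j x)).

Definition match_est (q : pair3) (f : J -> nat) (m : 'I_(nmsg q)) : bool :=
  [forall x, carries q x ==> (comp q m x == f x)].

Definition pick_msg (q : pair3) (f : J -> nat) : nat :=
  if [pick m | @match_est q f m] is Some m then val m else 0%N.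

Definition sched_code : Defs.code R := {|
  enc := fun j t ow _ => \sum_x \sum_b
    if (a x b == j) && win (u x) (len x) t then sl_up (s x) b (jobmsg ow x b) (t - u x) else 0;
  relay := fun t y => \sum_x if win (dn x) (len x) t then
    sl_down (s x) (sl_rel (s x) (trunc_sig (len x) (fun i => y (u x + i)%N))) (t - dn x) else 0;
  dec := fun j y ow k =>
    if @insub _ (fun q : 'I_3 * 'I_3 => q.1 != q.2) pair3 (k, j) is Some q
    then pick_msg q (estimate j y ow) else 0%N |}.

Hypothesis pow : forall j, \sum_x \sum_b (if a x b == j then (len x)%:R * p x b else 0) <= n%:R * P.
Hypothesis sum_len : (\sum_x len x <= n)%N.
Hypothesis P_ge0 : 0 <= P.

Section fixed_messages.
Variable m : msgs nmsg.
Notation noise w := (noise Z w).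

Definition mJ (x : J) (b : bool) : nat := comp (upair x b) (val (m (upair x b))) x.

Lemma jobmsg_own x b : jobmsg (own m (a x b)) x b = mJ x b.
Proof.
rewrite /jobmsg /mJ /own; case: insubP => [q _ eq|]; last by rewrite a_neq.
by have -> : q = upair x b by apply: val_inj.
Qed.

Lemma past_lt z k t : (t < k)%N ->
  past h1 h2 h3 sched_code m z k t = recv_from h1 h2 h3 sched_code m z (past h1 h2 h3 sched_code m z t) t.
Proof.
elim: k => // k IH; rewrite ltnS leq_eqVlt => /orP[/eqP->|tk] /=.
  by rewrite ltnn eqxx.
by rewrite tk IH.
Qed.

Lemma xmit_user z i j : xmit h1 h2 h3 sched_code m z i (Some j) =
  \sum_x \sum_b if (a x b == j) && win (u x) (len x) i then sl_up (s x) b (mJ x b) (i - u x) else 0.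
Proof.
apply: eq_bigr => x _; apply: eq_bigr => b _.
by case: eqP => //= <-; rewrite jobmsg_own.
Qed.

Lemma recv_relay z x i : (i < len x)%N ->
  recv_from h1 h2 h3 sched_code m z (past h1 h2 h3 sched_code m z (u x + i)) (u x + i) None =
  g (a x false) * sl_up (s x) false (mJ x false) i + g (a x true) * sl_up (s x) true (mJ x true) i
    + z (u x + i)%N None.
Proof.
move=> il /=; congr (_ + _).
have wx : win (u x) (len x) (u x + i) by rewrite /win leq_addr ltn_add2l.
under eq_bigr => j _.
  rewrite (_ : \sum_x0 _ = \sum_b if a x b == j then sl_up (s x) b (mJ x b) i else 0); last first.
    rewrite (bigD1 x)//= [X in _ + X]big1 ?addr0.
      apply: eq_bigr => b _; rewrite wx andbT addKn.
      by case: eqP => //= <-; rewrite jobmsg_own.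
    move=> y yx; rewrite big1// => b _; rewrite [win _ _ _](_ : _ = false) ?andbF//.
    by apply/negP => /(u_disj wx) xy; rewrite xy eqxx in yx.
  over.
under eq_bigr do rewrite mulr_sumr.
rewrite exchange_big big_bool [LHS]addrC.
have one b : \sum_j g j * (if a x b == j then sl_up (s x) b (mJ x b) i else 0) =
    g (a x b) * sl_up (s x) b (mJ x b) i.
  rewrite (bigD1 (a x b))//= eqxx big1 ?addr0// => j ja.
  by rewrite eq_sym (negbTE ja) mulr0.
by congr (_ + _); [exact: (one false)|exact: (one true)].
Qed.

(** Causality: the uplink window of a slot ends before its broadcast starts, so the relay already
    holds every sample it decodes from. *)
Lemma xmit_relay w i : xmit h1 h2 h3 sched_code m (noise w) i None =
  \sum_x if win (dn x) (len x) i then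
    sl_down (s x) (slot_relay Z (s x) (len x) (fun b => g (a x b)) (u x) (mJ x) w) (i - dn x) else 0.
Proof.
apply: eq_bigr => x _; case: ifP => // /andP[di _].
congr (sl_down _ (sl_rel _ _) _); apply/funext => k; rewrite /trunc_sig; case: ifP => // kl.
rewrite past_lt; first by rewrite recv_relay.
by apply: leq_trans di; apply: leq_trans (u_dn x); rewrite ltn_add2l.
Qed.

Lemma recv_user w x b i : (i < len x)%N ->
  past h1 h2 h3 sched_code m (noise w) n (dn x + i) (Some (a x b)) =
  g (a x b) * sl_down (s x) (slot_relay Z (s x) (len x) (fun b => g (a x b)) (u x) (mJ x) w) i
    + Z (dn x + i)%N (Some (a x b)) w.
Proof.
move=> il; have wx : win (dn x) (len x) (dn x + i) by rewrite /win leq_addr ltn_add2l.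
rewrite past_lt; last by apply: leq_trans (dn_n x); rewrite ltn_add2l.
rewrite [LHS](_ : _ = g (a x b) * xmit h1 h2 h3 sched_code m (noise w) (dn x + i) None +
  Z (dn x + i)%N (Some (a x b)) w)// xmit_relay.
rewrite (bigD1 x)//= wx addKn big1 ?addr0// => y yx.
rewrite [win _ _ _](_ : _ = false)//.
by apply/negP => /(dn_disj wx) xy; rewrite xy eqxx in yx.
Qed.

Lemma sideE x b : side (a x b) x = b.
Proof. by case: b; rewrite /side ?eqxx// (negbTE (a_neq x true)). Qed.

Lemma estimateE w x b :
  estimate (a x b) (fun i => past h1 h2 h3 sched_code m (noise w) n i (Some (a x b)))
    (own m (a x b)) x =
  slot_dec Z (s x) (len x) (fun b => g (a x b)) (a x) (u x) (dn x) (mJ x) b w.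
Proof.
rewrite /estimate sideE jobmsg_own /slot_dec; congr (sl_dec _ _ _ _).
apply/funext => i; rewrite /trunc_sig; case: ifP => // il.
by rewrite recv_user.
Qed.

Lemma compE q (k : 'I_(nmsg q)) x : comp q k x = (enum_val k : msgT q) x.
Proof. by rewrite /comp valK. Qed.

Lemma comp_inj q (k l : 'I_(nmsg q)) :
  (forall x, carries q x -> comp q k x = comp q l x) -> k = l.
Proof.
move=> h; apply: enum_val_inj; apply/ffunP => x; apply: val_inj => /=.
have [/h|nc] := boolP (carries q x); first by rewrite !compE.
have z (i : 'I_(sizes q x)) : val i = 0%N.
  by case: i => i /=; rewrite /sizes (negbTE nc) ltnS leqn0 => /eqP.
by rewrite !z.
Qed.

Lemma pick_msgE q f (k : 'I_(nmsg q)) :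
  (forall x, carries q x -> comp q k x = f x) -> pick_msg q f = k.
Proof.
move=> h; rewrite /pick_msg; case: pickP => [l /forallP hl|]; last first.
  by move=> /(_ k) /forallP[]; move=> x; apply/implyP => /h ->.
congr val; apply: comp_inj => x cx; rewrite h//.
by have := hl x; rewrite cx => /eqP.
Qed.

Notation y w j := (fun i => past h1 h2 h3 sched_code m (noise w) n i (Some j)).
Notation est w q := (estimate (val q).2 (y w (val q).2) (own m (val q).2)).
Notation serr x := (slot_err Z (s x) (len x) (fun b => g (a x b)) (a x) (u x) (dn x) (mJ x)).

Lemma dec_errorE w : dec_error h1 h2 h3 sched_code m (noise w) n =
  exists q : pair3, pick_msg q (est w q) != val (m q).
Proof.
rewrite /dec_error; congr (exists q, is_true (_ != _)); apply/funext => q /=.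
have -> : ((val q).1, (val q).2) = val q by case: (val q).
by rewrite valK.
Qed.

Notation sdec x b w :=
  (slot_dec Z (s x) (len x) (fun b' => g (a x b')) (a x) (u x) (dn x) (mJ x) b w).

Lemma est_upair w x b : est w (upair x b) x = sdec x (~~ b) w.
Proof. exact: (estimateE w x (~~ b)). Qed.

Lemma carriesP q x : carries q x -> exists b, q = upair x b.
Proof. by case/orP => /eqP ->; [exists false|exists true]. Qed.

Lemma dec_error_sub w : dec_error h1 h2 h3 sched_code m (noise w) n -> exists x, serr x w.
Proof.
rewrite dec_errorE => -[q]; apply: contraPP => h; apply/negP/negPn/eqP; apply: pick_msgE => x cx.
have [b e1] := carriesP cx; rewrite e1 est_upair; symmetry.
have nx : ~ serr x w by move=> hx; apply: h; exists x.
suff -> : sdec x (~~ b) w = mJ x (~~ ~~ b) by rewrite negbK /mJ.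
by apply/eqP/negPn/negP => hb; apply: nx; exists (~~ b).
Qed.

Lemma measurable_serr x : measurable (serr x).
Proof.
by apply: (measurable_slot_err iid); [exact: (sl_rel_meas (ok x))|exact: (sl_dec_meas (ok x))].
Qed.

Lemma measurable_match_est q (k : 'I_(nmsg q)) : measurable [set w | match_est (est w q) k].
Proof.
rewrite (_ : [set w | _] =
    \bigcap_(x in [set: J]) [set w | carries q x ==> (comp q k x == est w q x)]); last first.
  apply/seteqP; split => w h; first by move=> x _; exact: (forallP h x).
  by apply/forallP => x; exact: h.
apply: fin_bigcap_measurable => [|x _]; first exact: finite_finset.
have [cx|nc] := boolP (carries q x); last first.
  rewrite (_ : [set w | _] = setT); first exact: measurableT.
  by apply/seteqP; split.
have [b e1] := carriesP cx; rewrite (_ : [set w | _] = [set w | sdec x (~~ b) w = comp q k x]).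
  by apply: (measurable_slot_dec iid); [exact: (sl_rel_meas (ok x))|exact: (sl_dec_meas (ok x))].
have E w : est w q x = sdec x (~~ b) w by rewrite e1 est_upair.
by apply/seteqP; split => w; rewrite /mkset E implyTb; [move/eqP|move=> ->].
Qed.

Lemma measurable_dec_error : measurable [set w | dec_error h1 h2 h3 sched_code m (noise w) n].
Proof.
rewrite (_ : [set w | _] = [set w | exists q : pair3, pick_msg q (est w q) != val (m q)]); last first.
  by apply/seteqP; split => w; rewrite /mkset dec_errorE.
apply: measurable_exists_fin => q.
have := measurable_finfun (fun t : {ffun 'I_(nmsg q) -> bool} =>
  (if [pick k | t k] is Some k then val k else 0%N) != val (m q)) (@measurable_match_est q).
congr measurable; apply/seteqP; split => w; rewrite /mkset /pick_msg;
  by rewrite (eq_pick (fun k => ffunE _ k)).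
Qed.

Lemma user_power z j : \sum_(i < n) xmit h1 h2 h3 sched_code m z i (Some j) ^+ 2 <= n%:R * P.
Proof.
apply: le_trans (pow j); rewrite pair_bigA.
under [leLHS]eq_bigr => i _.
  rewrite xmit_user pair_bigA sqr_sum_disjoint; last first.
  move=> [x b] [y b'] /= ne; case: ifP => [/andP[/eqP ab wx]|]; last by rewrite mul0r.
  case: ifP => [/andP[/eqP ab' wy]|]; last by rewrite mulr0.
  have xy := u_disj wx wy; subst y.
  suff bb : b = b' by rewrite bb eqxx in ne.
  case: (eqVneq b b') => // nb; have := a_neq x b.
  have -> : ~~ b = b' by case: (b) (b') nb => -[].
  by rewrite ab ab' eqxx.
  over.
rewrite exchange_big/=; apply: ler_sum => -[x b] _ /=.
case: eqP => _ /=; last by rewrite big1// => i _; rewrite expr0n.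
have := sl_up_power (ok x) b (mJ x b); apply: le_trans.
rewrite -(@sum_window R (fun i => sl_up (s x) b (mJ x b) i ^+ 2) n (u x)); last first.
  by apply: leq_trans (u_dn x) _; apply: leq_trans (dn_n x); exact: leq_addr.
by apply: ler_sum => i _; case: ifP; rewrite // expr0n.
Qed.

Lemma relay_power w : \sum_(i < n) xmit h1 h2 h3 sched_code m (noise w) i None ^+ 2 <= n%:R * P.
Proof.
under [leLHS]eq_bigr => i _.
  rewrite xmit_relay sqr_sum_disjoint; last first.
  move=> x y ne; case: ifP => [wx|]; last by rewrite mul0r.
  case: ifP => [wy|]; last by rewrite mulr0.
  by move: ne; rewrite (dn_disj wx wy) eqxx.
  over.
rewrite exchange_big/=; apply: (@le_trans _ _ (\sum_x (len x)%:R * P)).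
  apply: ler_sum => x _; set t := slot_relay _ _ _ _ _ _ _.
  have := sl_down_power (ok x) t; apply: le_trans.
  rewrite -(@sum_window R (fun i => sl_down (s x) t i ^+ 2) n (dn x)) ?dn_n//.
  by apply: ler_sum => i _; case: ifP; rewrite // expr0n.
by rewrite -mulr_suml -natr_sum ler_wpM2r// ler_nat.
Qed.

Lemma xmit_power w v :
  \sum_(i < n) xmit h1 h2 h3 sched_code m (noise w) i v ^+ 2 <= n%:R * P.
Proof. by case: v => [j|]; [exact: user_power|exact: relay_power]. Qed.

Lemma measurable_xmit i v :
  measurable_fun setT (fun w => xmit h1 h2 h3 sched_code m (noise w) i v).
Proof.
case: v => [j|].
  under eq_fun do rewrite xmit_user.
  exact: measurable_cst.
under eq_fun do rewrite xmit_relay.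
apply: (@measurable_sum _ _ _ setT J (index_enum J) (fun x w => if win (dn x) (len x) i then
  sl_down (s x) (slot_relay Z (s x) (len x) (fun b => g (a x b)) (u x) (mJ x) w) (i - dn x) else 0))
  => x.
case: (win (dn x) (len x) i); last exact: measurable_cst.
apply: (measurable_nat_comp (sl_down (s x) ^~ (i - dn x)%N)) => t.
by apply: (measurable_slot_relay iid); exact: (sl_rel_meas (ok x)).
Qed.

Lemma xmit_energy v :
  (\sum_(i < n) \int[Pr]_w ((xmit h1 h2 h3 sched_code m (noise w) i v) ^+ 2)%:E <= (n%:R * P)%:E)%E.
Proof.
rewrite -ge0_integral_sum//; last 2 first.
- move=> i; apply/measurable_EFinP; apply: measurable_funX; exact: measurable_xmit.
- by move=> i w _; rewrite lee_fin sqr_ge0.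
have -> : (n%:R * P)%:E = (\int[Pr]_w (n%:R * P)%:E)%E.
  have P1 : Pr setT = 1%E by exact: probability_setT.
  by rewrite integral_cst// [X in (_ * X)%E]P1 mule1.
apply: ge0_le_integral => //.
- by move=> w _; apply: sume_ge0 => i _; rewrite lee_fin sqr_ge0.
- apply: emeasurable_sum => i; apply/measurable_EFinP; apply: measurable_funX; exact: measurable_xmit.
by move=> w _; have := xmit_power w v; rewrite -lee_fin -sumEFin.
Qed.

End fixed_messages.

Lemma nmsg_gt0 q : (0 < nmsg q)%N.
Proof.
rewrite /nmsg card_dffun_prod prodn_gt0// => x; rewrite card_ord /sizes.
by case: ifP => // _; exact: (sl_size_gt0 (ok x)).
Qed.

Lemma nmsg_rate q : expR (\sum_(x | carries q x) r x * (len x)%:R) <= (nmsg q)%:R.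
Proof.
rewrite big_mkcond /nmsg card_dffun_prod; apply: natr_prod_expR => x.
rewrite card_ord /sizes; case: ifP => _; last by rewrite expR0.
exact: (sl_rate (ok x)).
Qed.

Lemma card_msgs : #|{: msgs nmsg}| = (\prod_q nmsg q)%N.
Proof. by rewrite card_dffun_prod; apply: eq_bigr => q _; rewrite card_ord. Qed.

Lemma card_msgs_gt0 : (0 < #|{: msgs nmsg}|)%N.
Proof. by rewrite card_msgs prodn_gt0// => q; exact: nmsg_gt0. Qed.

Lemma sched_measurable : code_measurable Z h1 h2 h3 n nmsg sched_code.
Proof. by move=> m; split=> [i v _|]; [exact: measurable_xmit|exact: measurable_dec_error]. Qed.

Lemma sched_power : code_power Pr Z h1 h2 h3 P n nmsg sched_code.
Proof.
move=> v; rewrite exchange_big.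
apply: (@le_trans _ _ (\sum_(m : msgs nmsg) (n%:R * P)%:E)%E).
  by apply: lee_sum => m _; exact: xmit_energy.
rewrite sumEFin lee_fin sumr_const -[leLHS]mulr_natr; exact: lexx.
Qed.

Notation slot_err_at x mm :=
  (slot_err Z (s x) (len x) (fun b => g (a x b)) (a x) (u x) (dn x) mm).

Lemma comp_avg q x (F : nat -> R) : carries q x ->
  (sl_size (s x))%:R * (\sum_(k < nmsg q) F (comp q k x)) =
  (nmsg q)%:R * \sum_(k < sl_size (s x)) F k.
Proof.
move=> cx; have E : sizes q x = sl_size (s x) by rewrite /sizes cx.
rewrite (eq_bigr (fun k : 'I_(nmsg q) => F ((enum_val k : msgT q) x))); last first.
  by move=> k _; rewrite compE.
rewrite (sum_enum_val (fun f : msgT q => F (f x))).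
have := sum_coord1 (T_ := fun x : J => 'I_(sizes q x)) (i := x) (fun k => F (val k)).
by rewrite -E card_ord => ->.
Qed.

Lemma upair_neq x : upair x false != upair x true.
Proof. by apply/eqP => /(congr1 (fun q : pair3 => (val q).1)) /= h; have := a_neq x false; rewrite /= h eqxx. Qed.

Lemma carries_upair x b : carries (upair x b) x.
Proof. by case: b; rewrite /carries eqxx ?orbT. Qed.

(** Only two digits matter, one from each message of the pair. Coordinates of a uniform tuple are
    independent and uniform, so the average over all messages is the average of the slot itself. *)
Lemma sched_slot_err x :
  \sum_(m : msgs nmsg) rprob Pr (slot_err_at x (mJ m x)) <= #|{: msgs nmsg}|%:R * e x.
Proof.
set L := sl_size (s x); set q0 := upair x false; set q1 := upair x true.
pose G (k0 k1 : nat) := rprob Pr (slot_err_at x (pairm k0 k1)).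
have L0 : 0 < L%:R :> R by rewrite ltr0n (sl_size_gt0 (ok x)).
have n0 q : 0 < (nmsg q)%:R :> R by rewrite ltr0n nmsg_gt0.
have E := sum_coord2_ord nmsg
  (fun k0 k1 => G (comp q0 k0 x) (comp q1 k1 x)) (upair_neq x).
have inner k0 : L%:R * (\sum_(k1 < nmsg q1) G k0 (comp q1 k1 x)) =
    (nmsg q1)%:R * \sum_(k1 < L) G k0 k1.
  exact: (comp_avg (G k0) (carries_upair x true)).
have outer : L%:R * (L%:R * \sum_(k0 < nmsg q0) \sum_(k1 < nmsg q1) G (comp q0 k0 x) (comp q1 k1 x)) =
    (nmsg q0)%:R * ((nmsg q1)%:R * \sum_(k0 < L) \sum_(k1 < L) G k0 k1).
  rewrite [X in _ * X](_ : _ = (nmsg q1)%:R * \sum_(k0 < nmsg q0) \sum_(k1 < L) G (comp q0 k0 x) k1).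
    rewrite [LHS]mulrCA (comp_avg (fun k0 => \sum_(k1 < L) G k0 k1) (carries_upair x false)).
    exact: mulrCA.
  by rewrite !mulr_sumr; apply: eq_bigr => k0 _; exact: inner.
rewrite (eq_bigr (fun m : msgs nmsg => G (comp q0 (val (m q0)) x) (comp q1 (val (m q1)) x))); last first.
  move=> m _; congr (rprob Pr (slot_err_at x _)).
  by apply/funext => -[].
have bound : \sum_(k0 < L) \sum_(k1 < L) G k0 k1 <= L%:R ^+ 2 * e x by exact: (sl_err (ok x)).
exact: (avg_bound (n0 q0) (n0 q1) L0 (ler0n _ _) E outer bound).
Qed.

Lemma sched_err_prob : err_prob Pr Z h1 h2 h3 n nmsg sched_code <= \sum_x e x.
Proof.
have D0 : 0 < #|{: msgs nmsg}|%:R :> R by rewrite ltr0n card_msgs_gt0.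
rewrite /err_prob ler_pdivrMr// mulrC mulr_sumr.
apply: (@le_trans _ _ (\sum_x \sum_(m : msgs nmsg) rprob Pr (slot_err_at x (mJ m x)))); last first.
  by apply: ler_sum => x _; exact: sched_slot_err.
rewrite exchange_big; apply: ler_sum => m _.
apply: (le_trans _ (rprob_exists_le _ _)); last by move=> x; exact: measurable_serr.
apply: rprob_le; first exact: measurable_dec_error.
  by apply: measurable_exists_fin => x; exact: measurable_serr.
by move=> w; exact: dec_error_sub.
Qed.

End schedule.

(** * Rounds *)

Lemma eventually_fin (K : finType) (Q : K -> nat -> Prop) :
  (forall k, exists n0, forall n, (n0 <= n)%N -> Q k n) ->
  exists n0, forall n, (n0 <= n)%N -> forall k, Q k n.
Proof.
move=> /choice[f hf]; exists (\max_k f k)%N => n fn k; apply: hf.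
by apply: leq_trans fn; exact: leq_bigmax.
Qed.

(** Rounding down the block length and then the slot length loses at most the constant [B * t + B]
    over all rounds, while the slack between [c] and [B / B.+1] grows linearly in [n]. *)
Lemma truncn_rounds (R : realType) (B : nat) (t c : R) : 0 <= t -> c < B%:R / B.+1%:R ->
  exists n0, forall n, (n0 <= n)%N -> c * t * n%:R <= B%:R * (Num.truncn (t * (n %/ B.+1)%:R))%:R.
Proof.
move=> t0 cB; have [->|tn0] := eqVneq t 0.
  by exists 0%N => n _; rewrite mulr0 mul0r mulr_ge0.
have tp : 0 < t by rewrite lt_neqAle eq_sym tn0.
set D := B%:R / B.+1%:R - c; have Dp : 0 < D by rewrite subr_gt0.
have [n0 h0] := natr_upper ((B%:R * t + B%:R) / (D * t)).
exists n0 => n nn; have B1 : 0 < B.+1%:R :> R by rewrite ltr0n.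
have hn : B%:R * t + B%:R <= D * t * n%:R.
  rewrite [leRHS]mulrC -ler_pdivrMr ?mulr_gt0//; exact: h0.
set N := (n %/ B.+1)%N.
have hN : n%:R / B.+1%:R <= N%:R + 1 :> R.
  rewrite ler_pdivrMr// -[X in _ + X]/(1%:R) -natrD -natrM ler_nat addn1.
  by apply: ltnW; exact: ltn_ceil.
have hT : t * N%:R <= (Num.truncn (t * N%:R))%:R + 1.
  have /andP[_ /ltW] := truncn_itv (mulr_ge0 (ltW tp) (ler0n R N)).
  by rewrite -natr1.
clear h0 nn; set T := (Num.truncn _)%:R in hT *; set BR := B%:R in D Dp hn *.
have BR0 : 0 <= BR by rewrite /BR.
have h1 : BR * (t * N%:R) <= BR * (T + 1) by rewrite ler_wpM2l.
have h2 : BR * t * (n%:R / B.+1%:R) <= BR * t * (N%:R + 1).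
  by rewrite ler_wpM2l// mulr_ge0// ltW.
have h3 : BR * t * (n%:R / B.+1%:R) = (D + c) * t * n%:R.
  by rewrite /D subrK; ring.
have {}h1 : BR * (t * N%:R) <= BR * T + BR by rewrite -[X in _ + X]mulr1 -mulrDr.
have {}h2 : D * t * n%:R + c * t * n%:R <= BR * (t * N%:R) + BR * t.
  by move: h2; rewrite h3 !mulrDl mulrDr mulr1 !mulrA.
by move: h1 h2 hn; move: (BR * t) (BR * T) (BR * (t * N%:R)) (D * t * n%:R) (c * t * n%:R) => *; lra.
Qed.

Section rounds.
Context d (Omega : measurableType d) (R : realType) (Pr : probability Omega R).
Context (Z : nat -> option 'I_3 -> Omega -> R).
Hypothesis iid : iid_std_normal Pr Z.
Variables (h1 h2 h3 P : R) (K : nat) (a : 'I_K -> bool -> 'I_3) (t r S : 'I_K -> R).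
Variable (p : 'I_K -> bool -> R).
Notation g := (gain h1 h2 h3).
Hypothesis P_gt0 : 0 < P.
Hypothesis a_neq : forall k b, a k b != a k (~~ b).
Hypothesis t_ge0 : forall k, 0 <= t k.
Hypothesis t_sum : \sum_k t k <= 1.
Hypothesis r_ge0 : forall k, 0 <= r k.
Hypothesis p_ge0 : forall k b, 0 <= p k b.
Hypothesis pow : forall j, \sum_k \sum_b (if a k b == j then t k * p k b else 0) <= P.
Hypothesis slot_rates : forall k, r k = 0 \/
  [/\ 0 < S k, forall b, S k <= g (a k b) ^+ 2 * p k b, expR (2 * r k) < 1 / 2 + S k
    & forall b, expR (2 * r k) < 1 + g (a k b) ^+ 2 * P].

Section one_length.
Variables (B n : nat).
Notation J := ('I_B * 'I_K)%type.
Let N := (n %/ B.+1)%N.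
Definition slot_len (k : 'I_K) : nat := Num.truncn (t k * (n %/ B.+1)%:R).
Definition slot_off (k : nat) : nat := (\sum_(l < K | (l < k)%N) slot_len l)%N.
Definition up_start (x : J) : nat := (x.1 * (n %/ B.+1) + slot_off x.2)%N.
(** The broadcast of a round occupies the next block, during which the users already send the next
    round: relay and users transmit simultaneously. *)
Definition dn_start (x : J) : nat := (up_start x + n %/ B.+1)%N.

Lemma slot_len_le k : (slot_len k)%:R <= t k * N%:R.
Proof. by have /andP[] := truncn_itv (mulr_ge0 (t_ge0 k) (ler0n R N)). Qed.

Lemma sum_slot_len : (\sum_k slot_len k <= N)%N.
Proof.
rewrite -(ler_nat R) natr_sum; apply: (@le_trans _ _ (\sum_k t k * N%:R)).
  by apply: ler_sum => k _; exact: slot_len_le.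
by rewrite -mulr_suml ler_piMl.
Qed.

Lemma slot_off_next (k : 'I_K) (i : nat) : (k < i)%N -> (slot_off k + slot_len k <= slot_off i)%N.
Proof.
move=> ki; rewrite /slot_off [leqRHS](bigD1 k)//= addnC leq_add2l.
rewrite [leqLHS]big_mkcond [leqRHS]big_mkcond; apply: leq_sum => l _.
case: ifP => // lk; rewrite (ltn_trans lk ki)/= ifT//.
by apply/eqP => lk'; rewrite lk' ltnn in lk.
Qed.

Lemma slot_off_len (k : 'I_K) : (slot_off k + slot_len k <= N)%N.
Proof.
apply: leq_trans sum_slot_len; apply: leq_trans (slot_off_next (ltn_ord k)) _.
by rewrite /slot_off [leqLHS](eq_bigl xpredT) // => l; rewrite ltn_ord.
Qed.

Lemma win_up_inj (x y : J) i :
  win (up_start x) (slot_len x.2) i -> win (up_start y) (slot_len y.2) i -> x = y.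
Proof.
case: x => b k; case: y => b' k'; rewrite /win /up_start /=.
move=> /andP[l1 u1] /andP[l2 u2].
have o1 := slot_off_len k; have o2 := slot_off_len k'.
have key (c c' : nat) o o' : (c * N + o <= i)%N -> (i < c' * N + o')%N -> (o' <= N)%N -> (c <= c')%N.
  move=> h h' h''; rewrite leqNgt; apply/negP => cc.
  have : (c'.+1 * N <= c * N)%N by rewrite leq_mul2r cc orbT.
  rewrite mulSn; lia.
have bb : b = b'.
  apply: val_inj; apply/eqP; rewrite eqn_leq.
  rewrite (key _ _ _ _ l1 _ o2) ?addnA// (key _ _ _ _ l2 _ o1) ?addnA//.
subst b'; congr pair.
case: (ltngtP k k') => [kk|kk|]; last exact: val_inj.
- by have := slot_off_next kk; move: l2 u1; lia.
- by have := slot_off_next kk; move: l1 u2; lia.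
Qed.

Lemma win_dn_inj (x y : J) i :
  win (dn_start x) (slot_len x.2) i -> win (dn_start y) (slot_len y.2) i -> x = y.
Proof.
rewrite /win /dn_start => wx wy.
have iN : (N <= i)%N by move: wx; rewrite -/N; lia.
by apply: (@win_up_inj x y (i - N)%N); rewrite /win; move: wx wy; rewrite -/N; lia.
Qed.

Lemma up_before_dn (x : J) : (up_start x + slot_len x.2 <= dn_start x)%N.
Proof.
rewrite /dn_start leq_add2l; apply: leq_trans (slot_off_len x.2); exact: leq_addl.
Qed.

Lemma dn_in_block (x : J) : (dn_start x + slot_len x.2 <= n)%N.
Proof.
apply: (@leq_trans (B.+1 * N)); last by rewrite mulnC leq_divM.
have := slot_off_len x.2; rewrite /dn_start /up_start -/N.
have : (x.1.+1 * N <= B * N)%N by rewrite leq_mul2r ltn_ord orbT.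
rewrite !mulSn; lia.
Qed.

Lemma rounds_le : (B * N <= n)%N.
Proof. apply: leq_trans (leq_divM n B.+1); rewrite mulnC leq_mul2l leqnSn orbT//. Qed.

Lemma rounds_sum_len : (\sum_(x : J) slot_len x.2 <= n)%N.
Proof.
rewrite -(pair_bigA _ (fun _ k => slot_len k))/= sum_nat_const card_ord.
by apply: leq_trans rounds_le; rewrite leq_mul2l sum_slot_len orbT.
Qed.

Lemma rounds_power j :
  \sum_(x : J) \sum_b (if a x.2 b == j then (slot_len x.2)%:R * p x.2 b else 0) <= n%:R * P.
Proof.
rewrite -(pair_bigA _ (fun _ k => \sum_b (if a k b == j then (slot_len k)%:R * p k b else 0)))/=.
rewrite sumr_const card_ord -[leLHS]mulr_natl.
apply: (@le_trans _ _ (B%:R * (N%:R * P))).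
  rewrite ler_wpM2l//; apply: le_trans (ler_wpM2l (ler0n R N) (pow j)).
  rewrite mulr_sumr; apply: ler_sum => k _; rewrite mulr_sumr; apply: ler_sum => b _.
  case: ifP => _; last by rewrite mulr0.
  by rewrite mulrA ler_wpM2r// mulrC slot_len_le.
by rewrite mulrA -natrM ler_wpM2r ?(ltW P_gt0)// ler_nat rounds_le.
Qed.

End one_length.

Lemma slots_exist (B : nat) (c e : R) : 0 < c -> c < B%:R / B.+1%:R -> 0 < e ->
  exists n0, forall n, (n0 <= n)%N -> forall k u dn,
    exists s, slot_ok Pr Z s (slot_len B n k) (fun b => g (a k b)) (a k) u dn (r k) e P (p k).
Proof.
move=> c0 cB e0; apply: (@eventually_fin _ (fun k n => forall u dn, exists s,
  slot_ok Pr Z s (slot_len B n k) (fun b => g (a k b)) (a k) u dn (r k) e P (p k))) => k.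
have [rk|[S0 Sp r1 r2]] := slot_rates k.
  exists 0%N => n _ u dn; exists (trivial_slot R); apply: trivial_slot_ok => //; rewrite ?rk ?mul0r//.
  - exact: ltW.
  - exact: ltW.
(* A slot of length 0 asks for a single message, whatever the rate. For [t k > 0] the length
   eventually passes the threshold of [pair_code]. *)
have [tk|tk] := eqVneq (t k) 0.
  exists 0%N => n _ u dn; exists (trivial_slot R); apply: trivial_slot_ok => //.
  - by rewrite /slot_len tk mul0r truncn0 mulr0.
  - exact: ltW.
  - exact: ltW.
have tp : 0 < t k by rewrite lt_neqAle eq_sym tk t_ge0.
have [n1 h1'] := pair_code iid (g := fun b => g (a k b)) (a k) S0 Sp P_gt0 (r_ge0 k) r1 r2 e0.
have [n2 h2'] := truncn_rounds (t_ge0 k) cB.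
have [n3 h3'] := natr_upper (B%:R * n1%:R / (c * t k)).
have Bp : 0 < B%:R :> R.
  by rewrite lt_neqAle ler0n andbT; apply/eqP => B0; move: cB; rewrite -B0 mul0r ltNge (ltW c0).
exists (maxn n2 n3) => n; rewrite geq_max => /andP[nn2 nn3] u dn; apply: h1'.
rewrite -(ler_nat R) -(ler_pM2l Bp); apply: le_trans (h2' _ nn2).
by rewrite [leRHS]mulrC -ler_pdivrMr ?mulr_gt0// h3'.
Qed.

Lemma rounds_codes (B : nat) (c e : R) : 0 < c -> c < B%:R / B.+1%:R -> 0 < e ->
  exists n0, forall n, (n0 <= n)%N -> exists (M : pair3 -> nat) (C : Defs.code R),
    [/\ code_measurable Z h1 h2 h3 n M C, code_power Pr Z h1 h2 h3 P n M C,
      forall q, expR (c * n%:R * \sum_(k | carries a_neq q k) t k * r k) <= (M q)%:R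
      & err_prob Pr Z h1 h2 h3 n M C <= e].
Proof.
move=> c0 cB e0; set m := #|{: 'I_B * 'I_K}|.
(* The error is shared among the [m] slots; the successor avoids a division by 0. *)
have e1 : 0 < e / m.+1%:R by rewrite divr_gt0.
have [n1 hs] := slots_exist c0 cB e1.
have [n2 hl] : exists n0, forall n, (n0 <= n)%N ->
    forall k, c * t k * n%:R <= B%:R * (slot_len B n k)%:R.
  by apply: (@eventually_fin _ (fun k n => c * t k * n%:R <= B%:R * (slot_len B n k)%:R)) => k;
    exact: truncn_rounds.
exists (maxn n1 n2) => n; rewrite geq_max => /andP[nn1 nn2].
have [s ok] := choice (fun x : 'I_B * 'I_K => hs n nn1 x.2 (up_start n x) (dn_start n x)).
have a_neqJ (x : 'I_B * 'I_K) b : a x.2 b != a x.2 (~~ b) by exact: a_neq.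
exists (nmsg s a_neqJ).
exists (sched_code s (fun x => slot_len B n x.2) (up_start n) (dn_start n) a_neqJ).
have ud := @up_before_dn B n; have dn := @dn_in_block B n.
have wu := @win_up_inj B n; have wd := @win_dn_inj B n.
split.
- exact: (sched_measurable iid (a_neq := a_neqJ) ud dn wu wd ok).
- apply: (sched_power iid a_neqJ ud dn wu wd ok (@rounds_power B n) (rounds_sum_len B n)).
  exact: ltW.
- move=> q; apply: le_trans (nmsg_rate a_neqJ ok q); rewrite ler_expR.
  rewrite (eq_bigl (fun x : 'I_B * 'I_K => xpredT x.1 && carries a_neq q x.2))//.
  rewrite -(pair_big xpredT (carries a_neq q) (fun _ k => r k * (slot_len B n k)%:R))/=.
  rewrite sumr_const card_ord -[leRHS]mulr_natl !mulr_sumr; apply: ler_sum => k _.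
  rewrite [leLHS](_ : _ = r k * (c * t k * n%:R)); last by ring.
  by rewrite [leRHS]mulrCA ler_wpM2l// hl.
apply: le_trans (sched_err_prob iid a_neqJ ud dn wu wd ok) _.
rewrite sumr_const -[leLHS]mulr_natr -mulrA ler_piMr ?(ltW e0)//.
by rewrite mulrC ler_pdivrMr// mul1r ler_nat; exact: leqnSn.
Qed.

End rounds.

(** * Achievable rates *)

Section achievable_rates.
Context d (Omega : measurableType d) (R : realType) (Pr : probability Omega R).
Context (Z : nat -> option 'I_3 -> Omega -> R).
Variables (h1 h2 h3 P : R).
Notation g := (gain h1 h2 h3).
Hypothesis P_gt0 : 0 < P.

Definition silent_code : Defs.code R :=
  Code (fun _ _ _ _ => 0%R) (fun _ _ => 0%R) (fun _ _ _ _ => 0%N).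

Lemma silent_measurable n M : code_measurable Z h1 h2 h3 n M silent_code.
Proof.
move=> m; split=> [i [j|] _|]; try exact: measurable_cst.
rewrite (_ : [set w | _] = [set w : Omega | exists q, 0%N != val (m q)]) //.
have [h|h] := pselect (exists q, 0%N != val (m q)).
  rewrite (_ : [set w | _] = setT); first exact: measurableT.
  by apply/seteqP; split.
rewrite (_ : [set w | _] = set0); first exact: measurable0.
by apply/seteqP; split.
Qed.

Lemma silent_power n M : code_power Pr Z h1 h2 h3 P n M silent_code.
Proof.
move=> v; rewrite big1; last first.
  move=> i _; rewrite big1// => m _; apply: integral0_eq => w _.
  by case: v => [j|]; rewrite [xmit _ _ _ _ _ _ _ _](_ : _ = 0)// expr0n.
by rewrite lee_fin !mulr_ge0// ltW.
Qed.

Lemma err_prob_ge0 n M c : 0 <= err_prob Pr Z h1 h2 h3 n M c.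
Proof. by rewrite divr_ge0// sumr_ge0// => m _; rewrite fine_ge0. Qed.

(** Achievability wants one sequence of codes, valid at every length, whereas the premise gives for
    each [e] codes at large lengths only. Taking at each [n] a code within [1 / n.+1] of the infimal
    error diagonalises over [e]; the silent code makes the infimum range over a nonempty set. *)
Lemma achievable_of_codes (Rt : pair3 -> R) : (forall q, 0 <= Rt q) ->
  (forall e, 0 < e -> exists n0, forall n, (n0 <= n)%N -> exists M c,
    [/\ code_measurable Z h1 h2 h3 n M c, code_power Pr Z h1 h2 h3 P n M c,
        forall q, 2 `^ (n%:R * Rt q) <= (M q)%:R
      & err_prob Pr Z h1 h2 h3 n M c <= e]) ->
  achievable Pr Z h1 h2 h3 P Rt.
Proof.
move=> R0 H; split => //.
pose good n (Mc : (pair3 -> nat) * Defs.code R) :=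
  [/\ forall q, 2 `^ (n%:R * Rt q) <= (Mc.1 q)%:R,
      code_measurable Z h1 h2 h3 n Mc.1 Mc.2 & code_power Pr Z h1 h2 h3 P n Mc.1 Mc.2].
pose E n := [set err_prob Pr Z h1 h2 h3 n Mc.1 Mc.2 | Mc in good n].
have E_inf n : has_inf (E n).
  split; last by exists 0 => _ [Mc _ <-]; exact: err_prob_ge0.
  pose M q := (Num.truncn (2 `^ (n%:R * Rt q) : R)).+1.
  exists (err_prob Pr Z h1 h2 h3 n M silent_code), (M, silent_code) => //; split => /=.
  - by move=> q; exact/ltW/truncnS_gt.
  - exact: silent_measurable.
  - exact: silent_power.
have /choice[f hf] n : exists Mc, good n Mc /\
    err_prob Pr Z h1 h2 h3 n Mc.1 Mc.2 < inf (E n) + n.+1%:R^-1.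
  have [|_ [Mc gMc <-] lt] := inf_adherent (eps := n.+1%:R^-1) _ (E_inf n); first by rewrite invr_gt0.
  by exists Mc.
exists (fun n => (f n).1), (fun n => (f n).2); split.
- by move=> n; have [[]] := hf n.
- by move=> n; have [[]] := hf n.
- by move=> n; have [[]] := hf n.
apply/cvgrPdist_lt => e e0.
have [n0 h0] := H (e / 2) (divr_gt0 e0 (ltr0n _ 2)).
have [n1 h1'] := natr_upper (2 / e).
exists (maxn n0 n1) => // n /=; rewrite geq_max => /andP[nn0 nn1].
rewrite sub0r normrN ger0_norm ?err_prob_ge0//.
have [_ /lt_le_trans] := hf n; apply.
have [M [c [m1 m2 m3 m4]]] := h0 n nn0.
have i1 : inf (E n) <= e / 2.
  apply: le_trans m4; apply: ge_inf; first by have [] := E_inf n.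
  by exists (M, c).
have i2 : n.+1%:R^-1 <= e / 2.
  rewrite -[leRHS]invrK lef_pV2 ?posrE ?invr_gt0 ?divr_gt0// invf_div.
  by apply: h1'; exact: leqW.
by rewrite [leRHS]splitr lerD.
Qed.

End achievable_rates.

Lemma exists_rounds (R : realType) (c : R) : c < 1 -> exists B : nat, c < B%:R / B.+1%:R.
Proof.
move=> c1; have [B hB] := natr_upper (1 / (1 - c)).
exists B; have {}hB := hB _ (leqnn B).
have c1' : 0 < 1 - c by rewrite subr_gt0.
rewrite ltr_pdivlMr ?ltr0n// -natr1.
by move: hB; rewrite ler_pdivrMr// => hB; lra.
Qed.

(** * From slot allocations to the sum-capacity *)

Section slot_capacity.
Context d (Omega : measurableType d) (R : realType) (Pr : probability Omega R).
Context (Z : nat -> option 'I_3 -> Omega -> R).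
Hypothesis iid : iid_std_normal Pr Z.
Variables (h1 h2 h3 P : R) (K : nat) (a : 'I_K -> bool -> 'I_3) (t v S : 'I_K -> R).
Notation g := (gain h1 h2 h3).
Hypothesis P_gt0 : 0 < P.
Hypothesis a_neq : forall k b, a k b != a k (~~ b).
Hypothesis t_ge0 : forall k, 0 <= t k.
Hypothesis t_sum : \sum_k t k <= 1.
Hypothesis S_ge0 : forall k, 0 <= S k.
Hypothesis pow : forall j, \sum_k \sum_b (if a k b == j then t k * S k else 0) <= g j ^+ 2 * P.
Hypothesis v_up : forall k, v k <= Capp (S k - 2^-1).
Hypothesis v_dn : forall k b, v k <= Cap (g (a k b) ^+ 2 * P).

Lemma ln2_gt0 : 0 < ln 2 :> R.
Proof. by rewrite ln_gt0 ?ltr1n. Qed.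

Lemma expR_lt_of_Cap (x r : R) : 0 <= r -> r < Cap x -> expR (2 * (r * ln 2)) < 1 + x.
Proof.
move=> r0; rewrite /Cap ltr_pdivlMr ?mulr_gt0 ?ln2_gt0// => h.
have l0 : 0 < ln (1 + x).
  by apply: le_lt_trans h; rewrite !mulr_ge0 ?(ltW ln2_gt0).
have x0 : 0 < 1 + x by rewrite ltNge; apply/negP => /ln0 e; rewrite e ltxx in l0.
by rewrite -[ltRHS]lnK ?posrE// ltr_expR mulrCA.
Qed.

Let r (dl : R) k := Num.max 0 (v k - dl) * ln 2.
Let p k b := S k / g (a k b) ^+ 2.

Lemma slot_rates_delta dl : 0 < dl -> forall k, r dl k = 0 \/
  [/\ 0 < S k, forall b, S k <= g (a k b) ^+ 2 * p k b, expR (2 * r dl k) < 1 / 2 + S k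
    & forall b, expR (2 * r dl k) < 1 + g (a k b) ^+ 2 * P].
Proof.
move=> dl0 k; have [vd|vd] := leP (v k - dl) 0.
  by left; rewrite /r (max_idPl vd) mul0r.
right; rewrite /r (max_idPr (ltW vd)).
have vlt : v k - dl < v k by rewrite ltrBlDr ltrDl.
have hP b : expR (2 * ((v k - dl) * ln 2)) < 1 + g (a k b) ^+ 2 * P.
  by apply: expR_lt_of_Cap; [exact: ltW|exact: lt_le_trans vlt (v_dn k b)].
have gt1 : 1 < expR (2 * ((v k - dl) * ln 2)).
  by rewrite -[ltLHS]expR0 ltr_expR !mulr_gt0 ?ln2_gt0.
have hS : expR (2 * ((v k - dl) * ln 2)) < 1 / 2 + S k.
  rewrite (_ : 1 / 2 + S k = 1 + (S k - 2^-1)); last by field.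
  apply: expR_lt_of_Cap; first exact: ltW.
  (* A positive rate excludes the value 0 of the maximum in [Capp]. *)
  have := lt_le_trans vlt (v_up k); rewrite /Capp lt_max => /orP[|//].
  by rewrite ltNge (ltW vd).
split => //.
  by have := lt_trans gt1 hS; rewrite -ltrBlDl => /(lt_trans _); apply; lra.
move=> b; rewrite /p mulrC divfK//; apply/eqP => g0.
by have := lt_trans gt1 (hP b); rewrite g0 mul0r addr0 ltxx.
Qed.

Lemma slot_user_power j : \sum_k \sum_b (if a k b == j then t k * p k b else 0) <= P.
Proof.
rewrite (_ : \sum_k _ = (\sum_k \sum_b (if a k b == j then t k * S k else 0)) / g j ^+ 2).
  (* Division by a zero gain gives 0; the slots of such a user have rate 0 and need no power. *)
  have [->|g0] := eqVneq (g j ^+ 2) 0; first by rewrite invr0 mulr0 ltW.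
  have g2 : 0 < g j ^+ 2 by rewrite lt_neqAle eq_sym g0 sqr_ge0.
  by rewrite (ler_pdivrMr _ _ g2) [leRHS]mulrC; exact: pow.
rewrite mulr_suml; apply: eq_bigr => k _; rewrite mulr_suml; apply: eq_bigr => b _.
by case: eqP => [<-|_]; [exact: mulrA|rewrite mul0r].
Qed.

Lemma achievable_slots (dl c : R) : 0 < dl -> 0 < c -> c < 1 ->
  achievable Pr Z h1 h2 h3 P
    (fun q => c * \sum_(k | carries a_neq q k) t k * Num.max 0 (v k - dl)).
Proof.
move=> dl0 c0 c1; have [B cB] := exists_rounds c1.
have m0 k : 0 <= Num.max 0 (v k - dl) by rewrite le_max lexx.
apply: achievable_of_codes => // [q|e e0].
  by rewrite mulr_ge0 ?(ltW c0)// sumr_ge0// => k _; rewrite mulr_ge0.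
have r0 k : 0 <= r dl k by rewrite mulr_ge0// ltW// ln2_gt0.
have p0 k b : 0 <= p k b by rewrite divr_ge0// sqr_ge0.
have [n0 h0] := rounds_codes iid P_gt0 a_neq t_ge0 t_sum r0 p0 slot_user_power
  (slot_rates_delta dl0) c0 cB e0.
exists n0 => n nn; have [M [C [m1 m2 m3 m4]]] := h0 n nn; exists M, C; split => // q.
apply: le_trans (m3 q); rewrite /powR pnatr_eq0/= ler_expR.
rewrite le_eqVlt; apply/orP; left; apply/eqP.
rewrite [X in _ = _ * X](eq_bigr (fun k => (t k * Num.max 0 (v k - dl)) * ln 2)); last first.
  by move=> k _; rewrite /r mulrA.
by rewrite -mulr_suml; ring.
Qed.

Lemma sum_carries (f : 'I_K -> R) :
  \sum_q \sum_(k | carries a_neq q k) f k = 2 * \sum_k f k.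
Proof.
under eq_bigr do rewrite big_mkcond.
rewrite exchange_big mulr_sumr; apply: eq_bigr => k _ /=.
rewrite -big_mkcond (bigD1 (upair a_neq k false)) ?carries_upair//=.
rewrite (bigD1 (upair a_neq k true))/=; last by rewrite carries_upair eq_sym upair_neq.
rewrite big1 ?addr0; first by ring.
by move=> q /andP[/andP[/orP[|] /eqP ->]]; rewrite eqxx.
Qed.

Lemma capacity_ge_slots : ((2 * \sum_k t k * v k)%:E <= sum_capacity Pr Z h1 h2 h3 P)%E.
Proof.
set m := fun dl k => Num.max 0 (v k - dl).
have step dl c : 0 < dl -> 0 < c -> c < 1 ->
    ((c * (2 * \sum_k t k * m dl k))%:E <= sum_capacity Pr Z h1 h2 h3 P)%E.
  move=> dl0 c0 c1; apply: ereal_sup_ubound; eexists; first exact: (achievable_slots dl0 c0 c1).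
  by rewrite -mulr_sumr sum_carries.
apply/lee_subgt0Pr => e e0.
pose dl := e / 4; have dl0 : 0 < dl by rewrite divr_gt0.
pose T := 2 * \sum_k t k * m dl k.
have T0 : 0 <= T.
  by rewrite mulr_ge0// sumr_ge0// => k _; rewrite mulr_ge0// le_max lexx.
have vT : 2 * (\sum_k t k * v k) - e / 2 <= T.
  rewrite (_ : 2 * _ - e / 2 = 2 * (\sum_k t k * v k - dl)); last by rewrite /dl; field.
  rewrite /T ler_pM2l//; apply: (@le_trans _ _ (\sum_k t k * v k - (\sum_k t k) * dl)).
    by rewrite lerD2l lerN2 ler_piMl// ltW.
  rewrite mulr_suml -sumrB; apply: ler_sum => k _; rewrite -mulrBr ler_wpM2l//.
  by rewrite le_max lexx orbT.
(* A factor below 1 that loses at most [e / 2] of [T] and is well defined and positive even for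
   [T = 0]. *)
pose c := (T + e / 4) / (T + e / 2).
have den : 0 < T + e / 2 by lra.
have c0 : 0 < c by rewrite divr_gt0//; lra.
have c1 : c < 1 by rewrite ltr_pdivrMr// mul1r; lra.
have cT : T - e / 2 <= c * T.
  rewrite -mulrA [_^-1 * _]mulrC mulrA ler_pdivlMr// -subr_ge0.
  rewrite (_ : _ - _ = e / 4 * T + (e / 2) ^+ 2); last by ring.
  by apply: addr_ge0; [apply: mulr_ge0 => //; lra|exact: sqr_ge0].
apply: le_trans (step dl c dl0 c0 c1); rewrite -EFinB lee_fin.
by apply: le_trans cT; rewrite -/T; lra.
Qed.

End slot_capacity.

(** * Allocation of power and time *)

Lemma minfrac_ge0 (R : realType) (a b c d : R) : 0 <= a -> 0 <= b -> 0 <= c -> 0 <= d ->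
  0 <= minfrac a b c d.
Proof.
move=> a0 b0 c0 d0; rewrite /minfrac; case: ifP => _; first by rewrite divr_ge0.
by case: ifP => _; rewrite ?le_min ?divr_ge0.
Qed.

Lemma minfrac_mul1 (R : realType) (a b c d : R) : 0 <= a -> 0 <= b ->
  minfrac a b c d * b <= a.
Proof.
move=> a0 b0; rewrite /minfrac; case: eqP => [->|/eqP bn]; first by rewrite mulr0.
have bp : 0 < b by rewrite lt_neqAle eq_sym bn.
by case: ifP => _; rewrite -ler_pdivlMr// ge_min lexx.
Qed.

Lemma minfrac_mul2 (R : realType) (a b c d : R) : 0 <= c -> 0 <= d ->
  minfrac a b c d * d <= c.
Proof.
move=> c0 d0; have [->|dn] := eqVneq d 0; first by rewrite mulr0.
have dp : 0 < d by rewrite lt_neqAle eq_sym dn.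
rewrite /minfrac (negbTE dn); case: ifP => _; rewrite -ler_pdivlMr//.
by rewrite ge_min lexx orbT.
Qed.

(** Multiplied by [y + z], the claim is the combination of the two bounds with weights [y] and
    [z]. *)
Lemma third_user_power (R : realType) (c y z t w : R) : 0 <= y -> 0 <= z -> 0 <= c ->
  t * (y + z) <= c -> w * (y + z) <= c -> y * t + z * w <= c.
Proof.
move=> y0 z0 c0 t2 w2; have [yz|yz] := eqVneq (y + z) 0.
  have [-> ->] : y = 0 /\ z = 0.
    by split; apply/eqP; rewrite eq_le; apply/andP; split; lra.
  by rewrite !mul0r addr0.
have yzp : 0 < y + z by rewrite lt_neqAle eq_sym yz addr_ge0.
rewrite -(ler_pM2l yzp) mulrDr.
have h1 : y * (t * (y + z)) <= y * c by rewrite ler_wpM2l.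
have h2 : z * (w * (y + z)) <= z * c by rewrite ler_wpM2l.
by nra.
Qed.

(** If [x <= y] then [2 * x * s] is at most [s * (x + y) <= b] and the rest is at most [b <= a]; the
    case [x <= z] is similar. Otherwise the powers are compared with the quotients [A] and [B]. *)
Lemma two_users_power (R : realType) (a b x y z s t w : R) :
  0 <= x -> 0 <= y -> 0 <= z -> 0 <= s -> y * t + z * w <= b -> b <= a ->
  s * (x + z) <= a -> s * (x + y) <= b -> t * (x + z) <= a -> w * (x + y) <= b ->
  2 * (x * s) + (y * t + z * w) <= a + b.
Proof.
move=> x0 y0 z0 s0 Q ab s1 s2 t1 w1.
have [xy|yx] := leP x y.
  have : x * s <= y * s by rewrite ler_wpM2r.
  have e : s * (x + y) = x * s + y * s by ring.
  by move: s2; rewrite e => *; lra.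
have [xz|zx] := leP x z.
  have : x * s <= z * s by rewrite ler_wpM2r.
  have e : s * (x + z) = x * s + z * s by ring.
  by move: s1; rewrite e => *; lra.
have xzp : 0 < x + z by lra.
have xyp : 0 < x + y by lra.
pose A := a / (x + z); pose B := b / (x + y).
have aE : a = x * A + z * A by rewrite -mulrDl mulrC divfK// gt_eqF.
have bE : b = x * B + y * B by rewrite -mulrDl mulrC divfK// gt_eqF.
have sA : x * s <= x * A by rewrite ler_wpM2l// ler_pdivlMr.
have sB : x * s <= x * B by rewrite ler_wpM2l// ler_pdivlMr.
have tA : y * t <= y * A by rewrite ler_wpM2l// ler_pdivlMr.
have wB : z * w <= z * B by rewrite ler_wpM2l// ler_pdivlMr.
clearbody A B; have [AB|BA] := leP A B.
  (* For [A <= B] the left side is at most [2 * x * A + y * A + z * B], which differs from [a + b]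
     by this product; the other case is symmetric. *)
  have : 0 <= (x + y - z) * (B - A) by apply: mulr_ge0; lra.
  by rewrite mulrBr !mulrBl !mulrDl; lra.
have : 0 <= (x + z - y) * (A - B) by apply: mulr_ge0; lra.
by rewrite mulrBr !mulrBl !mulrDl; lra.
Qed.

(** User 1 takes as much of the shared load [q] as its budget allows, and the bound on the total
    leaves the rest to user 2. *)
Lemma power_split (R : realType) (a b s q : R) : 0 <= q -> s <= b -> b <= a -> 2 * s + q <= a + b ->
  exists2 l, 0 <= l <= 1 & s + l * q <= a /\ s + (1 - l) * q <= b.
Proof.
move=> q0 sb ab T; have [qa|aq] := leP q (a - s).
  by exists 1; [rewrite ler01 lexx|split; lra].
have qp : 0 < q by lra.
exists ((a - s) / q).
  apply/andP; split; first by apply: divr_ge0; lra.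
  by rewrite ler_pdivrMr//; lra.
have e : (a - s) / q * q = a - s by rewrite divfK// gt_eqF.
by split; [rewrite e; lra|rewrite mulrBl mul1r e; lra].
Qed.

Lemma le_Cap (R : realType) (x y : R) : 0 <= x -> x <= y -> Cap x <= Cap y.
Proof.
move=> x0 xy; rewrite ler_wpM2r ?invr_ge0 ?mulr_ge0 ?ln_ge0 ?ler1n//.
by rewrite ler_ln ?posrE ?lerD2l ?ltr_pwDl// (le_trans x0).
Qed.

(* The pair {1,2} has slot 0. The fractions of [C3_objective] weighted by a23 and
   a31 have slots 1-2 and 3-4, each shared between the pairs {1,3} and {2,3}. *)
Definition slot_user (k : nat) (b : bool) : 'I_3 :=
  if k is 0 then if b then @Ordinal 3 1 isT else @Ordinal 3 0 isT
  else if b then @Ordinal 3 2 isT else if odd k then @Ordinal 3 0 isT else @Ordinal 3 1 isT.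

Lemma slot_user_neq k b : slot_user k b != slot_user k (~~ b).
Proof. by case: k => [|k]; case: b => //=; case: ifP. Qed.

Lemma sum_slots (R : realType) (f : 'I_5 -> R) (F : nat -> R) : (forall k, f k = F k) ->
  \sum_k f k = F 0%N + F 1%N + F 2%N + F 3%N + F 4%N.
Proof.
move=> fF; under eq_bigr do rewrite fF.
by rewrite !big_ord_recl big_ord0 addr0 !addrA.
Qed.

(** Replacing user 1 by user 2 opposite user 3 alters neither the uplink rate, which depends on the
    common received power, nor the downlink bound, set by [h3]. All powers are therefore measured at
    the relay, and only the budgets [a], [b], [c] constrain the split. *)
Lemma objective_le_capacity (R : realType) (d : measure_display) (Omega : measurableType d)
  (Pr : probability Omega R) (Z : nat -> option 'I_3 -> Omega -> R) (h1 h2 h3 P x y z : R) :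
  iid_std_normal Pr Z -> h2 ^+ 2 <= h1 ^+ 2 -> h3 ^+ 2 <= h2 ^+ 2 -> 0 < P ->
  0 <= x -> 0 <= y -> 0 <= z -> x + y + z = 1 ->
  ((C3_objective h1 h2 h3 P x y z)%:E <= sum_capacity Pr Z h1 h2 h3 P)%E.
Proof.
move=> iid h21 h32 P0 x0 y0 z0 xyz; rewrite /C3_objective.
have P0' := ltW P0.
set a := h1 ^+ 2 * P; set b := h2 ^+ 2 * P; set c := h3 ^+ 2 * P.
have ab : b <= a by rewrite ler_wpM2r.
have bc : c <= b by rewrite ler_wpM2r.
have c0 : 0 <= c by rewrite mulr_ge0// sqr_ge0.
have b0 := le_trans c0 bc; have a0 := le_trans b0 ab.
have xz0 : 0 <= x + z by rewrite addr_ge0.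
have xy0 : 0 <= x + y by rewrite addr_ge0.
have yz0 : 0 <= y + z by rewrite addr_ge0.
set s := minfrac a (x + z) b _; set t := minfrac a _ c _; set w := minfrac b _ c _.
have s0 : 0 <= s by exact: minfrac_ge0.
have t0 : 0 <= t by exact: minfrac_ge0.
have w0 : 0 <= w by exact: minfrac_ge0.
have Q := third_user_power y0 z0 c0 (minfrac_mul2 a (x + z) c0 yz0) (minfrac_mul2 b (x + y) c0 yz0).
have T := two_users_power x0 y0 z0 s0 (le_trans Q bc) ab (minfrac_mul1 b (x + y) a0 xz0)
  (minfrac_mul2 a (x + z) b0 xy0) (minfrac_mul1 c (y + z) a0 xz0) (minfrac_mul1 c (y + z) b0 xy0).
have xs : x * s <= b.
  have := minfrac_mul2 a (x + z) b0 xy0; rewrite -/s; apply: le_trans.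
  by rewrite mulrC ler_wpM2l// lerDl.
rewrite -/t -/w in Q T.
have q0 : 0 <= y * t + z * w by rewrite addr_ge0// mulr_ge0.
have [l /andP[l0 l1] [la lb]] := power_split q0 xs ab T.
have l1' : 0 <= 1 - l by rewrite subr_ge0.
set u := Num.min _ (Cap b); set v := Num.min _ (Cap c); set v' := Num.min _ (Cap c).
pose tF (k : nat) := match k with 0 => x | 1 => l * y | 2 => (1 - l) * y | 3 => l * z | _ => (1 - l) * z end.
pose SF (k : nat) := match k with 0 => s | 1 => t | 2 => t | _ => w end.
pose vF (k : nat) := match k with 0 => u | 1 => v | 2 => v | _ => v' end.
have -> : 2 * x * u + 2 * y * v + 2 * z * v' = 2 * \sum_(k < 5) tF k * vF k.
  by rewrite (sum_slots (F := fun k => tF k * vF k))//= ; ring.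
have vS (A B : R) : Num.min A B <= A by rewrite ge_min lexx.
have vC (A B C : R) : B <= C -> Num.min A B <= C.
  by move=> BC; rewrite ge_min BC orbT.
apply: (capacity_ge_slots iid P0 (fun k : 'I_5 => slot_user_neq k) (S := fun k : 'I_5 => SF k)).
- by case=> [[|[|[|[|[|//]]]]] ?] /=; rewrite ?mulr_ge0.
- by rewrite (sum_slots (F := tF))//=; lra.
- by case=> [[|[|[|[|[|//]]]]] ?].
- move=> j; rewrite (sum_slots (F := fun k =>
    \sum_b (if slot_user k b == j then tF k * SF k else 0)))// !big_bool /tF /SF.
  by case: j => [[|[|[|//]]] ?]; rewrite /gain /= -?/a -?/b -?/c; lra.
- by case=> [[|[|[|[|[|//]]]]] ?] /=; exact: vS.
(* The weaker gain of each pair limits its downlink: [h2] for {1,2}, [h3] for the others. *)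
case=> [[|[|[|[|[|//]]]]] ?] [] /=; apply: vC;
  by apply: le_Cap => //; exact: le_trans ab.
Qed.

Theorem theorem5 (R : realType) (d : measure_display) (Omega : measurableType d)
  (Pr : probability Omega R) (Z : nat -> option 'I_3 -> Omega -> R)
  (h1 h2 h3 P : R) :
  iid_std_normal Pr Z ->
  h2 ^+ 2 <= h1 ^+ 2 -> h3 ^+ 2 <= h2 ^+ 2 -> 0 < P ->
  ((C3_lower h1 h2 h3 P)%:E <= sum_capacity Pr Z h1 h2 h3 P)%E.
Proof.
move=> iid h21 h32 P0.
have H x y z : 0 <= x <= 1 -> 0 <= y <= 1 -> 0 <= z <= 1 -> x + y + z = 1 ->
    ((C3_objective h1 h2 h3 P x y z)%:E <= sum_capacity Pr Z h1 h2 h3 P)%E.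
  by move=> /andP[x0 _] /andP[y0 _] /andP[z0 _]; exact: objective_le_capacity.
(* One explicit allocation shows that the capacity is not [-oo] and that the supremum is over a
   nonempty set. *)
have H1 : ((C3_objective h1 h2 h3 P 1 0 0)%:E <= sum_capacity Pr Z h1 h2 h3 P)%E.
  by apply: H; rewrite ?lexx ?ler01 ?addr0.
move: H H1; case: (sum_capacity Pr Z h1 h2 h3 P) => [C|_ _|_]; [|exact: leey|by []].
move=> H H1; rewrite lee_fin /C3_lower; apply: ge_sup.
  by exists (C3_objective h1 h2 h3 P 1 0 0), 1, 0, 0; rewrite ?lexx ?ler01 ?addr0.
by move=> _ [x [y [z [x01 y01 z01 xyz ->]]]]; rewrite -lee_fin; exact: H.
Qed.
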